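(* Let $\Sigma$ be a fixed alphabet containing a special symbol $\#$, and let $\alpha(\beta/\delta)\gamma$ be an alignment of $A=\alpha\beta\gamma$ and $B=\alpha\delta\gamma$ (as defined in the context). Given the suffix tree of the string $A=\alpha\beta\gamma$, the suffix tree of the alignment $\alpha(\beta/\delta)\gamma$ can be constructed in $O(|\alpha^{*}|+|\delta|+|\hat{\gamma}|)$ time.
   Context: Alignment: $\alpha,\beta,\gamma,\delta$ are strings over $\Sigma$ with $\delta\neq\beta$; $\alpha$ may be empty; $\gamma$ is nonempty and contains the symbol $\#$, which is the last character of both $A$ and $B$ and occurs nowhere else in them; at most one of $\beta,\delta$ is empty; and the first characters of $\beta\gamma$ and $\delta\gamma$ are distinct. The notation $\alpha(\beta/\delta)\gamma$ denotes that $B$ is obtained from $A$ by replacing $\beta$ by $\delta$. Let $\alpha^{a}$ (resp. $\alpha^{b}$) be the longest suffix of $\alpha$ occurring at least twice in $A$ (resp. in $B$), and $\alpha^{*}$ the longer of $\alpha^a,\alpha^b$, i.e. the longest suffix of $\alpha$ occurring at least twice in $A$ or at least twice in $B$. Let $d$ be the character preceding $\gamma$ in $B$, and let $\hat{\gamma}$ be the longest prefix of $\gamma$ such that $d\hat{\gamma}$ occurs at least twice in $A$ and $B$ (occurrences in the two strings counted together). Alignment-suffixes (a-suffixes) of $\alpha(\beta/\delta)\gamma$ are of four types: (1) a suffix of $\gamma$; (2) a suffix of $\alpha^{*}\beta\gamma$ longer than $\gamma$; (3) a suffix of $\alpha^{*}\delta\gamma$ longer than $\gamma$; (4) $\alpha'(\beta/\delta)\gamma$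 where $\alpha'$ is a suffix of $\alpha$ longer than $\alpha^{*}$ (such an a-suffix stands for both $\alpha'\beta\gamma$ and $\alpha'\delta\gamma$). The suffix tree of the alignment is the compacted trie with one leaf per a-suffix, i.e. a rooted tree such that: each nonterminal arc is labeled with a nonempty substring of $A$ or $B$; each terminal arc is labeled with a nonempty suffix of $\beta\gamma$ or $\delta\gamma$, or with $\alpha'(\beta/\delta)\gamma$ for a nonempty suffix $\alpha'$ of $\alpha$; each internal node has at least two children and the labels of the arcs to its children begin with distinct symbols; and the root-to-leaf label concatenations are exactly the a-suffixes. The suffix tree of a string $S$ is the compacted trie of all suffixes of $S$, one leaf per suffix. Arc labels are stored in constant space as references into the strings. *)

(* Defs.v *)
From Stdlib Require List.
From mathcomp Require Import all_boot.

Set Implicit Arguments.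
Unset Strict Implicit.
Unset Printing Implicit Defensive.

(* A unit-cost RAM: structured programs over an infinite bank of registers and
   a flat memory addressed by natural numbers.  Since every step has unit cost
   on numbers of any size, arithmetic is limited to addition and truncated
   subtraction: no multiplication, shifts or bitwise operations. *)

Record state := State { reg : nat -> nat; mem : nat -> nat }.

Definition upd (f : nat -> nat) (k x : nat) : nat -> nat :=
  fun j => if j == k then x else f j.

Inductive expr :=
| Const of nat
| Reg of nat
| Add of expr & expr
| Sub of expr & expr
| MemRead of expr.

Inductive test :=
| TLe of expr & expr
| TEq of expr & expr
| TNot of test.

Inductive cmd :=
| Skip
| Assign of nat & expr
| MemWrite of expr & expr
| Seq of cmd & cmd
| If of test & cmd & cmd
| While of test & cmd.

Fixpoint eval (s : state) (e : expr) : nat :=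
  match e with
  | Const n => n
  | Reg r => reg s r
  | Add e1 e2 => eval s e1 + eval s e2
  | Sub e1 e2 => eval s e1 - eval s e2
  | MemRead e1 => mem s (eval s e1)
  end.

Fixpoint teval (s : state) (b : test) : bool :=
  match b with
  | TLe e1 e2 => eval s e1 <= eval s e2
  | TEq e1 e2 => eval s e1 == eval s e2
  | TNot b1 => ~~ teval s b1
  end.

Fixpoint ecost (e : expr) : nat :=
  match e with
  | Const _ | Reg _ => 1
  | Add e1 e2 | Sub e1 e2 => (ecost e1 + ecost e2).+1
  | MemRead e1 => (ecost e1).+1
  end.

Fixpoint tcost (b : test) : nat :=
  match b with
  | TLe e1 e2 | TEq e1 e2 => (ecost e1 + ecost e2).+1
  | TNot b1 => (tcost b1).+1
  end.

(* [exec p s T s']: started in [s], [p] halts in [s'] after [T] time units. *)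
Inductive exec : cmd -> state -> nat -> state -> Prop :=
| ExecSkip s : exec Skip s 1 s
| ExecAssign s r e :
    exec (Assign r e) s (ecost e).+1 (State (upd (reg s) r (eval s e)) (mem s))
| ExecMemWrite s e1 e2 :
    exec (MemWrite e1 e2) s (ecost e1 + ecost e2).+1
         (State (reg s) (upd (mem s) (eval s e1) (eval s e2)))
| ExecSeq p q s s1 s2 T1 T2 :
    exec p s T1 s1 -> exec q s1 T2 s2 -> exec (Seq p q) s (T1 + T2) s2
| ExecIf b p q s s1 T :
    exec (if teval s b then p else q) s T s1 ->
    exec (If b p q) s (tcost b + T) s1
| ExecWhileF b p s : ~~ teval s b -> exec (While b p) s (tcost b) s
| ExecWhileT b p s s1 s2 T1 T2 :
    teval s b -> exec p s T1 s1 -> exec (While b p) s1 T2 s2 ->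
    exec (While b p) s (tcost b + T1 + T2) s2.

Section Strings.
Variable Sigma : finType.
Implicit Types (w S : seq Sigma).

(* The empty string occurs [size S + 1] times in [S]. *)
Definition occ w S : nat :=
  count (fun i => prefix w (drop i S)) (iota 0 (size S).+1).

(* The longest suffix (prefix) of [S] satisfying [P]; empty if there is none. *)
Definition longest_suffix (P : pred (seq Sigma)) S : seq Sigma :=
  let c := [seq drop i S | i <- iota 0 (size S).+1] in nth [::] c (find P c).

Definition longest_prefix (P : pred (seq Sigma)) S : seq Sigma :=
  let c := [seq take (size S - i) S | i <- iota 0 (size S).+1] in
  nth [::] c (find P c).

Record alignment (hash : Sigma) (alpha beta delta gamma : seq Sigma) : Prop :=
  Alignment {
    align_neq : delta != beta;
    align_gamma : gamma != [::];
    align_hash_gamma : hash \in gamma;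
    align_hash_A : exists2 A', alpha ++ beta ++ gamma = rcons A' hash
                             & hash \notin A';
    align_hash_B : exists2 B', alpha ++ delta ++ gamma = rcons B' hash
                             & hash \notin B';
    align_empty : ~~ ((beta == [::]) && (delta == [::]));
    align_first : ohead (beta ++ gamma) != ohead (delta ++ gamma)
  }.

Definition alpha_rep alpha S : seq Sigma :=
  longest_suffix (fun w => 2 <= occ w S) alpha.

Definition alpha_star alpha beta delta gamma : seq Sigma :=
  let a := alpha_rep alpha (alpha ++ beta ++ gamma) in
  let b := alpha_rep alpha (alpha ++ delta ++ gamma) in
  if size b <= size a then a else b.

(* The character [d] preceding [gamma] in [B] does not exist when [alpha] and
   [delta] are both empty; also, [d] itself may occur only once.  In both cases
   [gamma_hat] is empty. *)
Definition gamma_hat alpha beta delta gamma : seq Sigma :=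
  let A := alpha ++ beta ++ gamma in
  let B := alpha ++ delta ++ gamma in
  match ohead (rev (alpha ++ delta)) with
  | Some d => longest_prefix (fun w => 2 <= occ (d :: w) A + occ (d :: w) B) gamma
  | None => [::]
  end.

(* [Plain w] is the string [w]; [Aligned w], relative to an alignment
   alpha(beta/delta)gamma, is w(beta/delta)gamma.  Both forms serve as
   a-suffixes and as arc labels. *)

Inductive asuffix := Plain of seq Sigma | Aligned of seq Sigma.

Definition first (l : asuffix) : option Sigma :=
  match l with Plain w | Aligned w => ohead w end.

Definition extend w (l : asuffix) : asuffix :=
  match l with Plain v => Plain (w ++ v) | Aligned v => Aligned (w ++ v) end.

(* The number carried by a node is its name, used below as its address. *)
Inductive tree :=
| Leaf of nat
| Node of nat & seq (asuffix * tree).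

Definition name (t : tree) : nat :=
  match t with Leaf v => v | Node v _ => v end.

Fixpoint names (t : tree) : seq nat :=
  match t with
  | Leaf v => [:: v]
  | Node v arcs => v :: flatten [seq names a.2 | a <- arcs]
  end.

(* [node_at t x u]: [u] is (the subtree at) the node of [t] such that the
   labels on the path from the root to it concatenate to [x]. *)
Inductive node_at (t : tree) : asuffix -> tree -> Prop :=
| AtRoot : node_at t (Plain [::]) t
| AtChild w v arcs l u :
    node_at t (Plain w) (Node v arcs) -> List.In (l, u) arcs ->
    node_at t (extend w l) u.

(* [inner], [term]: admissible labels of nonterminal and terminal arcs;
   [word]: the set of root-to-leaf words.  Labels are nonempty, so that
   [w != [::]] says that the node is not the root; the root is exempted because
   the suffix tree of a one-character string has a root with one child. *)
Definition compacted_trie (inner : pred (seq Sigma)) (term word : pred asuffix)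
    (t : tree) : Prop :=
  [/\ exists v arcs, t = Node v arcs,
      forall w v arcs, node_at t (Plain w) (Node v arcs) ->
        [/\ w != [::] -> 2 <= size arcs,
            uniq [seq first a.1 | a <- arcs],
            forall l v' arcs', List.In (l, Node v' arcs') arcs ->
              exists2 x, l = Plain x & (x != [::]) && inner x
          & forall l v', List.In (l, Leaf v') arcs -> term l]
    & forall x, word x <-> exists v, node_at t x (Leaf v)].

Definition nonempty_suffix_of S (x : asuffix) : bool :=
  match x with
  | Plain w => (w != [::]) && suffix w S
  | Aligned _ => false
  end.

Definition suffix_tree S (t : tree) : Prop :=
  compacted_trie (fun w => infix w S) (nonempty_suffix_of S)
                 (nonempty_suffix_of S) t.

Definition is_asuffix alpha beta delta gamma (x : asuffix) : bool :=
  let alphas := alpha_star alpha beta delta gamma in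
  match x with
  | Plain w =>
      (w != [::]) &&
      [|| suffix w gamma,
          suffix w (alphas ++ beta ++ gamma) && (size gamma < size w)
        | suffix w (alphas ++ delta ++ gamma) && (size gamma < size w)]
  | Aligned w => suffix w alpha && (size alphas < size w)
  end.

Definition alignment_terminal alpha beta delta gamma (l : asuffix) : bool :=
  match l with
  | Plain w => (w != [::]) && (suffix w (beta ++ gamma) || suffix w (delta ++ gamma))
  | Aligned w => (w != [::]) && suffix w alpha
  end.

Definition alignment_suffix_tree alpha beta delta gamma (t : tree) : Prop :=
  compacted_trie
    (fun w => infix w (alpha ++ beta ++ gamma) || infix w (alpha ++ delta ++ gamma))
    (alignment_terminal alpha beta delta gamma)
    (is_asuffix alpha beta delta gamma) t
  /\ (forall v arcs, t = Node v arcs -> 2 <= size arcs).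

Definition code (c : Sigma) : nat := enum_rank c.

Definition string_at (m : nat -> nat) (p : nat) w : Prop :=
  [seq m i | i <- iota p (size w)] = [seq code c | c <- w].

(* A node at address [v] occupies [rec_size] cells:
     v      0 for a leaf, 1 for an internal node;
     v+1    which string the label of the incoming arc refers to;
     v+2    the position in that string where the label starts;
     v+3    the position where it ends (exclusive; not used by leaves);
     v+4    the suffix link (internal nodes other than the root);
     v+5+c  the child whose arc label begins with the character of code [c],
            or the null address 0 (internal nodes). *)
Definition rec_size : nat := 5 + #|Sigma|.

Definition child (arcs : seq (asuffix * tree)) (c : Sigma) : nat :=
  nth 0 [seq name a.2 | a <- arcs] (find (fun a => first a.1 == Some c) arcs).

(* [strs] lists the strings that labels may refer to.  A terminal label is
   given by its start [i] in the string [S] only, and is decoded by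
   [dec S i]. *)
Definition label_at (strs : seq (seq Sigma)) (dec : seq Sigma -> nat -> asuffix)
    (m : nat -> nat) (l : asuffix) (u : tree) : Prop :=
  exists2 S, onth strs (m (name u + 1)) = Some S &
  let i := m (name u + 2) in
  match u with
  | Leaf _ => l = dec S i
  | Node _ _ =>
      let j := m (name u + 3) in
      j <= size S /\ l = Plain (take (j - i) (drop i S))
  end.

Definition tree_at (strs : seq (seq Sigma)) (dec : seq Sigma -> nat -> asuffix)
    (m : nat -> nat) (t : tree) : Prop :=
  [/\ forall x v, node_at t x (Leaf v) -> m v = 0,
      forall x v arcs, node_at t x (Node v arcs) ->
        [/\ m v = 1,
            forall c, m (v + 5 + code c) = child arcs c
          & forall l u, List.In (l, u) arcs -> label_at strs dec m l u]
    & forall c w v arcs, node_at t (Plain (c :: w)) (Node v arcs) ->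
        exists v' arcs', node_at t (Plain w) (Node v' arcs') /\ m (v + 4) = v'].

Definition dec_string S (i : nat) : asuffix := Plain (drop i S).

(* A terminal label starting at [i] within the common prefix [alpha] stands for
   both continuations. *)
Definition dec_alignment alpha S (i : nat) : asuffix :=
  if i < size alpha then Aligned (drop i alpha) else Plain (drop i S).

End Strings.

Definition rA : nat := 0.
Definition rD : nat := 1.
Definition rAlphaLen : nat := 2.
Definition rBetaLen : nat := 3.
Definition rDeltaLen : nat := 4.
Definition rGammaLen : nat := 5.
Definition rRoot : nat := 6.
Definition rFree : nat := 7.

(* The memory holds [A] (at [rA]), [delta] (at [rD]) and the tree [t] (rooted at
   [rRoot]) in pairwise disjoint nonnull cells, all below the address in
   [rFree].  Nothing is assumed about other registers and cells. *)
Definition stored (Sigma : finType) (alpha beta delta gamma : seq Sigma)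
    (strs : seq (seq Sigma)) (dec : seq Sigma -> nat -> asuffix Sigma)
    (t : tree Sigma) (s : state) : Prop :=
  let A := alpha ++ beta ++ gamma in
  let cells := iota (reg s rA) (size A) ++ iota (reg s rD) (size delta)
               ++ flatten [seq iota v (rec_size Sigma) | v <- names t] in
  [/\ [/\ reg s rAlphaLen = size alpha, reg s rBetaLen = size beta,
          reg s rDeltaLen = size delta & reg s rGammaLen = size gamma],
      string_at (mem s) (reg s rA) A /\ string_at (mem s) (reg s rD) delta,
      uniq cells /\ all (fun x => 0 < x < reg s rFree) cells,
      reg s rRoot = name t
    & tree_at strs dec (mem s) t].

Definition stored_string_tree (Sigma : finType)
    (alpha beta delta gamma : seq Sigma) (t : tree Sigma) (s : state) : Prop :=
  suffix_tree (alpha ++ beta ++ gamma) t /\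
  stored alpha beta delta gamma [:: alpha ++ beta ++ gamma]
         (@dec_string Sigma) t s.

Definition stored_alignment_tree (Sigma : finType)
    (alpha beta delta gamma : seq Sigma) (t : tree Sigma) (s : state) : Prop :=
  alignment_suffix_tree alpha beta delta gamma t /\
  stored alpha beta delta gamma
         [:: alpha ++ beta ++ gamma; alpha ++ delta ++ gamma]
         (dec_alignment alpha) t s.

(* Main.v *)
(* The suffixes of alpha^a delta gamma longer than gamma, and then those of alpha* delta gamma
   longer than alpha^a delta gamma, are inserted into the suffix tree of A in order of decreasing
   length, as in McCreight's algorithm: the suffix link of the node at which the previous suffix
   was attached leads to the node from which the next one is located.  The right end of the
   matched part of B never moves left and, by the choice of gamma_hat, never passes gamma_hat, so
   the total time is linear in |alpha*| + |delta| + |gamma_hat|.  The arc of a leaf p of A with p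
   before alpha* starts within alpha and needs no change: it is read as alpha'(beta/delta)gamma.

   The suffix alpha^a is found by trying suffixes of alpha of lengths 1, 3, 7, ...: the suffixes
   of the tried one are located one after the other, along suffix links, until one of them does
   not end inside the arc of a leaf, so the time is proportional to the length of the answer.
   Once alpha^a delta gamma has been inserted, the same search finds alpha*, except when the second
   occurrence of alpha* in B is the beginning of a suffix alpha* beta gamma of B; as this is also a
   suffix of A, no second leaf witnesses it, but then alpha* beta is a suffix of alpha delta, and
   the longest common suffix of alpha beta and alpha delta reveals it. *)

From Stdlib Require ClassicalEpsilon.
Require Import Defs.
From mathcomp Require Import all_boot zify.
Import Defs.

Set Implicit Arguments.
Unset Strict Implicit.
Unset Printing Implicit Defensive.

(** * Programs with straight-line bodies and loops *)

(** Time and memory are studied on sets of words, not on tree terms. A set [W] of words ending in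
    [hash] determines its compacted trie: the inner nodes are given by [br W], the leaves by [W],
    and arcs join consecutive nodes of a path. The invariant [rep] gives an address to every node,
    so a destructive update is matched with a change of [W]. Terms of type [tree] appear only where
    the input is read ([inv_of_stored]) and where the output is produced ([build]).

    Following suffix links requires that the tail of each word be a word as well. During an
    insertion this fails for one tail at most, that of the suffix inserted last, and this tail is
    inserted next. Each round of insertions must therefore stop at a suffix of B that is already a
    word: [gamma] for the first round, the suffix with which the first round began for the second.
    Suffixes of B enter in two rounds because a repetition within B shows up in the trie only
    through suffixes of B; those of the first round suffice to reveal it. *)

Fixpoint run (p : cmd) (s : state) : state :=
  match p with
  | Skip | While _ _ => s
  | Assign r e => State (upd (reg s) r (eval s e)) (mem s)
  | MemWrite e1 e2 => State (reg s) (upd (mem s) (eval s e1) (eval s e2))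
  | Seq p q => run q (run p s)
  | If b p q => if teval s b then run p s else run q s
  end.

Fixpoint loopfree (p : cmd) : bool :=
  match p with
  | While _ _ => false
  | Seq p q | If _ p q => loopfree p && loopfree q
  | _ => true
  end.

(** The time of a loop-free program is bounded independently of the state; a conditional is simply
    charged for both branches. *)
Fixpoint cmax (p : cmd) : nat :=
  match p with
  | Skip | While _ _ => 1
  | Assign r e => (ecost e).+1
  | MemWrite e1 e2 => (ecost e1 + ecost e2).+1
  | Seq p q => cmax p + cmax q
  | If b p q => tcost b + (cmax p + cmax q)
  end.

Lemma exec_run p s : loopfree p -> exists2 T, exec p s T (run p s) & T <= cmax p.
Proof.
elim: p s => //= [|r e|e1 e2|p IHp q IHq|b p IHp q IHq] s.
- by move=> _; exists 1 => //; constructor.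
- by move=> _; exists (ecost e).+1 => //; constructor.
- by move=> _; exists (ecost e1 + ecost e2).+1 => //; constructor.
- case/andP=> lp lq; have [T1 e1 l1] := IHp s lp; have [T2 e2 l2] := IHq (run p s) lq.
  by exists (T1 + T2); [apply: ExecSeq e1 e2 | lia].
case/andP=> lp lq; have [T1 e1 l1] := IHp s lp; have [T2 e2 l2] := IHq s lq.
case E: (teval s b).
  by exists (tcost b + T1); [apply: ExecIf; rewrite E | lia].
by exists (tcost b + T2); [apply: ExecIf; rewrite E | lia].
Qed.

(** Total correctness with the time passed to the postcondition, so that costs add up along a
    sequence of commands. *)
Definition runs (p : cmd) (s : state) (R : nat -> state -> Prop) : Prop :=
  exists T s', exec p s T s' /\ R T s'.

Lemma runs_run p s (R : nat -> state -> Prop) : loopfree p ->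
  (forall T, T <= cmax p -> R T (run p s)) -> runs p s R.
Proof. by move=> lp H; have [T e l] := exec_run s lp; exists T, (run p s); split; last exact: H. Qed.

Lemma runs_seq p q s (R : nat -> state -> Prop) :
  runs p s (fun T1 s1 => runs q s1 (fun T2 s2 => R (T1 + T2) s2)) -> runs (Seq p q) s R.
Proof.
case=> T1 [s1 [e1 [T2 [s2 [e2 r]]]]]; exists (T1 + T2), s2; split=> //.
exact: ExecSeq e1 e2.
Qed.

Lemma runs_impl p s (R R' : nat -> state -> Prop) :
  runs p s R -> (forall T s', R T s' -> R' T s') -> runs p s R'.
Proof. by move=> [T [s' [e r]]] H; exists T, s'; split=> //; apply: H. Qed.

Lemma tcost_gt0 b : 0 < tcost b. Proof. by case: b. Qed.

(* [Phi] is a potential: it pays for every iteration, which also bounds their number. *)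
Lemma runs_while b p (I : state -> Prop) (Phi : state -> nat) s :
  (forall s, I s -> teval s b ->
     runs p s (fun T s' => I s' /\ T + tcost b + Phi s' <= Phi s)) ->
  I s ->
  runs (While b p) s
    (fun T s' => [/\ I s', ~~ teval s' b & T + Phi s' <= Phi s + tcost b]).
Proof.
move=> body; have [n] := ubnP (Phi s); elim: n s => // n IH s lt_n Is.
have := tcost_gt0 b; case E: (teval s b) => tc.
  have [T1 [s1 [e1 [I1 l1]]]] := body _ Is E.
  have [|T2 [s2 [e2 [I2 nb l2]]]] := IH s1 _ I1; first lia.
  exists (tcost b + T1 + T2), s2; split; first exact: ExecWhileT E e1 e2.
  by split=> //; lia.
exists (tcost b), s; split; first by apply: ExecWhileF; rewrite E.
by split=> //; rewrite ?E //; lia.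
Qed.

(** * Compacted tries described by their sets of words *)

Section Trie.
Variables (Sigma : finType) (hash : Sigma).
Notation word := (seq Sigma).
Implicit Types (W : seq word) (u v w x y z : word) (N : pred word).

(* [size_prefix] with carrier [Finite.sort Sigma]: [lia] does not identify it with [Equality.sort]. *)
Lemma size_pfx u v : prefix u v -> size u <= size v.
Proof. exact: size_prefix. Qed.

Lemma prefix_comparable u v w : prefix u w -> prefix v w -> size u <= size v -> prefix u v.
Proof.
rewrite !prefixE => /eqP hu /eqP hv le.
by rewrite -{1}hv take_takel ?hu.
Qed.

Lemma prefix_size_eq u v : prefix u v -> size v <= size u -> u = v.
Proof. by rewrite prefixE => /eqP e le; rewrite -e take_oversize. Qed.

Lemma prefix_rcons_inj u c d w : prefix (rcons u c) w -> prefix (rcons u d) w -> c = d.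
Proof.
move=> h1 h2; have h : prefix (rcons u c) (rcons u d).
  by apply: (prefix_comparable h1 h2 _); rewrite !size_rcons.
by have /rcons_inj [] : rcons u c = rcons u d by apply: prefix_size_eq h _; rewrite !size_rcons.
Qed.

Lemma prefix_rconsl u c w : prefix (rcons u c) w -> prefix u w.
Proof. by apply: prefix_trans; rewrite prefix_rcons. Qed.

Lemma prefix_next b u w : prefix u w -> size u < size w -> prefix (rcons u (nth b w (size u))) w.
Proof.
move=> /prefixP [v ->]; rewrite size_cat nth_cat ltnn subnn.
case: v => [|c v]; rewrite ?addn0 ?ltnn // => _.
by rewrite -cat_rcons prefix_prefix.
Qed.

Lemma nth_prefix b u w i : prefix u w -> i < size u -> nth b w i = nth b u i.
Proof. by move=> /prefixP [v ->] h; rewrite nth_cat h. Qed.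

Lemma lcp_cases y w : exists p, [/\ prefix p y, prefix p w &
  [\/ p = y, p = w | exists c1 c2, [/\ c1 != c2, prefix (rcons p c1) y & prefix (rcons p c2) w]]].
Proof.
elim: y w => [|c y IH] [|d w].
- by exists [::]; split=> //; constructor 1.
- by exists [::]; split=> //; constructor 1.
- by exists [::]; split=> //; constructor 2.
case: (eqVneq c d) => [<-|ne].
  have [p [h1 h2 h3]] := IH w; exists (c :: p); split; rewrite ?prefix_cons ?eqxx //.
  case: h3 => [->|->|[c1 [c2 [n h h']]]]; [constructor 1|constructor 2|constructor 3] => //.
  by exists c1, c2; rewrite /= !eqxx /=; split.
exists [::]; split=> //; constructor 3; exists c, d; rewrite /= !eqxx /=.
by split=> //; apply: prefix0s.
Qed.

Definition pre W u := has (prefix u) W.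
(** The inner nodes of the compacted trie of [W]; the root is one whatever its degree. *)
Definition br W x := (x == [::]) || (1 < #|[pred c | pre W (rcons x c)]|).
(** The terminator makes [W] prefix-free, so that every word ends in a leaf. *)
Definition hterm W := forall w, w \in W -> exists2 w', w = rcons w' hash & hash \notin w'.

Lemma preP W u : reflect (exists2 w, w \in W & prefix u w) (pre W u).
Proof. exact: hasP. Qed.

Lemma brP W x : reflect
  (x = [::] \/ exists c1 c2, [/\ c1 != c2, pre W (rcons x c1) & pre W (rcons x c2)]) (br W x).
Proof.
rewrite /br; case: eqP => [->|nx]; first by constructor; left.
rewrite orFb.
apply: (iffP card_gt1P) => [[c1 [c2 [h1 h2 ne]]]|].
  by right; exists c1, c2; rewrite !inE in h1 h2.
by case=> // -[c1 [c2 [ne h1 h2]]]; exists c1, c2; rewrite !inE.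
Qed.

Lemma pre_prefix W u v : prefix u v -> pre W v -> pre W u.
Proof. by move=> p /preP [w wW h]; apply/preP; exists w => //; apply: prefix_trans h. Qed.

Lemma word_pre W w : w \in W -> pre W w.
Proof. by move=> h; apply/preP; exists w => //; apply: prefix_refl. Qed.

Lemma br_pre W x : br W x -> x != [::] -> pre W x.
Proof.
case/brP=> [-> //|[c [_ [_ h _]]] _]; apply: pre_prefix h; exact: prefix_rcons.
Qed.

Lemma hterm_inj W v w u : hterm W -> v \in W -> w \in W -> prefix v u -> prefix w u -> v = w.
Proof.
move=> hW; wlog le : v w / size v <= size w => [hwlog vW wW pv pw|].
  case: (leqP (size v) (size w)) => le; first exact: hwlog.
  by symmetry; apply: hwlog => //; apply: ltnW.
move=> vW wW pv pw; have pvw := prefix_comparable pv pw le.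
apply: prefix_size_eq => //; have [v' ev _] := hW _ vW; have [w' ew nw] := hW _ wW.
rewrite leqNgt; apply/negP => lt; case/negP: nw.
have : prefix v w' by apply: prefix_comparable pvw _ _; rewrite ?ew ?prefix_rcons //; move: lt; rewrite ew size_rcons.
by rewrite ev => /prefixP [t ->]; rewrite mem_cat mem_rcons inE eqxx.
Qed.

Lemma word_max W w v : hterm W -> w \in W -> pre W v -> prefix w v -> v = w.
Proof.
move=> hW wW /preP [w2 w2W p2] p; have e := hterm_inj hW wW w2W (prefix_trans p p2) (prefix_refl _).
by symmetry; apply: prefix_size_eq => //; rewrite e; apply: size_prefix p2.
Qed.

Lemma br_notin W x : hterm W -> br W x -> x \notin W.
Proof.
move=> hW /brP [->|[c [_ [_ h _]]]]; apply/negP => xW.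
  by have [[] ] := hW _ xW.
by have := word_max hW xW h (prefix_rcons _ _) => /(congr1 size); rewrite size_rcons; lia.
Qed.

Definition nd N W z := N z || (z \in W).
(** All that the theory of arcs asks of a set of inner nodes: extra nodes of degree one are
    tolerated. *)
Definition goodN N W := (forall z, br W z -> N z) /\ (forall z, N z -> z \notin W /\ (z != [::] -> pre W z)).
(** The arcs of the trie: [y] is the first node strictly below [x] on its path. *)
Definition edge N W x y :=
  [/\ N x, nd N W y, prefix x y, size x < size y &
      forall z, nd N W z -> prefix z y -> size x < size z -> z = y].

Lemma goodN_br W : hterm W -> goodN (br W) W.
Proof. by move=> hW; split=> // z h; split; [apply: br_notin | apply: br_pre]. Qed.

Section EdgeTheory.
Variables (N : pred word) (W : seq word).
Hypotheses (hW : hterm W) (gN : goodN N W).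

Lemma goodN0 : N [::]. Proof. by apply: gN.1; apply/brP; left. Qed.

Lemma nd_pre z : nd N W z -> z != [::] -> pre W z.
Proof. by case/orP=> [/(gN.2 _) []|/word_pre]. Qed.

Lemma edge_pre x y : edge N W x y -> pre W y.
Proof. by case=> _ ny _ lt _; apply: nd_pre => //; case: y lt {ny}. Qed.

(** Nothing leaves an arc in its middle: the point where [z] and [y] part would be a branching word,
    hence a node strictly inside the arc. *)
Lemma edge_cmp x y z : edge N W x y -> pre W z -> prefix x z ->
  (exists2 c, prefix (rcons x c) y & prefix (rcons x c) z) -> prefix y z \/ prefix z y.
Proof.
move=> ed /preP [w wW pzw] pxz [c hy hz].
have py := edge_pre ed; case: ed => Nx ny pxy lt between.
have [p [ppy ppw]] := lcp_cases y w; case=> [e|e|[c1 [c2 [ne h1 h2]]]].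
- rewrite e in ppw; case: (leqP (size y) (size z)) => le; [left|right].
    exact: prefix_comparable ppw pzw le.
  exact: prefix_comparable pzw ppw (ltnW le).
- by right; rewrite (word_max hW wW py) // -e.
have lp : size x < size p.
  rewrite ltnNge; apply/negP => le; case/eqP: ne.
  apply: (@prefix_rcons_inj p _ _ w) h2.
  apply: prefix_trans (prefix_trans hz pzw).
  by apply: (prefix_comparable h1 hy _); rewrite !size_rcons.
have bp : br W p.
  apply/brP; right; exists c1, c2; split=> //; first exact: pre_prefix h1 py.
  by apply/preP; exists w.
have e : p = y by apply: between => //; rewrite /nd gN.1.
by move: (size_pfx h1); rewrite e size_rcons ltnn.
Qed.

Lemma edge_ex x c : N x -> pre W (rcons x c) -> exists2 y, edge N W x y & prefix (rcons x c) y.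
Proof.
move=> Nx /preP [w wW pw].
have ex : exists n, (size x < n <= size w) && nd N W (take n w).
  exists (size w); rewrite take_size /nd wW orbT leqnn !andbT.
  by move: (size_pfx pw); rewrite size_rcons.
case: (ex_minnP ex) => n /andP [/andP [ln nw] ndn] mn.
have sz : size (take n w) = n by rewrite size_takel.
exists (take n w).
  split=> //; last first.
  - move=> z ndz pz lz; apply: prefix_size_eq => //; rewrite sz.
    have zw : prefix z w by apply: prefix_trans pz (prefix_take _ _).
    apply: mn; move: (zw); rewrite prefixE => /eqP ->.
    by rewrite lz ndz (size_pfx zw).
  - by rewrite sz.
  apply: (prefix_comparable (prefix_rconsl pw) (prefix_take _ _) _).
  by rewrite sz ltnW.
by apply: (prefix_comparable pw (prefix_take _ _) _); rewrite sz size_rcons.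
Qed.

Lemma edge_uniq x y y' c : edge N W x y -> edge N W x y' ->
  prefix (rcons x c) y -> prefix (rcons x c) y' -> y = y'.
Proof.
move=> ed ed' h h'.
have := edge_cmp ed (edge_pre ed') (prefix_rconsl h') (ex_intro2 _ _ c h h').
case: ed ed' => _ n1 _ l1 b1 [_ n2 _ l2 b2].
by case=> p; [apply: b2 | symmetry; apply: b1].
Qed.

Lemma edge_parent_uniq x x' y : edge N W x y -> edge N W x' y -> x = x'.
Proof.
have aux a b : edge N W a y -> edge N W b y -> size b <= size a.
  move=> [Na na pa la ba] [Nb nb pb lb bb]; rewrite leqNgt; apply/negP => lt.
  have : b = y by apply: ba => //; rewrite /nd Nb.
  by move=> e; move: lb; rewrite e ltnn.
move=> h1 h2; have l1 := aux _ _ h1 h2; have l2 := aux _ _ h2 h1.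
case: h1 h2 => _ _ p1 _ _ [_ _ p2 _ _].
by apply: prefix_size_eq l1; apply: (prefix_comparable p1 p2 _).
Qed.

Lemma parent_ex y : nd N W y -> y != [::] -> exists x, edge N W x y.
Proof.
move=> ny yn.
have ex : exists n, (n < size y) && N (take n y).
  by exists 0; rewrite take0 goodN0 andbT lt0n size_eq0.
have bd n : (n < size y) && N (take n y) -> n <= size y by case/andP => /ltnW.
case: (ex_maxnP ex bd) => n /andP [ln Nn] mn.
have sz : size (take n y) = n by rewrite size_takel // ltnW.
exists (take n y); split=> //; rewrite ?sz ?prefix_take // => z /orP [Nz|zW] pz lz.
  apply: prefix_size_eq => //; rewrite leqNgt; apply/negP => lt.
  have := mn (size z); move: (pz); rewrite prefixE => /eqP ->; rewrite Nz lt => /(_ isT).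
  lia.
by rewrite (word_max hW zW (nd_pre ny yn) pz).
Qed.

End EdgeTheory.

Definition two W u := has (fun v1 => has (fun v2 => [&& v1 != v2, prefix u v1 & prefix u v2]) W) W.

Lemma twoP W u : reflect (exists v1 v2, [/\ v1 \in W, v2 \in W, v1 != v2, prefix u v1 & prefix u v2]) (two W u).
Proof.
apply: (iffP hasP) => [[v1 h1 /hasP [v2 h2 /and3P [n p1 p2]]]|[v1 [v2 [h1 h2 n p1 p2]]]].
  by exists v1, v2.
by exists v1 => //; apply/hasP; exists v2 => //; apply/and3P.
Qed.

Lemma two_prefix W u v : prefix u v -> two W v -> two W u.
Proof.
move=> p /twoP [v1 [v2 [h1 h2 n p1 p2]]]; apply/twoP; exists v1, v2.
by split=> //; apply: prefix_trans p _.
Qed.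

Lemma br_two W x : br W x -> x != [::] -> two W x.
Proof.
case/brP=> [-> //|[c1 [c2 [ne /preP [v1 h1 p1] /preP [v2 h2 p2]]]] _].
apply/twoP; exists v1, v2; split=> //; try exact: prefix_rconsl.
- by apply/eqP => e; rewrite e in p1; case/eqP: ne; apply: prefix_rcons_inj p1 p2.
- exact: prefix_rconsl p1.
- exact: prefix_rconsl p2.
Qed.

Section Insertion.
Variables (W : seq word) (w cur : word) (c : Sigma).
Hypotheses (hW : hterm W) (pc : pre W cur) (pw : prefix (rcons cur c) w)
  (npre : ~~ pre W (rcons cur c)) (hcur : cur \notin W).

Lemma pre_insert u : pre (w :: W) u = prefix u w || pre W u. Proof. by []. Qed.

(** Up to [cur] the new word runs along old words, and past [cur] it is alone, so a new fork can
    arise only at [cur] itself. *)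
Lemma br_insert x : br (w :: W) x = (x == cur) || br W x.
Proof.
have pcw : prefix cur w := prefix_rconsl pw.
apply/idP/idP.
  case/brP=> [->|]; first by rewrite orbC /br eqxx.
  move=> [c1 [c2 [ne]]]; rewrite !pre_insert.
  case: eqP => //= nx h1 h2.
  have key d : prefix (rcons x d) w -> pre W (rcons x d) \/ (size cur < size x /\ prefix (rcons cur c) x).
    move=> p; case: (ltngtP (size x) (size cur)) => [lt|lt|e].
    - left; apply: pre_prefix pc; apply: (prefix_comparable p pcw _); by rewrite size_rcons.
    - right; split=> //; apply: (prefix_comparable pw (prefix_rconsl p) _); by rewrite size_rcons.
    - case: nx; apply: prefix_size_eq; last by rewrite e.
      by apply: (prefix_comparable (prefix_rconsl p) pcw _); rewrite e.
  have nox d : prefix (rcons cur c) x -> pre W (rcons x d) -> False.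
    move=> p /(pre_prefix (prefix_trans p (prefix_rcons _ _))); by rewrite (negbTE npre).
  apply/brP; right; exists c1, c2; split=> //.
    case/orP: h1 => // p1; case: (key _ p1) => // -[_ px].
    case/orP: h2 => [p2|/(nox _ px) []]; case/eqP: ne; exact: prefix_rcons_inj p1 p2.
  case/orP: h2 => // p2; case: (key _ p2) => // -[_ px].
  case/orP: h1 => [p1|/(nox _ px) []]; case/eqP: ne; exact: prefix_rcons_inj p1 p2.
case/orP=> [/eqP ->|/brP [->|[c1 [c2 [ne h1 h2]]]]]; last first.
- by apply/brP; right; exists c1, c2; rewrite !pre_insert h1 h2 !orbT.
- by apply/brP; left.
(* Some old word passes through [cur]; as it does not end there, it supplies the second
   continuation. *)
apply/brP; right; have /preP [v vW pv] := pc.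
have lt : size cur < size v.
  rewrite ltn_neqAle (size_pfx pv) andbT; apply/eqP => e.
  by case/negP: hcur; rewrite (prefix_size_eq pv) // e.
have [v0 p'] : exists d, prefix (rcons cur d) v.
  by exists (nth c v (size cur)); apply: prefix_next.
exists v0, c; rewrite !pre_insert pw orbC; split=> //; last first.
  by apply/orP; left; apply/preP; exists v.
by apply/eqP => e; case/negP: npre; rewrite -e; apply/preP; exists v.
Qed.

End Insertion.
End Trie.

(** * Suffix trees and compacted tries *)

Section TreeTheory.
Variable Sigma : finType.
Notation word := (seq Sigma).
Implicit Types (w x y z : word) (t u s : tree Sigma) (l : asuffix Sigma)
  (arcs : seq (asuffix Sigma * tree Sigma)).

Lemma extend_cat w w' l : extend w (extend w' l) = extend (w ++ w') l.
Proof. by case: l => v /=; rewrite catA. Qed.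

Lemma extend0 l : extend [::] l = l.
Proof. by case: l. Qed.

Lemma names_head t : name t \in names t.
Proof. by case: t => [v|v arcs] /=; rewrite inE eqxx. Qed.

Lemma names_arc v arcs l s : List.In (l, s) arcs -> {subset names s <= names (Node v arcs)}.
Proof.
move=> h a ha; rewrite /= inE; apply/orP; right.
elim: arcs h => //= b arcs IH [e|h]; rewrite mem_cat; first by rewrite e ha.
by rewrite IH ?orbT.
Qed.

Lemma size_names_arc v arcs l s : List.In (l, s) arcs -> size (names s) < size (names (Node v arcs)).
Proof.
rewrite /= ltnS; elim: arcs => //= b arcs IH [->|h]; rewrite size_cat; first exact: leq_addr.
exact: leq_trans (IH h) (leq_addl _ _).
Qed.

Lemma uniq_arcs arcs l s l' s' v : uniq (flatten [seq names a.2 | a <- arcs]) ->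
  List.In (l, s) arcs -> List.In (l', s') arcs -> v \in names s -> v \in names s' ->
  (l, s) = (l', s').
Proof.
have mem (b : asuffix Sigma * tree Sigma) bs : List.In b bs -> v \in names b.2 -> v \in flatten [seq names (a : asuffix Sigma * tree Sigma).2 | a <- bs].
  elim: bs => //= c bs IH [->|h] hv; rewrite mem_cat ?hv // IH ?orbT //.
elim: arcs => //= b arcs IH; rewrite cat_uniq => /and3P [u1 /hasPn dis u2].
case=> [e1|h1] [e2|h2] hv hv'.
- by rewrite -e1 -e2.
- by have /negP [] := dis _ (mem _ _ h2 hv'); rewrite e1.
- by have /negP [] := dis _ (mem _ _ h1 hv); rewrite e2.
- exact: IH.
Qed.

Lemma node_at_top v arcs l u : node_at (Node v arcs) l u ->
  (l = Plain [::] /\ u = Node v arcs) \/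
  exists (k : asuffix Sigma) s, List.In (k, s) arcs /\
    ((l = k /\ u = s) \/ exists w l', [/\ k = Plain w, node_at s l' u & l = extend w l']).
Proof.
elim=> [|w v0 arcs0 l0 u0 _ IH hin]; first by left.
right; case: IH => [[[->] [_ ea]]|[k [s [hk [[e1 e2]|[w1 [y [e1 hy e2]]]]]]]].
- by exists l0, u0; rewrite extend0 -ea; split=> //; left.
- exists k, s; split=> //; right; exists w, l0; split=> //.
  rewrite -e2 -[l0]extend0; exact: AtChild (AtRoot _) hin.
exists k, s; split=> //; right; case: y hy e2 => // y hy [e2].
exists w1, (extend y l0); rewrite extend_cat -e2; split=> //.
exact: AtChild hy hin.
Qed.

Lemma node_at_names t l u : node_at t l u -> {subset names u <= names t}.
Proof.
elim=> [//|w v0 arcs0 l0 u0 _ IH hin] a ha; apply: IH; exact: names_arc hin _ ha.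
Qed.

(** The names below different arcs are disjoint, so a name fixes the arc to take at every node. The
    induction counts names, since subtrees sit inside lists of arcs. *)
Lemma node_at_inj t l u l' u' : uniq (names t) ->
  node_at t l u -> node_at t l' u' -> name u = name u' -> l = l' /\ u = u'.
Proof.
have [n] := ubnP (size (names t)); elim: n t l u l' u' => // n IH t l u l' u' lt un.
case: t lt un => [v|v arcs] lt un.
  have leaf t k s : node_at t k s -> t = Leaf Sigma v -> k = Plain [::] /\ s = t.
    elim=> [//|w v0 arcs0 l0 u0 _ IH2 _] et.
    by case: (IH2 et) => _ e; rewrite -e in et.
  by move=> /leaf /(_ erefl) [-> ->] /leaf /(_ erefl) [-> ->].
move=> /node_at_top h1 /node_at_top h2 en.
have [nv uf] : v \notin flatten [seq names a.2 | a <- arcs] /\ uniq (flatten [seq names a.2 | a <- arcs]).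
  by move: un => /= /andP [].
have inf (k : asuffix Sigma) s a : List.In (k, s) arcs -> a \in names s -> a \in flatten [seq names b.2 | b <- arcs].
  move=> hin ha; elim: (arcs) hin => //= b bs IHb [e|h]; rewrite mem_cat; first by rewrite e ha.
  by rewrite IHb ?orbT.
have sub k s (y : asuffix Sigma) u0 : List.In (k, s) arcs ->
  (y = k /\ u0 = s) \/ (exists w l0, [/\ k = Plain w, node_at s l0 u0 & y = extend w l0]) ->
  name u0 \in names s.
  move=> _ [[_ ->]|[w [y0 [_ h _]]]]; first exact: names_head.
  by apply: (node_at_names h); apply: names_head.
case: h1 h2 => [[-> eu]|[k [s [hk c1]]]] [[-> eu']|[k' [s' [hk' c2]]]].
- by rewrite eu eu'.
- case/negP: nv; apply: (inf _ _ _ hk'); have := sub _ _ _ _ hk' c2; by rewrite -en eu.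
- case/negP: nv; apply: (inf _ _ _ hk); have := sub _ _ _ _ hk c1; by rewrite en eu'.
have := uniq_arcs uf hk hk' (sub _ _ _ _ hk c1).
rewrite en => /(_ (sub _ _ _ _ hk' c2)) [ek es].
move: c2 hk'; rewrite -ek -es => c2 hk' {ek es}.
have us : uniq (names s).
  elim: (arcs) hk uf => //= b bs IHb [->|h]; rewrite cat_uniq => /and3P [h1 _ h2] //.
  exact: IHb.
have ls : size (names s) < n.
  by apply: leq_trans (size_names_arc v hk) _; rewrite -ltnS.
have R : node_at s (Plain [::]) s by apply: AtRoot.
have {}c1 : exists2 l1, node_at s l1 u & l = if k is Plain w then extend w l1 else k.
  case: c1 => [[-> ->]|[w [l1 [ek h el]]]]; last by exists l1; rewrite ?ek.
  by exists (Plain [::]) => //; case: (k) => //= w; rewrite cats0.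
have {}c2 : exists2 l1, node_at s l1 u' & l' = if k is Plain w then extend w l1 else k.
  case: c2 => [[-> ->]|[w [l1 [ek h el]]]]; last by exists l1; rewrite ?ek.
  by exists (Plain [::]) => //; case: (k) => //= w; rewrite cats0.
case: c1 c2 => l1 hl1 -> [l2 hl2 ->].
by have [-> ->] := IH _ _ _ _ _ ls us hl1 hl2 en.
Qed.

(** * The nodes of a compacted trie are the branching prefixes and the words *)

Section Determinism.
Variables (t : tree Sigma) (W : seq word).
Hypotheses (ht : exists v arcs, t = Node v arcs)
  (hN : forall w v arcs, node_at t (Plain w) (Node v arcs) ->
     [/\ w != [::] -> 2 <= size arcs, uniq [seq first a.1 | a <- arcs] &
         forall l s, List.In (l, s) arcs -> exists2 w', l = Plain w' & w' != [::]])
  (hW : forall w, w \in W <-> exists v, node_at t (Plain w) (Leaf Sigma v)) (W0 : W != [::]).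

Lemma arc_first arcs l l' s s' : uniq [seq first a.1 | a <- arcs] ->
  List.In (l, s) arcs -> List.In (l', s') arcs -> first l = first l' -> (l, s) = (l', s').
Proof.
have mem (k : asuffix Sigma) u bs : List.In (k, u) bs -> first k \in [seq first (a : asuffix Sigma * tree Sigma).1 | a <- bs].
  by elim: bs => //= b bs IH [->|/IH h]; rewrite inE ?eqxx // h orbT.
elim: arcs => //= b arcs IH /andP [nb ua] [e1|h1] [e2|h2] ef.
- by rewrite -e1 -e2.
- by case/negP: nb; rewrite e1 /= ef; apply: mem h2.
- by case/negP: nb; rewrite e2 /= -ef; apply: mem h1.
- exact: IH.
Qed.

Lemma node_at_inv w u : node_at t (Plain w) u ->
  (w = [::] /\ u = t) \/ exists w0 v arcs w1, [/\ node_at t (Plain w0) (Node v arcs),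
    List.In (Plain w1, u) arcs, w1 != [::] & w = w0 ++ w1].
Proof.
move=> hw; have [l h el] : exists2 l, node_at t l u & l = Plain w by exists (Plain w).
case: h el => [[<-]|w0 v arcs l0 u0 h hin el]; first by left.
have [_ _ /(_ _ _ hin) [w1 e1 n1]] := hN h; right; exists w0, v, arcs, w1.
by rewrite e1 in hin el; case: el => ->.
Qed.

(** Uniqueness of the node at a word and the possibility of following a path are proved together,
    since each of them uses both for strictly shorter words. *)
Lemma node_at_det n :
  (forall w u u', size w < n -> node_at t (Plain w) u -> node_at t (Plain w) u' -> u = u') /\
  (forall x c v arcs z u, size z < n -> node_at t (Plain x) (Node v arcs) -> node_at t (Plain z) u ->
     prefix (rcons x c) z -> exists w s, [/\ List.In (Plain w, s) arcs, prefix (rcons x c) (x ++ w) &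
       prefix (x ++ w) z]).
Proof.
elim: n => [|n [IH1 IH2]]; first by [].
have fst w c w1 : w1 != [::] -> prefix (rcons w c) (w ++ w1) = (first (Plain w1) == Some c).
  case: w1 => // d w1 _; rewrite -cats1 prefix_catr // eqxx andTb prefix_cons prefix0s andbT.
  by rewrite /= (inj_eq Some_inj) eq_sym.
have shorter w w1 : w1 != [::] -> size (w ++ w1) < n.+1 -> size w < n.
  by move=> n1; rewrite size_cat ltnS; apply: leq_trans; rewrite -addn1 leq_add2l lt0n size_eq0.
have T6 x c v arcs z u : size z < n.+1 -> node_at t (Plain x) (Node v arcs) -> node_at t (Plain z) u ->
     prefix (rcons x c) z -> exists w s, [/\ List.In (Plain w, s) arcs, prefix (rcons x c) (x ++ w) &
       prefix (x ++ w) z].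
  move=> lz hx /node_at_inv [[-> _]|[w0 [v0 [arcs0 [w1 [h0 hin n1 ez]]]]]]; first by case: (x).
  rewrite ez in lz *; have l0 := shorter _ _ n1 lz.
  move=> p; case: (ltngtP (size x) (size w0)) => [lt|lt|e].
  - have p0 : prefix (rcons x c) w0.
      by apply: (prefix_comparable p (prefix_prefix _ _)); rewrite size_rcons.
    have [w [s [h1 h2 h3]]] := IH2 _ _ _ _ _ _ l0 hx h0 p0.
    by exists w, s; split=> //; apply: prefix_trans h3 (prefix_prefix _ _).
  (* Here [x] would lie strictly inside the last arc before [z]; but the arc that leads from [w0]
     towards the node [x] is this very arc, and it ends at [z], which is longer than [x]. *)
  - have px : prefix w0 x.
      by apply: (prefix_comparable (prefix_prefix _ _) (prefix_rconsl p)); apply: ltnW.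
    have lx : size x < n.
      by move: (size_pfx p); rewrite size_rcons => h; apply: leq_trans h _; rewrite -ltnS.
    have [d pd] : exists d, prefix (rcons w0 d) x.
      by exists (nth c x (size w0)); apply: prefix_next.
    have [w [s [h1 h2 h3]]] := IH2 _ _ _ _ _ _ lx h0 hx pd.
    have [_ uf hl] := hN h0.
    have [w' [ew] nw] := hl _ _ h1; rewrite -ew in nw.
    have pd' : prefix (rcons w0 d) (w0 ++ w1).
      by apply: prefix_trans pd (prefix_rconsl p).
    have ef : first (Plain w) = first (Plain w1).
      by rewrite fst // in h2; rewrite fst // in pd'; rewrite (eqP h2) (eqP pd').
    have [e _] := arc_first uf h1 hin ef.
    move: (size_pfx h3) (size_pfx p); rewrite e size_rcons => k1 k2.
    by move: (leq_trans k2 k1); rewrite ltnn.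
  have ex : x = w0.
    by apply: prefix_size_eq; [apply: (prefix_comparable (prefix_rconsl p) (prefix_prefix _ _)) | ]; rewrite e.
  rewrite -ex in l0 h0 p *; have [ev ea] := IH1 _ _ _ l0 hx h0.
  by exists w1, u; rewrite ea; split=> //; rewrite prefix_refl.
split=> // w u u' lw /node_at_inv [[ew eu]|[w0 [v0 [arcs0 [w1 [h0 hin n1 ew]]]]]].
  move=> /node_at_inv [[_ eu']|[w2 [v2 [arcs2 [w3 [_ _ n3 ew']]]]]]; first by rewrite eu eu'.
  by move: n3; rewrite ew in ew'; case: w3 ew' => //; case: w2.
move=> /node_at_inv [[ew' _]|[w2 [v2 [arcs2 [w3 [h2 hin2 n3 ew']]]]]].
  by move: n1; rewrite ew' in ew; case: w1 ew {hin} => //; case: w0 h0.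
(* Parents at different depths are impossible: the arc from the upper one towards the lower one is
   the arc that ends at [w], already below the lower one. *)
have key x1 y1 v1 a1 s1 x2 y2 v3 a2 s2 :
  node_at t (Plain x1) (Node v1 a1) -> List.In (Plain y1, s1) a1 -> y1 != [::] -> w = x1 ++ y1 ->
  node_at t (Plain x2) (Node v3 a2) -> List.In (Plain y2, s2) a2 -> y2 != [::] -> w = x2 ++ y2 ->
  size x1 < size x2 -> False.
  move=> k1 k2 k3 k4 k5 k6 k7 k8 lt.
  have px : prefix x1 x2.
    by apply: (@prefix_comparable _ _ _ w); rewrite ?(ltnW lt) // ?k4 ?prefix_prefix // -k4 k8 prefix_prefix.
  have [d pd] : exists d, prefix (rcons x1 d) x2.
    by case: y1 k3 {k2 k4} => // d _ _; exists (nth d x2 (size x1)); apply: prefix_next.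
  have l2 : size x2 < n by apply: (shorter _ _ k7); rewrite -k8.
  have [y [s [h1 h3 h4]]] := IH2 _ _ _ _ _ _ l2 k1 k5 pd.
  have [_ uf hl] := hN k1; have [w' [ey] ny] := hl _ _ h1; rewrite -ey in ny.
  have pd' : prefix (rcons x1 d) (x1 ++ y1).
    by apply: prefix_trans pd _; rewrite -k4 k8 prefix_prefix.
  have ef : first (Plain y) = first (Plain y1).
    by rewrite fst // in h3; rewrite fst // in pd'; rewrite (eqP h3) (eqP pd').
  have [e _] := arc_first uf h1 k2 ef.
  move: (size_pfx h4); rewrite e -k4 k8 size_cat -[X in _ <= X]addn0 leq_add2l leqn0 size_eq0.
  by rewrite (negbTE k7).
case: (ltngtP (size w0) (size w2)) => [lt|lt|e].
- by case: (key _ _ _ _ _ _ _ _ _ _ h0 hin n1 ew h2 hin2 n3 ew').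
- by case: (key _ _ _ _ _ _ _ _ _ _ h2 hin2 n3 ew' h0 hin n1 ew).
have e02 : w0 = w2.
  by apply: prefix_size_eq; rewrite ?e //; apply: (@prefix_comparable _ _ _ w); rewrite ?e // ?ew ?prefix_prefix // -ew ew' prefix_prefix.
rewrite -e02 in h2 ew'; have l0 : size w0 < n by apply: (shorter _ _ n1); rewrite -ew.
have [ev ea] := IH1 _ _ _ l0 h0 h2; rewrite -ea in hin2.
have e13 : w1 = w3 by move: ew'; rewrite ew => /eqP; rewrite eqseq_cat // eqxx => /eqP.
rewrite -e13 in hin2; have [_ uf _] := hN h0.
by have [] := arc_first uf hin hin2 erefl.
Qed.

Lemma node_at_uniq w u u' : node_at t (Plain w) u -> node_at t (Plain w) u' -> u = u'.
Proof. exact: (node_at_det (size w).+1).1. Qed.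

Lemma node_at_path x c v arcs z u : node_at t (Plain x) (Node v arcs) -> node_at t (Plain z) u ->
  prefix (rcons x c) z -> exists w s, [/\ List.In (Plain w, s) arcs, prefix (rcons x c) (x ++ w) &
     prefix (x ++ w) z].
Proof. exact: (node_at_det (size z).+1).2. Qed.

Lemma arc_ex w v arcs : node_at t (Plain w) (Node v arcs) -> exists l s, List.In (l, s) arcs.
Proof.
move=> h; have [h2 _ _] := hN h; case: arcs h h2 => [|[l s] arcs] h h2; last by exists l, s; left.
case: (eqVneq w [::]) => [ew|nw]; last by have := h2 nw.
have et : Node v [::] = t by rewrite ew in h; apply: node_at_uniq h (AtRoot t).
have [z zW] : exists z, z \in W by case: (W) W0 => // z W1 _; exists z; rewrite inE eqxx.
have /hW [v' hl] := zW; rewrite -et in hl.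
by case/node_at_top: hl => [[]//|[k [s [[]]]]].
Qed.

Lemma leaf_below x u : node_at t (Plain x) u -> exists2 w, w \in W & prefix x w.
Proof.
have [n] := ubnP (size (names u)); elim: n x u => // n IH x [v|v arcs] lt h.
  by exists x; [apply/hW; exists v | apply: prefix_refl].
have [l [s hin]] := arc_ex h; have [_ _ /(_ _ _ hin) [w el nw]] := hN h.
rewrite el in hin; have h2 := AtChild h hin.
have [|w' w'W p] := IH (x ++ w) s _ h2.
  by apply: leq_trans (size_names_arc v hin) _; rewrite -ltnS.
by exists w' => //; apply: prefix_trans p; apply: prefix_prefix.
Qed.

Lemma node_at_br x v arcs : node_at t (Plain x) (Node v arcs) -> br W x.
Proof.
move=> h; apply/brP; have [h2 uf hl] := hN h; case: (eqVneq x [::]) => [->|nx]; first by left.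
right; have := h2 nx; case: arcs h uf hl {h2} => [|[l1 s1] [|[l2 s2] arcs]] // h uf hl _.
have in1 : List.In (l1, s1) [:: (l1, s1), (l2, s2) & arcs] by left.
have in2 : List.In (l2, s2) [:: (l1, s1), (l2, s2) & arcs] by right; left.
have [w1 e1 n1] := hl _ _ in1; have [w2 e2 n2] := hl _ _ in2.
subst l1 l2; have [z1 z1W p1] := leaf_below (AtChild h in1).
have [z2 z2W p2] := leaf_below (AtChild h in2).
clear h hl in1 in2; case: w1 n1 uf p1 => // c1 w1 _ uf p1; case: w2 n2 uf p2 => // c2 w2 _ uf p2.
exists c1, c2; split.
- by move: uf => /= /andP [h3 _]; apply: contra h3 => /eqP ->; rewrite inE eqxx.
- apply/preP; exists z1 => //; apply: prefix_trans p1.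
  by rewrite -cat_rcons prefix_prefix.
- apply/preP; exists z2 => //; apply: prefix_trans p2.
  by rewrite -cat_rcons prefix_prefix.
Qed.

Lemma node_at_above z u x : node_at t (Plain z) u -> prefix x z -> size x < size z ->
  (exists v arcs, node_at t (Plain x) (Node v arcs)) \/
  exists w v arcs w1 s, [/\ node_at t (Plain w) (Node v arcs), List.In (Plain w1, s) arcs,
    prefix w x, size w < size x < size (w ++ w1) & prefix (w ++ w1) z].
Proof.
have [n] := ubnP (size z); elim: n z u => // n IH z u lt /node_at_inv.
case=> [[-> _]|[w0 [v [arcs [w1 [h hin n1 ez]]]]] p lx] //.
case: (ltngtP (size x) (size w0)) => [l1|l1|e].
- have p0 : prefix x w0.
    by apply: (prefix_comparable p _ (ltnW l1)); rewrite ez prefix_prefix.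
  have lw0 : size w0 < n.
    suff h0 : size w0 < size z by apply: leq_trans h0 lt.
    by rewrite ez size_cat -[X in X < _]addn0 ltn_add2l lt0n size_eq0.
  case: (IH _ _ lw0 h p0 l1) => [|[w [v2 [a2 [w2 [s [k1 k2 k3 k4 k5]]]]]]]; [by left|right].
  exists w, v2, a2, w2, s; split=> //; apply: prefix_trans k5 _; by rewrite ez prefix_prefix.
- right; exists w0, v, arcs, w1, u; split=> //.
  + by apply: (prefix_comparable _ p (ltnW l1)); rewrite ez prefix_prefix.
  + by rewrite l1 -ez.
  + by rewrite ez prefix_refl.
left; exists v, arcs; have <- // : w0 = x.
by apply: prefix_size_eq; rewrite ?e // (@prefix_comparable _ _ _ z) ?e // ez prefix_prefix.
Qed.

(** If a branching word were strictly inside an arc, both of its continuations would have to follow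
    the label of that arc. *)
Lemma br_node_at x : br W x -> exists v arcs, node_at t (Plain x) (Node v arcs).
Proof.
case/brP=> [->|[c1 [c2 [ne /preP [z1 z1W p1] /preP [z2 z2W p2]]]]].
  by have [v [arcs et]] := ht; exists v, arcs; rewrite -et; apply: AtRoot.
have /hW [v1 h1] := z1W; have /hW [v2 h2] := z2W.
have lx : size x < size z1 by move: (size_pfx p1); rewrite size_rcons.
case: (node_at_above h1 (prefix_rconsl p1) lx) => // [[w [v [arcs [w1 [s [hw hin pw /andP [l1 l2] pz]]]]]]].
have [d pd] : exists d, prefix (rcons w d) x.
  by exists (nth c1 x (size w)); apply: prefix_next.
have [w2 [s2 [in2 q1 q2]]] := node_at_path hw h2 (prefix_trans pd (prefix_rconsl p2)).
have [_ uf hl] := hN hw.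
have pd1 : prefix (rcons w d) (w ++ w1).
  apply: (@prefix_comparable _ _ _ z1); rewrite ?pz //; last by rewrite size_rcons (leq_trans l1) // ltnW.
  exact: prefix_trans pd (prefix_rconsl p1).
have fst y k : prefix (rcons w k) (w ++ y) -> first (Plain y) = Some k.
  by rewrite -cats1 prefix_catr // eqxx andTb; case: y => // a y /andP [/eqP ->].
have [e _] := arc_first uf hin in2 (etrans (fst _ _ pd1) (esym (fst _ _ q1))).
rewrite -e in q2; case/eqP: ne; apply: (@prefix_rcons_inj _ x _ _ z2); last exact: p2.
apply: prefix_trans q2; apply: (prefix_comparable p1 pz); by rewrite size_rcons.
Qed.

Lemma nd_node_at z : nd (br W) W z -> exists u, node_at t (Plain z) u.
Proof.
by case/orP=> [/br_node_at [v [arcs h]]|/hW [v h]]; [exists (Node v arcs) | exists (Leaf Sigma v)].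
Qed.

Lemma node_at_nd z u : node_at t (Plain z) u -> nd (br W) W z.
Proof.
case: u => [v|v arcs] h; first by rewrite /nd orbC (_ : z \in W) //; apply/hW; exists v.
by rewrite /nd (node_at_br h).
Qed.

Lemma edge_arc x y : edge (br W) W x y -> exists v arcs w s,
  [/\ node_at t (Plain x) (Node v arcs), List.In (Plain w, s) arcs, y = x ++ w, w != [::]
    & node_at t (Plain y) s].
Proof.
move=> [Nx ny pxy lxy bt]; have [v [arcs h]] := br_node_at Nx; have [u hu] := nd_node_at ny.
have [c pc] : exists c, prefix (rcons x c) y.
  case: (y) lxy pxy => // d y' lxy pxy; exists (nth d (d :: y') (size x)); exact: prefix_next.
have [w [s [hin p1 p2]]] := node_at_path h hu pc.
have hs := AtChild h hin; rewrite /= in hs.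
have lw : size x < size (x ++ w) by move: (size_pfx p1); rewrite size_rcons.
have e := bt _ (node_at_nd hs) p2 lw.
exists v, arcs, w, s; rewrite -e; split=> //.
by case: (w) lw => //; rewrite cats0 ltnn.
Qed.

End Determinism.
End TreeTheory.

(** * Disjoint records in memory *)

Section Cells.
Variables (k : nat).
Hypothesis k0 : 0 < k.
Implicit Type vs : seq nat.

Definition cells_of vs := flatten [seq iota v k | v <- vs].

Lemma mem_cells vs v i : v \in vs -> i < k -> v + i \in cells_of vs.
Proof.
move=> vv lt; apply/flattenP; exists (iota v k); first exact: map_f.
by rewrite mem_iota leq_addr ltn_add2l.
Qed.

Lemma cells_uniq vs : uniq (cells_of vs) -> uniq vs.
Proof.
elim: vs => //= v vs IH; rewrite cat_uniq => /and3P [_ /hasPn h /IH ->]; rewrite andbT.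
apply/negP => hv; have := h _ (mem_cells hv k0).
by rewrite addn0 mem_iota leqnn -[X in X < _]addn0 ltn_add2l k0.
Qed.

Lemma cells_dis vs v v' : uniq (cells_of vs) -> v \in vs -> v' \in vs -> v <> v' ->
  v + k <= v' \/ v' + k <= v.
Proof.
elim: vs => //= a vs IH; rewrite cat_uniq => /and3P [_ /hasPn h u].
have key b : b \in vs -> a + k <= b \/ b + k <= a.
  move=> hb; case: (leqP (a + k) b) => l1; [by left|]; case: (leqP (b + k) a) => l2; [by right|].
  case: (leqP a b) => l3.
    by have := h _ (mem_cells hb k0); rewrite addn0 mem_iota l3 l1.
  have hb' := mem_cells (i := a - b) hb; have := h a.
  by rewrite -{1}(subnKC (ltnW l3)) hb' ?mem_iota ?leqnn ?ltn_subLR ?(ltnW l3) // -[X in X < _]addn0 ltn_add2l k0 => /(_ isT).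
rewrite !inE => /orP [/eqP ->|h1] /orP [/eqP ->|h2] // ne.
- exact: key.
- by case: (key _ h1); [right|left].
exact: IH.
Qed.

Lemma uniq_cells vs : uniq vs -> (forall v v', v \in vs -> v' \in vs -> v <> v' -> v + k <= v' \/ v' + k <= v) ->
  uniq (cells_of vs).
Proof.
elim: vs => //= v vs IH /andP [nv uv] dis; rewrite cat_uniq iota_uniq IH ?andbT //=; last first.
  by move=> a b ha hb; apply: dis; rewrite inE ?ha ?hb orbT.
apply/hasPn => a /flattenP [c /mapP [b hb ->]]; rewrite !mem_iota => /andP [l1 l2].
apply/negP => /andP [l3 l4].
have [] := dis v b _ _ _; rewrite ?inE ?eqxx ?hb ?orbT //.
- by move=> e; rewrite e hb in nv.
- by move=> l; clear -l l1 l4; lia.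
by move=> l; clear -l l2 l3; lia.
Qed.
End Cells.

Section Child.
Variable Sigma : finType.
Implicit Type arcs : seq (asuffix Sigma * tree Sigma).

Lemma child_in arcs l s c : uniq [seq first a.1 | a <- arcs] -> List.In (l, s) arcs ->
  first l = Some c -> child arcs c = name s.
Proof.
rewrite /child; elim: arcs => //= b arcs IH /andP [nb ub] [->|h] el; rewrite ?el ?eqxx //=.
case: eqP => [e|_]; last exact: IH.
case/negP: nb; rewrite e -el; elim: (arcs) h => //= d ds IHd [->|h]; rewrite inE ?eqxx //.
by rewrite IHd ?orbT.
Qed.

(** The null address is the default value of [nth], reached when [find] fails. *)
Lemma child_null arcs c : (forall l s, List.In (l, s) arcs -> first l <> Some c) -> child arcs c = 0.
Proof.
rewrite /child; elim: arcs => //= b arcs IH h; case: eqP => [e|_].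
  by case: (h b.1 b.2); [left; case: (b) | exact: e].
by apply: IH => l s hin; apply: (h l s); right.
Qed.
End Child.

(** * The program *)

(* Registers 8-11: the locus of the substring of B between positions [rJ] and [rE];
   it lies at or below the node [rU] of depth [rDU].  [rPend] is the node whose suffix link is
   not yet set, or 0. *)
Local Notation rJ := 8 (only parsing).
Local Notation rE := 9 (only parsing).
Local Notation rU := 10 (only parsing).
Local Notation rDU := 11 (only parsing).
Local Notation rY := 12 (only parsing).
Local Notation rC := 13 (only parsing).
Local Notation rGo := 14 (only parsing).
Local Notation rPend := 15 (only parsing).
Local Notation rLim := 16 (only parsing).
Local Notation rK := 17 (only parsing).
Local Notation rEll := 18 (only parsing).
Local Notation rZ := 19 (only parsing).
Local Notation rC2 := 20 (only parsing).
Local Notation rOld := 21 (only parsing).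
Local Notation rStr := 22 (only parsing).
Local Notation rBeg := 23 (only parsing).
Local Notation rEnd := 24 (only parsing).
Local Notation rT := 25 (only parsing).
Local Coercion Reg : nat >-> expr.
Local Notation "a `+ b" := (Add a b) (at level 50, left associativity).
Local Notation "a `- b" := (Sub a b) (at level 50, left associativity).
Local Notation "! a" := (MemRead a) (at level 8, a at level 0, format "! a").
Local Notation "# n" := (Const n) (at level 8, n at level 0, format "# n").
Local Notation "r <~ e" := (Assign r e) (at level 60).
Local Notation "a <<~ e" := (MemWrite a e) (at level 60).
Local Notation "p ;; q" := (Seq p q) (at level 65, right associativity).

(** [B] is not in memory: a position is redirected to [alpha] or [gamma] inside [A], or to [delta].
    In the last case subtraction comes first and is exact, since [p] is at least the length of
    [delta] there. *)
Definition get_b (p : expr) (out : nat) : cmd :=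
  If (TLe (p `+ #1) rAlphaLen) (out <~ !(rA `+ p))
    (If (TLe (p `+ #1) (rAlphaLen `+ rDeltaLen)) (out <~ !(rD `+ (p `- rAlphaLen)))
       (out <~ !(rA `+ (p `- rDeltaLen `+ rBetaLen)))).

Definition get_s (k p : expr) (out : nat) : cmd :=
  If (TEq k #0) (out <~ !(rA `+ p)) (get_b p out).

Definition len_y : expr := !(rY `+ #3) `- !(rY `+ #2).
Definition len_b : expr := rAlphaLen `+ rDeltaLen `+ rGammaLen.

(** The string to locate is known to be a path in the trie, so one character selects an arc and the
    rest of its label is skipped without comparison. If the string ends strictly below [rU], then
    [rY] is left at the lower end of the arc concerned. *)
Definition rescan_body : cmd :=
  If (TEq (rJ `+ rDU) rE) (rGo <~ #0)
    (get_b (rJ `+ rDU) rC ;; rY <~ !(rU `+ #5 `+ rC) ;;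
     If (TEq !rY #0) (rGo <~ #0)
       (If (TLe (rJ `+ rDU `+ len_y) rE)
          (rDU <~ rDU `+ len_y ;; rU <~ rY)
          (rGo <~ #0))).
Definition rescan : cmd := rGo <~ #1 ;; While (TEq rGo #1) rescan_body.

(** Here the string grows, one compared character at a time. A null [rY] means that the node has no
    arc for the next character; [rU] moves down only to inner nodes, never to a leaf. *)
Definition scan_body : cmd :=
  If (TEq rE len_b) (rGo <~ #0)
    (get_b rE rC ;;
     If (TEq (rJ `+ rDU) rE) (rY <~ !(rU `+ #5 `+ rC)) Skip ;;
     If (TEq rY #0) (rGo <~ #0)
       (get_s !(rY `+ #1) (!(rY `+ #2) `+ (rE `- (rJ `+ rDU))) rC2 ;;
        If (TEq rC rC2)
          (rE <~ rE `+ #1 ;;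
           If (TEq !rY #0) Skip
             (If (TEq (rJ `+ rDU `+ len_y) rE) (rDU <~ rE `- rJ ;; rU <~ rY) Skip))
          (rGo <~ #0))).
Definition scan : cmd := rGo <~ #1 ;; While (TEq rGo #1) scan_body.

Fixpoint clear n : cmd :=
  if n is k.+1 then clear k ;; rZ `+ #(5 + k) <<~ #0 else Skip.

(** Free cells have arbitrary contents, hence the clearing of the child table. The new node is the
    target of the link awaited by [rPend], if any; its own link has to wait until the next suffix is
    located. *)
Definition split (sz : nat) : cmd :=
  If (TEq (rJ `+ rDU) rE) (rZ <~ rU)
    (rZ <~ rFree ;; rFree <~ rFree `+ #(5 + sz) ;;
     get_b (rJ `+ rDU) rC ;; get_s !(rY `+ #1) (!(rY `+ #2) `+ (rE `- (rJ `+ rDU))) rC2 ;;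
     rStr <~ !(rY `+ #1) ;; rBeg <~ !(rY `+ #2) ;; rEnd <~ rBeg `+ (rE `- (rJ `+ rDU)) ;;
     clear sz ;;
     rZ <<~ #1 ;; rZ `+ #1 <<~ rStr ;; rZ `+ #2 <<~ rBeg ;; rZ `+ #3 <<~ rEnd ;;
     rY `+ #2 <<~ rEnd ;; rU `+ #5 `+ rC <<~ rZ ;; rZ `+ #5 `+ rC2 <<~ rY ;;
     If (TEq rPend #0) Skip (rPend `+ #4 <<~ rZ) ;;
     rPend <~ rZ).

Definition add_leaf (sz : nat) : cmd :=
  get_b rE rC ;; rZ `+ #5 `+ rC <<~ rFree ;;
  rFree <<~ #0 ;; rFree `+ #1 <<~ #1 ;; rFree `+ #2 <<~ rE ;;
  rFree <~ rFree `+ #(5 + sz).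

(** The root has no suffix link and is kept. The last test matters when the matched part is empty:
    its right end then moves along with its left end. *)
Definition shift : cmd :=
  If (TEq rDU #0) Skip (rU <~ !(rU `+ #4) ;; rDU <~ rDU `- #1) ;;
  rJ <~ rJ `+ #1 ;;
  If (TLe rJ rE) Skip (rE <~ rJ).

(** If the located string ends at a node, this node is the target of the awaited link; otherwise the
    target will be created by the next [split]. *)
Definition fix_link : cmd :=
  If (TEq rPend #0) Skip
    (If (TEq (rJ `+ rDU) rE) (rPend `+ #4 <<~ rU ;; rPend <~ #0) Skip).

(** When the scan reaches the end of [B], the suffix is already a word of the trie and no leaf is
    added. *)
Definition insert_body (sz : nat) : cmd :=
  scan ;; If (TEq rE len_b) Skip (split sz ;; add_leaf sz) ;;
  shift ;; rescan ;; fix_link.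

(* Inserts the suffixes of B starting at the positions from [rJ] up to [rLim]. *)
Definition insert (sz : nat) : cmd :=
  rE <~ rJ ;; rU <~ rRoot ;; rDU <~ #0 ;; rPend <~ #0 ;;
  While (TNot (TLe rLim rJ)) (insert_body sz).

(* Sets [rC2] to 1 if the located string ends inside the arc of a leaf, i.e. occurs only once. *)
Definition leaf_arc : cmd :=
  If (TEq (rJ `+ rDU) rE) (rC2 <~ #0) (If (TEq !rY #0) (rC2 <~ #1) (rC2 <~ #0)).

(** If [rK] exceeds the length of [alpha], truncated subtraction starts the trial at position 0;
    [rEll] then falls short of [rK], which ends the search. *)
Definition find_body : cmd :=
  rK <~ rK `+ rK `+ #1 ;; rJ <~ rAlphaLen `- rK ;; rE <~ rAlphaLen ;;
  rU <~ rRoot ;; rDU <~ #0 ;; rescan ;; leaf_arc ;;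
  While (TEq rC2 #1) (shift ;; rescan ;; leaf_arc) ;;
  rEll <~ rAlphaLen `- rJ.
Definition find_rep : cmd :=
  rK <~ #0 ;; rEll <~ #0 ;; While (TEq rEll rK) find_body.

(* The length of the longest common suffix of alpha ++ beta and alpha ++ delta. *)
Definition common_body : cmd :=
  If (TLe (rT `+ #1) (rAlphaLen `+ rBetaLen))
    (If (TLe (rT `+ #1) (rAlphaLen `+ rDeltaLen))
      (rC <~ !(rA `+ (rAlphaLen `+ rBetaLen `- (rT `+ #1))) ;;
       get_b (rAlphaLen `+ rDeltaLen `- (rT `+ #1)) rC2 ;;
       If (TEq rC rC2) (rT <~ rT `+ #1) (rGo <~ #0))
      (rGo <~ #0))
    (rGo <~ #0).
Definition common : cmd := rT <~ #0 ;; rGo <~ #1 ;; While (TEq rGo #1) common_body.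

(* An occurrence in B of a suffix a of alpha may start a suffix of B that is also a suffix
   of A, hence no new leaf: then a ++ beta is a suffix of alpha ++ delta, which [common]
   detects. *)
Definition main (sz : nat) : cmd :=
  find_rep ;; rJ <~ rAlphaLen `- rEll ;; rOld <~ rJ ;; rLim <~ rAlphaLen `+ rDeltaLen ;;
  insert sz ;;
  find_rep ;; common ;; If (TLe (rEll `+ rBetaLen) rT) (rEll <~ rT `- rBetaLen) Skip ;;
  rJ <~ rAlphaLen `- rEll ;; rLim <~ rOld ;;
  insert sz.

Arguments get_b : simpl never.

Arguments get_s : simpl never.

(** * The memory invariant *)

Section Algo.
Variables (Sigma : finType) (hash : Sigma) (alpha beta delta gamma : seq Sigma).
Variables (a0 d0 root : nat).
Notation word := (seq Sigma).
Notation A := (alpha ++ beta ++ gamma).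
Notation B := (alpha ++ delta ++ gamma).
Notation rs := (rec_size Sigma).
Implicit Types (W : seq word) (u v w x y z cur : word) (N : pred word) (nm : word -> nat)
  (f m : nat -> nat) (s : state).

Hypothesis hA : exists2 A', A = rcons A' hash & hash \notin A'.
Hypothesis hB : exists2 B', B = rcons B' hash & hash \notin B'.

Definition sub j e : word := take (e - j) (drop j B).

(* The memory [m] holds the trie of the words [W] with internal nodes [N], node [z] being stored
   at [nm z].  [N] contains [br W] but, between [split] and [add_leaf], also a node with a single
   child; the suffix link of [pd] is not set. *)
Record rep N W nm m (fr : nat) (pd : option word) : Prop := Rep {
  r_leaf w : w \in W -> m (nm w) = 0;
  r_int x : N x -> m (nm x) = 1;
  r_child x y : edge N W x y -> m (nm x + 5 + code (nth hash y (size x))) = nm y;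
  r_null x c : N x -> ~~ pre W (rcons x c) -> m (nm x + 5 + code c) = 0;
  r_lleaf x y : edge N W x y -> y \in W ->
    exists S p, [/\ onth [:: A; B] (m (nm y + 1)) = Some S, y = drop p S &
                    m (nm y + 2) = p + size x];
  r_lint x y : edge N W x y -> N y ->
    exists S, [/\ onth [:: A; B] (m (nm y + 1)) = Some S, m (nm y + 3) <= size S &
      drop (size x) y = take (m (nm y + 3) - m (nm y + 2)) (drop (m (nm y + 2)) S)];
  r_link c w : N (c :: w) -> Some (c :: w) <> pd -> N w /\ m (nm (c :: w) + 4) = nm w;
  r_pos z : nd N W z -> 0 < nm z /\ nm z + rs <= fr;
  r_dis z z' : nd N W z -> nd N W z' -> z <> z' -> nm z + rs <= nm z' \/ nm z' + rs <= nm z;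
  r_A z i : nd N W z -> i < size A -> a0 + i < nm z \/ nm z + rs <= a0 + i;
  r_D z i : nd N W z -> i < size delta -> d0 + i < nm z \/ nm z + rs <= d0 + i;
  r_strA i : i < size A -> a0 + i < fr;
  r_strD i : i < size delta -> d0 + i < fr }.

Definition consts f : Prop :=
  [/\ [/\ f rA = a0, f rD = d0 & f rRoot = root],
      f rAlphaLen = size alpha, f rBetaLen = size beta, f rDeltaLen = size delta
    & f rGammaLen = size gamma].

Definition strs m : Prop :=
  (forall i, i < size A -> m (a0 + i) = code (nth hash A i)) /\
  (forall i, i < size delta -> m (d0 + i) = code (nth hash delta i)).

Definition inv N W nm pd s : Prop :=
  [/\ consts (reg s), strs (mem s), rep N W nm (mem s) (reg s rFree) pd,
      hterm hash W /\ goodN N W & nm [::] = root].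

Definition same_but (l : seq nat) s s' : Prop :=
  mem s' = mem s /\ forall r, r \notin l -> reg s' r = reg s r.

(** Registers below 8 hold the input parameters and [rFree], the only registers that the invariant
    mentions. *)
Lemma inv_same l N W nm pd s s' : all (leq 8) l -> same_but l s s' ->
  inv N W nm pd s -> inv N W nm pd s'.
Proof.
case: s s' => f m [f' m'] /allP hl [/= -> e].
have e' r : r < 8 -> f' r = f r.
  by move=> lt; apply: e; apply/negP => /hl /=; rewrite leqNgt lt.
by rewrite /inv /consts /= !e'.
Qed.

Lemma run_get_b p out s : consts (reg s) -> strs (mem s) -> eval s p < size B ->
  run (get_b p out) s = State (upd (reg s) out (code (nth hash B (eval s p)))) (mem s).
Proof.
case: s => f m [[/= fA fD _] f2 f3 f4 f5] [/= mA mD] lt; rewrite /get_b.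
cbn [run teval eval]; cbn [reg mem].
move: lt; rewrite f2 f4 fA fD f3; set i := eval _ _; rewrite !size_cat addn1 => lt.
case: ltnP => h1 /=.
  by rewrite mA ?size_cat; [rewrite !nth_cat h1 | lia].
rewrite nth_cat [i < size alpha]ltnNge h1 /=; case: ltnP => h2.
  by rewrite mD; [rewrite nth_cat; case: ltnP => //; lia | lia].
rewrite mA ?size_cat; last by lia.
congr (State (upd _ _ _) _).
rewrite !nth_cat !ifN; try lia.
by congr (code (nth _ _ _)); lia.
Qed.

Lemma run_get_s k p out s S : consts (reg s) -> strs (mem s) ->
  onth [:: A; B] (eval s k) = Some S -> eval s p < size S ->
  run (get_s k p out) s = State (upd (reg s) out (code (nth hash S (eval s p)))) (mem s).
Proof.
move=> cs st hS lt; rewrite /get_s; cbn [run teval].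
case: eqP => [e|ne].
  move: hS lt; rewrite e => -[<-] lt.
  by case: s cs st {e} lt => f m [[/= fA _ _] _ _ _ _] [/= mA _] lt; rewrite fA mA.
move: hS ne; cbn [eval]; case: (eval s k) => [|[|n]] hS ne; first by case: ne.
  by move: hS lt => -[<-] lt; apply: run_get_b.
by move: hS; rewrite /onth /=; case: n {ne}.
Qed.

#[local] Arguments run : simpl never.
#[local] Arguments cmax : simpl never.
#[local] Arguments tcost : simpl never.

Lemma size_sub j e : e <= size B -> size (sub j e) = e - j.
Proof. by move=> le; rewrite /sub size_takel // size_drop leq_sub2r. Qed.

Lemma sub0 j : sub j j = [::]. Proof. by rewrite /sub subnn take0. Qed.

Lemma nth_sub j e i : i < e - j -> nth hash (sub j e) i = nth hash B (j + i).
Proof. by move=> lt; rewrite /sub nth_take // nth_drop. Qed.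

Lemma sub_prefix j e e' : e <= e' -> prefix (sub j e) (sub j e').
Proof. by move=> le; rewrite /sub -(take_takel (drop j B) (leq_sub2r j le)) prefix_take. Qed.

Lemma sub_rcons j e : j <= e -> e < size B -> sub j e.+1 = rcons (sub j e) (nth hash B e).
Proof.
move=> le lt; rewrite /sub subSn // (take_nth hash) ?size_drop ?ltn_sub2r //; last first.
  exact: leq_ltn_trans lt.
by rewrite nth_drop subnKC.
Qed.

Lemma sub_take j e z : e <= size B -> prefix z (sub j e) -> z = sub j (j + size z).
Proof.
move=> le p; have := size_pfx p; rewrite size_sub // => lz.
move: p; rewrite prefixE /sub take_takel // => /eqP.
by rewrite addKn.
Qed.

Lemma behead_sub j e : behead (sub j e) = sub j.+1 e.
Proof.
rewrite /sub subnS -[j.+1]add1n -drop_drop drop1.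
by case: (drop j B) (e - j) => [|? ?] [|n] //=; rewrite take0.
Qed.

Lemma sub_full j : sub j (size B) = drop j B.
Proof. by rewrite /sub -size_drop take_size. Qed.

Lemma hash_sub j e : e < size B -> hash \notin sub j e.
Proof.
have [B' eB nh] := hB => lt; apply: contra nh; rewrite /sub.
have le : e <= size B' by move: lt; rewrite eB size_rcons ltnS.
case: (leqP j e) => [lj|lj]; last by rewrite (eqP (ltnW lj : e - j == 0)) take0.
rewrite eB drop_rcons ?(leq_trans lj) // -cats1 takel_cat ?size_drop ?leq_sub2r //.
by move=> h; apply: mem_drop (mem_take h).
Qed.

(** A word contains [hash], which does not occur in [B] before its last position. *)
Lemma sub_not_word W w j e : hterm hash W -> w \in W -> prefix w (sub j e) -> e < size B -> False.
Proof.
move=> hW /hW [w' -> _] /prefixP [t h] lt; have := hash_sub j lt.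
by rewrite h mem_cat mem_rcons inE eqxx.
Qed.

(** Arcs to leaves store only the start of their label, other arcs both ends; reading characters is
    the same for both. *)
Lemma label_nth N W nm m fr pd x y : rep N W nm m fr pd -> edge N W x y ->
  exists2 S, onth [:: A; B] (m (nm y + 1)) = Some S &
  forall o, o < size y - size x -> m (nm y + 2) + o < size S /\
    nth hash S (m (nm y + 2) + o) = nth hash y (size x + o).
Proof.
move=> R ed; have [_ ny pxy lt _] := ed; case/orP: (ny) => [Ny|yW].
  have [S [e1 le e2]] := r_lint R ed Ny; exists S => // o lo.
  have sz : size (drop (size x) y) <= size (drop (m (nm y + 2)) S).
    by rewrite e2 size_take_min geq_minr.
  have lo' : o < m (nm y + 3) - m (nm y + 2).
    by apply: leq_trans lo _; rewrite -size_drop e2 size_take_min geq_minl.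
  split; first by rewrite !size_drop in sz; lia.
  by rewrite -nth_drop -(nth_take _ lo') -e2 nth_drop.
have [S [p [e1 e2 e3]]] := r_lleaf R ed yW; exists S => // o lo.
rewrite e3 e2 nth_drop; move: lo; rewrite e2 size_drop => lo; split; first lia.
by congr nth; lia.
Qed.

Lemma label_size N W nm m fr pd x y : rep N W nm m fr pd -> edge N W x y -> N y ->
  m (nm y + 3) - m (nm y + 2) = size y - size x.
Proof.
move=> R ed Ny; have [S [e1 le e2]] := r_lint R ed Ny.
by rewrite -size_drop e2 size_takel // size_drop leq_sub2r.
Qed.

Definition at_node N W nm f x : Prop :=
  [/\ N x, f rJ + size x <= f rE <= size B, sub (f rJ) (f rJ + size x) = x,
      f rU = nm x /\ f rDU = size x & pre W (sub (f rJ) (f rE))].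

(** The located string may be all of [y] only if [y] is a leaf: at an inner node it would be located
    at that node itself. *)
Definition mid_edge N W nm f x y : Prop :=
  [/\ edge N W x y, prefix (sub (f rJ) (f rE)) y, size x < f rE - f rJ, f rY = nm y
    & N y -> f rE - f rJ < size y].

Definition locus N W nm f x : Prop :=
  at_node N W nm f x /\ (size x = f rE - f rJ \/ exists y, mid_edge N W nm f x y).

Lemma same_trans l1 l2 l3 s1 s2 s3 : same_but l1 s1 s2 -> same_but l2 s2 s3 ->
  {subset l1 <= l3} -> {subset l2 <= l3} -> same_but l3 s1 s3.
Proof.
move=> [e1 f1] [e2 f2] h1 h2; split; first by rewrite e2.
by move=> r h; rewrite f2 ?f1 //; apply: contra h; [apply: h1 | apply: h2].
Qed.

Lemma same_upd (l : seq nat) s f m k (v : nat) : k \in l -> same_but l s (State f m) ->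
  same_but l s (State (upd f k v) m).
Proof.
move=> kl [/= e h]; split=> //= r nr; rewrite /upd; case: eqP => [e'|_]; last exact: h.
by rewrite -e' (negbTE nr) in kl.
Qed.

Lemma run_seq p q s : run (p ;; q) s = run q (run p s). Proof. by []. Qed.
Lemma run_if b p q s : run (If b p q) s = if teval s b then run p s else run q s.
Proof. by []. Qed.
Lemma run_asg r e f m : run (r <~ e) (State f m) = State (upd f r (eval (State f m) e)) m.
Proof. by []. Qed.
Lemma run_mw a e f m : run (a <<~ e) (State f m) =
  State f (upd m (eval (State f m) a) (eval (State f m) e)).
Proof. by []. Qed.

Lemma updE f k (v : nat) j : upd f k v j = if j == k then v else f j. Proof. by []. Qed.

Ltac ev := cbn [eval teval reg mem]; rewrite ?updE /=.

Lemma pay k T a b : T <= k -> a < b -> T + k * a <= k * b.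
Proof.
move=> lT lt; apply: (@leq_trans (k * a.+1)); last by rewrite leq_mul2l lt orbT.
by rewrite mulnS leq_add2r.
Qed.

Lemma node_leaf N W nm m fr pd y : rep N W nm m fr pd -> goodN N W -> nd N W y ->
  (m (nm y) == 0) = (y \in W).
Proof.
move=> R gN /orP [Ny|yW]; last by rewrite (r_leaf R yW) yW.
by rewrite (r_int R Ny) (negbTE (gN.2 _ Ny).1).
Qed.

Lemma child_ex N W nm m fr pd x u c : hterm hash W -> goodN N W -> rep N W nm m fr pd ->
  N x -> prefix (rcons x c) u -> pre W u ->
  exists y, [/\ edge N W x y, m (nm x + 5 + code c) = nm y, prefix (rcons x c) y &
                prefix y u \/ prefix u y].
Proof.
move=> hW gN R Nx pu preu.
have [y ed pxy] := edge_ex Nx (pre_prefix pu preu).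
exists y; split=> //.
  rewrite -(r_child R ed); congr (m (_ + code _)).
  by rewrite (nth_prefix _ pxy) ?size_rcons // nth_rcons ltnn eqxx.
apply: (edge_cmp hW gN ed preu); first exact: prefix_rconsl pu.
by exists c.
Qed.

(** * Locating strings in the trie *)

Definition rescan_regs := [:: rU; rDU; rY; rC; rGo].
Definition rescan_unit := (cmax rescan_body + tcost (TEq rGo #1)).*2 + cmax (rGo <~ #1).

(** Every iteration but the last moves to a deeper node, so the gain in depth pays, even if the
    located string is much longer. *)
Lemma run_rescan N W nm pd s x : inv N W nm pd s -> at_node N W nm (reg s) x ->
  runs rescan s (fun T s' => same_but rescan_regs s s' /\
    exists x', [/\ locus N W nm (reg s') x', size x <= size x' &
                   T <= rescan_unit * (size x' - size x + 1)]).
Proof.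
move=> Is atx; apply: runs_seq; apply: runs_run => // T0 lT0.
set s1 := run _ _.
pose I s' := same_but rescan_regs s s' /\ exists x', [/\ at_node N W nm (reg s') x', size x <= size x' &
  reg s' rGo <> 1 -> locus N W nm (reg s') x'].
pose k := cmax rescan_body + tcost (TEq rGo #1).
(* The flag pays for the last iteration, which only clears [rGo]. The part of the string that
   remains below the last node is returned at the end. *)
pose Phi s' := k * ((reg s' rE - reg s' rJ - reg s' rDU) + (reg s' rGo == 1)).
have I1 : I s1.
  split; last by exists x; split=> //.
  by rewrite /s1; case: (s) => f m; apply: same_upd.
have [|T [s' [ex [[sb [x' [at' le lo]]] ng lT]]]] := runs_while (I := I) (Phi := Phi) (p := rescan_body) (b := TEq rGo #1) _ I1.
  move=> {I1} [f m] [sb [x' [at' le _]]] /= /eqP go.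
  apply: runs_run => // T lT.
  pose G s2 := I s2 /\ T + tcost (TEq rGo #1) + Phi s2 <= Phi (State f m).
  rewrite -/(G (run rescan_body (State f m))).
  have lT' : T + tcost (TEq rGo #1) <= k by rewrite leq_add2r.
  have [cs st R [hW gN] _] := inv_same (s := s) (l := rescan_regs) isT sb Is.
  have [Nx /andP [bnd bE] subx [eu edu] preW] := at'.
  cbn [reg mem] in *.
  have hPhi f' : f' 9 - f' 8 - f' 11 + (f' 14 == 1) < f 9 - f 8 - f 11 + (f 14 == 1) ->
      T + tcost (TEq rGo #1) + Phi (State f' m) <= Phi (State f m).
    by move=> h; rewrite /Phi /=; apply: pay.
  rewrite /rescan_body run_if; ev.
  case: eqP => [e|ne].
    rewrite run_asg; ev; split; last by apply: hPhi; ev; rewrite go; clear; lia.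
    split; first exact: same_upd.
    by exists x'; split=> // _; split=> //; left; ev; clear -e edu; lia.
  rewrite run_seq run_get_b //; ev; last by clear -bnd bE edu ne; lia.
  set c := nth hash B _.
  have ec : rcons x' c = sub (f 8) (f 8 + size x').+1.
    by rewrite sub_rcons ?subx /c ?edu //; clear -bnd bE edu ne; lia.
  have [|y [ed chy pxy cmp]] := child_ex (c := c) hW gN R Nx _ preW.
    by rewrite ec sub_prefix //; clear -bnd bE edu ne; lia.
  rewrite run_seq run_asg; ev; rewrite eu chy.
  have [_ ny pxy' lxy _] := ed.
  rewrite run_if; ev; rewrite (node_leaf R gN ny).
  have sz := size_sub (f 8) bE.
  have sb' : same_but rescan_regs s (State (upd (upd (upd f 13 (code c)) 12 (nm y)) 14 0) m).
    by do 3!apply: same_upd => //.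
  have stop : prefix (sub (f 8) (f 9)) y -> (N y -> f 9 - f 8 < size y) ->
      G (State (upd (upd (upd f 13 (code c)) 12 (nm y)) 14 0) m).
    move=> pc lN; split; last by apply: hPhi; ev; rewrite go; clear; lia.
    split=> //; exists x'; split=> // _; split=> //; right; exists y; split=> //; ev; clear -bnd bE edu ne; lia.
  case: ifP => yW.
    rewrite run_asg; ev; apply: stop; last by move=> /(gN.2 _) [/negP].
    by case: cmp => // p; rewrite (word_max hW yW preW p) prefix_refl.
  have Ny : N y by move: ny; rewrite /nd yW orbF.
  rewrite run_if /len_y; ev; rewrite (label_size R ed Ny).
  case: leqP => [le2|lt2].
    rewrite run_seq !run_asg; ev; rewrite (label_size R ed Ny).
    have py : prefix y (sub (f 8) (f 9)).
      by case: cmp => // p; rewrite (prefix_size_eq p) ?prefix_refl // sz; clear -le2 edu lxy; lia.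
    split; last by apply: hPhi; ev; clear -le2 edu lxy; lia.
    split; first by do 4!apply: same_upd => //.
    exists y; split; last by ev; rewrite go.
      split=> //; ev; last by split=> //; clear -edu lxy; lia.
        by apply/andP; split=> //; clear -le2 edu lxy; lia.
      by rewrite -(sub_take bE py).
    by clear -le lxy; lia.
  rewrite run_asg; ev; apply: stop; last by clear -lt2 edu lxy bnd; lia.
  case: cmp => // p; exfalso; move: (size_pfx p); rewrite sz; clear -lt2 edu lxy bnd; lia.
exists T, s'; split=> //; split=> //; exists x'.
have lex := le.
have lx : locus N W nm (reg s') x' by apply: lo => h; move/eqP: ng; rewrite /= h.
split=> //.
have [[_ /andP [b1 b2] _ [_ e2] _] _] := lx.
have [_ /andP [b3 b4] _ [_ e4] _] := atx.
have e5 : reg s' 8 = reg s 8 by case: sb => _ ->.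
have e6 : reg s' 9 = reg s 9 by case: sb => _ ->.
move: lT; rewrite /Phi; have -> : reg s1 9 - reg s1 8 - reg s1 11 + (reg s1 14 == 1) =
  (size x' - size x + 1) + (reg s' 9 - reg s' 8 - reg s' 11).
  rewrite /s1; case: (s) e4 b3 e5 e6 => f m; rewrite run_asg; ev => e4 b3 e5 e6; clear -e2 e4 e5 e6 b1 b3 lex; lia.
have -> : (reg s' 14 == 1) = false by apply: negbTE.
rewrite addn0 /rescan_unit -/k; set D := size x' - size x + 1.
have Dp : 0 < D by rewrite /D addn1.
have := leq_pmulr k Dp; have := leq_pmulr (cmax (14 <~ #1)) Dp.
move: lT0; have : tcost (TEq 14 #1) <= k by rewrite leq_addl.
rewrite mulnDr -addnn !mulnDl; clear; lia.
Qed.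

Lemma run_skip s : run Skip s = s. Proof. by []. Qed.

Lemma code_inj : injective (@code Sigma).
Proof. by move=> c d /ord_inj /enum_rank_inj. Qed.

Lemma mid_next N W x y cur c : hterm hash W -> goodN N W -> edge N W x y -> prefix cur y ->
  size x < size cur < size y -> pre W (rcons cur c) -> prefix (rcons cur c) y.
Proof.
move=> hW gN ed pc /andP [l1 l2] pr; have [_ _ px lxy _] := ed.
have pxc : prefix x cur by apply: (prefix_comparable px pc); apply: ltnW.
have := edge_cmp hW gN ed pr (prefix_trans pxc (prefix_rcons _ _)).
have pn := prefix_next hash px lxy.
case=> [|p|//].
  exists (nth hash y (size x)) => //.
  apply: prefix_trans (prefix_rcons _ _).
  by apply: (prefix_comparable pn pc); rewrite size_rcons.
have e : y = rcons cur c by apply: (prefix_size_eq p); rewrite size_rcons.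
by rewrite e prefix_refl.
Qed.

Definition scan_regs := [:: rE; rU; rDU; rY; rC; rGo; rC2].
Definition scan_unit := (cmax scan_body + tcost (TEq rGo #1)).*2 + cmax (rGo <~ #1).

(** The potential is the unread part of [B]; what is left of it at the end is returned, so that only
    the advance of [rE] is paid for. *)
Lemma run_scan N W nm pd s x : inv N W nm pd s -> locus N W nm (reg s) x ->
  runs scan s (fun T s' => same_but scan_regs s s' /\
    exists x', [/\ locus N W nm (reg s') x', size x <= size x', reg s rE <= reg s' rE,
       reg s' rE = size B \/
         ~~ pre W (rcons (sub (reg s' rJ) (reg s' rE)) (nth hash B (reg s' rE)))
     & T <= scan_unit * (reg s' rE - reg s rE + 1)]).
Proof.
move=> Is atx; apply: runs_seq; apply: runs_run => // T0 lT0.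
set s1 := run _ _.
pose I s' := same_but scan_regs s s' /\ exists x', [/\ locus N W nm (reg s') x', size x <= size x',
  reg s rE <= reg s' rE & reg s' rGo <> 1 -> reg s' rE = size B \/
         ~~ pre W (rcons (sub (reg s' rJ) (reg s' rE)) (nth hash B (reg s' rE)))].
pose k := cmax scan_body + tcost (TEq rGo #1).
pose Phi s' := k * ((size B - reg s' rE) + (reg s' rGo == 1)).
have I1 : I s1.
  split; last by exists x; split=> //.
  by rewrite /s1; case: (s) => f m; apply: same_upd.
have [|T [s' [ex [[sb [x' [lx lex le lo]]] ng lT]]]] := runs_while (I := I) (Phi := Phi) (p := scan_body) (b := TEq rGo #1) _ I1.
  move=> {I1} [f m] [sb [x' [lx lex le _]]] /= /eqP go.
  apply: runs_run => // T lT.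
  pose G s2 := I s2 /\ T + tcost (TEq rGo #1) + Phi s2 <= Phi (State f m).
  rewrite -/(G (run scan_body (State f m))).
  have lT' : T + tcost (TEq rGo #1) <= k by rewrite leq_add2r.
  have [cs st R [hW gN] _] := inv_same (s := s) (l := scan_regs) isT sb Is.
  have [[Nx /andP [bnd bE] subx [eu edu] preW] alt] := lx.
  cbn [reg mem] in *.
  have hPhi f' : (size B - f' 9) + (f' 14 == 1) < (size B - f 9) + (f 14 == 1) ->
      T + tcost (TEq rGo #1) + Phi (State f' m) <= Phi (State f m).
    by move=> h; rewrite /Phi /=; apply: pay.
  have eB : f rAlphaLen + f rDeltaLen + f rGammaLen = size B.
    by case: cs => _ -> _ -> ->; rewrite !size_cat addnA.
  rewrite /scan_body run_if /len_b; ev; rewrite eB.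
  case: eqP => [e|ne].
    rewrite run_asg; ev; split; last by apply: hPhi; ev; rewrite go; clear; lia.
    split; first exact: same_upd.
    by exists x'; split=> //; left.
  have ltB : f 9 < size B by clear -bE ne; lia.
  rewrite run_seq run_get_b //; ev.
  set c := nth hash B _; set cur := sub (f 8) (f 9).
  have szc : size cur = f 9 - f 8 by apply: size_sub.
  have lej : f 8 <= f 9 by clear -bnd; lia.
  have scur : sub (f 8) (f 9).+1 = rcons cur c by rewrite sub_rcons.
  set IF := If _ _ _; rewrite run_seq.
  (* Either the string ends at a node without an arc for [c], or there is an arc to follow. In the
     second case the string ends inside the arc, or at its upper end and the arc was selected by
     [c]. *)
  have [f2 [ef2 same2 h2]] : exists f2, [/\ run IF (State (upd f 13 (code c)) m) = State f2 m,
     forall r, r <> 12 -> f2 r = upd f 13 (code c) r &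
     (size x' = f 9 - f 8 /\ f2 12 = 0 /\ ~~ pre W (rcons cur c)) \/
     exists y, [/\ edge N W x' y, prefix cur y, size cur < size y, f2 12 = nm y &
       size x' < size cur \/ prefix (rcons cur c) y]].
    rewrite /IF run_if; ev; rewrite edu; case: eqP => [e|ne2].
      have ecur : cur = x' by rewrite /cur -e subx.
      exists (upd (upd f 13 (code c)) 12 (m (nm x' + 5 + code c))); split.
      - by rewrite run_asg; ev; rewrite eu.
      - by move=> r /eqP nr; rewrite updE (negbTE nr).
      case: (boolP (pre W (rcons cur c))) => pr; [right|left].
        have [|y [ed chy pxy _]] := child_ex (x := x') (c := c) hW gN R Nx _ pr.
          by rewrite ecur prefix_refl.
        exists y; rewrite ecur; split=> //; first exact: prefix_rconsl pxy.
          by case: ed.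
        by right.
      by rewrite /= (r_null R) // -?ecur // ecur; split=> //; rewrite -ecur szc.
    exists (upd f 13 (code c)); split=> //; right.
    case: alt => [e|[y [ed pc lt ey yN]]]; first by case: ne2; clear -e lej; lia.
    exists y; split=> //; last by left; rewrite szc.
    rewrite szc; have [_ ny _ _ _] := ed; case/orP: ny => [/yN //|yW].
    rewrite ltnNge -szc; apply/negP => h.
    by apply: (@sub_not_word W y (f 8) (f 9) hW yW) => //; rewrite (prefix_size_eq pc) ?prefix_refl.
  rewrite ef2 run_if; ev.
  have sb2 : same_but scan_regs s (State f2 m).
    case: sb => /= e h; split=> //= r nr; rewrite same2; last by move=> e2; rewrite e2 in nr.
    by rewrite updE; case: eqP => [e2|_]; [rewrite e2 in nr | apply: h].
  have r2 r : r \notin [:: 12; 13] -> f2 r = f r.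
    rewrite !inE negb_or => /andP [/eqP n1 /negbTE n2].
    by rewrite same2 // updE n2.
  have c2 : f2 13 = code c by rewrite same2.
  case: h2 => [[ex2 [e12 npr]]|[y [ed pc lcy e12 nxt]]].
    rewrite e12 /= run_asg; ev; split; last first.
      by apply: hPhi; ev; rewrite go (r2 9) //; clear -ltB; lia.
    split; first exact: same_upd.
    exists x'; split=> //=; rewrite ?updE /= ?r2 //; last by right.
    by rewrite /locus /at_node; ev; rewrite !r2 //; split; [split=> //; apply/andP | left].
  have [_ ny px lxy _] := ed.
  have [nmp _] := r_pos R ny; rewrite e12 (gtn_eqF nmp) /=.
  have cs2 : consts f2 by move: cs; rewrite /consts !r2.
  have [S eS hS] := label_nth R ed.
  have [|lS eqS] := hS (f 9 - (f 8 + size x')).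
    by clear -lcy szc lxy bnd; lia.
  rewrite run_seq (run_get_s _ (S := S)) //; ev; rewrite ?e12 ?r2 ?edu //.
  rewrite eqS; have -> : size x' + (f 9 - (f 8 + size x')) = size cur.
    by clear -szc bnd; lia.
  set d := nth hash y _; rewrite run_if; ev; rewrite c2.
  have sb3 : same_but scan_regs s (State (upd f2 20 (code d)) m) by apply: same_upd.
  have pd' : prefix (rcons cur d) y by apply: prefix_next.
  case: eqP => [ecd|necd].
    have {}ecd : c = d := code_inj ecd.
    have p1 : prefix (sub (f 8) (f 9).+1) y by rewrite scur ecd.
    have pr1 : pre W (sub (f 8) (f 9).+1) := pre_prefix p1 (edge_pre gN ed).
    rewrite run_seq run_asg; ev; rewrite r2 // addn1.
    set f3 := upd _ 9 _.
    have r3 r : r \notin [:: 9; 12; 13; 20] -> f3 r = f r.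
      rewrite !inE !negb_or => /and4P [n1 n2 n3 n4].
      by rewrite /f3 !updE (negbTE n1) (negbTE n4) r2 // !inE negb_or n2.
    have f39 : f3 9 = (f 9).+1 by [].
    have f312 : f3 12 = nm y by [].
    have sb4 : same_but scan_regs s (State f3 m) by apply: same_upd.
    have stay : (N y -> (f 9).+1 - f 8 < size y) -> G (State f3 m).
      move=> lN; split; last by apply: hPhi; rewrite f39 r3 //; clear -ltB; lia.
      split=> //; exists x'; rewrite /= f39 r3 // go; split=> //; last by clear -le; lia.
      rewrite /locus /at_node /mid_edge !f39 f312 !r3 //; split.
        by split=> //; apply/andP; split=> //; clear -bnd; lia.
      by right; exists y; split=> //; clear -bnd; lia.
    rewrite run_if; cbn [teval eval reg mem]; rewrite f312 (node_leaf R gN ny).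
    case: ifP => yW; first by apply: stay => /(gN.2 _) [/negP].
    have Ny : N y by move: ny; rewrite /nd yW orbF.
    rewrite run_if /len_y; cbn [teval eval reg mem]; rewrite f312 (label_size R ed Ny) f39 !r3 // edu.
    have sz1 : size (sub (f 8) (f 9).+1) = (f 9).+1 - f 8 by apply: size_sub.
    case: eqP => [e2|ne2].
      rewrite run_seq !run_asg; cbn [eval reg mem]; rewrite !updE /= f39 f312 !r3 //.
      have ey : sub (f 8) (f 9).+1 = y.
        by apply: (prefix_size_eq p1); rewrite sz1; clear -e2 lxy bnd; lia.
      have ly : size y = (f 9).+1 - f 8 by rewrite -ey.
      split; last by apply: hPhi; rewrite !updE /= f39 r3 //; clear -ltB; lia.
      split; first by do 2!apply: same_upd => //.
      exists y; rewrite /= !updE /= f39 r3 // go; split=> //; last by clear -le; lia.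
        rewrite /locus /at_node !updE /= !f39 !r3 //; split; last by left.
        split=> //.
        - by apply/andP; split=> //; clear -ly lej; lia.
        - by rewrite ly subnKC ?ey //; clear -lej; lia.
      by clear -lex lxy; lia.
    rewrite run_skip; apply: stay => _; move: (size_pfx p1); rewrite sz1.
    by clear -ne2 lxy lej; lia.
  rewrite run_asg; ev; split; last first.
    by apply: hPhi; ev; rewrite r2 // go; clear; lia.
  split; first by apply: same_upd.
  exists x'; rewrite /= !updE /= !r2 //; split=> //.
    rewrite /locus /at_node /mid_edge !updE /= e12 !r2 //; split; first by split=> //; apply/andP.
    case: nxt => [lt|p]; last by case: necd; rewrite (prefix_rcons_inj p pd').
    by right; exists y; rewrite -szc; split.
  (* Inside an arc the trie has a single continuation, and the next character of the label differs
     from that of [B]. *)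
  move=> _; right; apply/negP => pr; case: necd.
  case: nxt => [lt|p]; last by rewrite (prefix_rcons_inj p pd').
  have l2 : size x' < size cur < size y by rewrite lt.
  congr code; exact: prefix_rcons_inj (mid_next hW gN ed pc l2 pr) pd'.
exists T, s'; split=> //; split=> //; exists x'.
have ng' : reg s' 14 <> 1 by move/eqP: ng.
split=> //; first exact: lo.
have [[_ /andP [b1 b2] _ _ _] _] := lx.
have [[_ /andP [b3 b4] _ _ _] _] := atx.
move: lT; rewrite /Phi; have -> : (size B - reg s1 9) + (reg s1 14 == 1) =
  (reg s' 9 - reg s 9 + 1) + (size B - reg s' 9).
  rewrite /s1; case: (s) b4 le => f m; ev; rewrite updE /=; clear -b2; lia.
have -> : (reg s' 14 == 1) = false by apply: negbTE.
rewrite addn0 /scan_unit -/k; set D := reg s' 9 - reg s 9 + 1.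
have Dp : 0 < D by rewrite /D addn1.
have := leq_pmulr k Dp; have := leq_pmulr (cmax (14 <~ #1)) Dp.
move: lT0; have : tcost (TEq 14 #1) <= k by rewrite leq_addl.
rewrite mulnDr -addnn !mulnDl; clear; lia.
Qed.

(** Disjointness of records splits an equation between addresses into one between nodes and one
    between offsets. *)
Lemma addr_eq nm v v' k k' :
  (v <> v' -> nm v + rs <= nm v' \/ nm v' + rs <= nm v) -> k < rs -> k' < rs ->
  (nm v + k == nm v' + k') = (v == v') && (k == k').
Proof.
move=> dis lk lk'; case: (eqVneq v v') => [<-|ne]; first by rewrite eqn_add2l.
by apply: negbTE; apply/eqP; case: (dis (elimN eqP ne)); clear -lk lk'; lia.
Qed.

Lemma code_lt (c : Sigma) : 5 + code c < rs.
Proof. by rewrite /rec_size ltn_add2l /code ltn_ord. Qed.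

(** * Splitting an arc *)

Section EdgeSplit.
Variables (N : pred word) (W : seq word) (x y cur : word).
Hypotheses (hW : hterm hash W) (gN : goodN N W) (ed : edge N W x y) (pc : prefix cur y)
  (lt1 : size x < size cur) (lt2 : size cur < size y).
Let N' : pred word := fun z => (z == cur) || N z.

Lemma split_new : ~~ nd N W cur.
Proof.
apply/negP => h; case: ed => _ _ _ _ /(_ _ h pc lt1) e.
by move: lt2; rewrite e ltnn.
Qed.

Lemma split_prefix : prefix x cur.
Proof. by case: ed => _ _ p _ _; apply: (prefix_comparable p pc (ltnW lt1)). Qed.

Lemma split_nd z : nd N' W z = (z == cur) || nd N W z.
Proof. by rewrite /nd /N' orbA. Qed.

Lemma split_good : goodN N' W.
Proof.
split=> [z /gN.1 h|z]; first by rewrite /N' h orbT.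
case/orP=> [/eqP ->|/(gN.2 _)//]; split.
  by move: split_new; rewrite negb_or => /andP [].
by move=> _; apply: pre_prefix pc (edge_pre gN ed).
Qed.

Lemma split_edge1 : edge N' W x cur.
Proof.
have [Nx _ px lxy bt] := ed; split=> //.
- by rewrite /N' Nx orbT.
- by rewrite split_nd eqxx.
- exact: split_prefix.
move=> z; rewrite split_nd => /orP [/eqP ->|nz] pz lz //.
have e := bt z nz (prefix_trans pz pc) lz.
by move: (size_pfx pz) lt2; rewrite e ltnNge => ->.
Qed.

Lemma split_edge2 : edge N' W cur y.
Proof.
have [Nx ny px lxy bt] := ed; split=> //.
- by rewrite /N' eqxx.
- by rewrite split_nd ny orbT.
move=> z; rewrite split_nd => /orP [/eqP -> _|nz pz lz]; first by rewrite ltnn.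
by apply: bt => //; apply: ltn_trans lz.
Qed.

(** The new node has no other arc below it: a second one would make [cur] branching, hence a node
    before the split. *)
Lemma split_edge a b : edge N' W a b ->
  [\/ a = x /\ b = cur, a = cur /\ b = y | [/\ edge N W a b, b <> y, a <> cur & b <> cur]].
Proof.
move=> h; case: (eqVneq b cur) => [e|nb].
  by constructor 1; split=> //; rewrite e in h; apply: edge_parent_uniq split_edge1.
have nb' : nd N W b by case: h => _; rewrite split_nd (negbTE nb).
case: (eqVneq a cur) => [e|na].
  constructor 2; split=> //; rewrite e in h.
  have prb := edge_pre split_good h; have pry := edge_pre split_good split_edge2.
  have [_ _ pb lb _] := h.
  have n1 := prefix_next hash pb lb; have n2 := prefix_next hash pc lt2.
  case: (eqVneq (nth hash b (size cur)) (nth hash y (size cur))) => [e2|ne].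
    by rewrite e2 in n1; apply: (edge_uniq hW split_good h split_edge2 n1 n2).
  case/negP: split_new; rewrite /nd gN.1 //; apply/brP; right.
  exists (nth hash b (size cur)), (nth hash y (size cur)); split=> //.
    exact: pre_prefix n1 prb.
  exact: pre_prefix n2 pry.
have ed' : edge N W a b.
  case: h => Na _ p l bt; split=> //.
    by move: Na; rewrite /N' (negbTE na).
  by move=> z nz; apply: bt; rewrite split_nd nz orbT.
constructor 3; split=> //; try exact/eqP.
move=> e; rewrite e in h.
by case/eqP: na; apply: edge_parent_uniq h split_edge2.
Qed.

End EdgeSplit.

Definition rename nm u (a : nat) : word -> nat := fun v => if v == u then a else nm v.

Lemma rename_other nm u a v : v != u -> rename nm u a v = nm v.
Proof. by rewrite /rename => /negbTE ->. Qed.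

Lemma rename_same nm u a : rename nm u a u = a. Proof. by rewrite /rename eqxx. Qed.

(** The last hypothesis lists the only cells of old records that may change: the start of the label
    of [y], one child entry of [x], and the link of the pending node. The new node then takes over
    the role of the node without a link. *)
Lemma rep_split N W nm m m' fr pd x y cur :
  hterm hash W -> goodN N W -> rep N W nm m fr pd ->
  edge N W x y -> prefix cur y -> size x < size cur -> size cur < size y ->
  (forall b w, pd = Some (b :: w) -> w = cur) -> 
  m' fr = 1 -> m' (fr + 1) = m (nm y + 1) -> m' (fr + 2) = m (nm y + 2) ->
  m' (fr + 3) = m (nm y + 2) + (size cur - size x) ->
  (forall c, m' (fr + 5 + code c) = if c == nth hash y (size cur) then nm y else 0) ->
  (forall v k, nd N W v -> k < rs -> m' (nm v + k) =
     if (v == y) && (k == 2) then m (nm y + 2) + (size cur - size x)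
     else if (v == x) && (k == 5 + code (nth hash y (size x))) then fr
     else if (Some v == pd) && (k == 4) then fr
     else m (nm v + k)) ->
  rep (fun z => (z == cur) || N z) W (rename nm cur fr) m' (fr + rs) (Some cur).
Proof.
move=> hW gN R ed pc lt1 lt2 hpd M0 M1 M2 M3 MC MV.
set N' := fun z => _.
have new := split_new ed pc lt1 lt2.
have nmv v : nd N W v -> rename nm cur fr v = nm v.
  by move=> h; apply: rename_other; apply: contraNneq new => <-.
have nmc := rename_same nm cur fr.
have ndN v : N v -> nd N W v by rewrite /nd => ->.
have ndW v : v \in W -> nd N W v by rewrite /nd orbC => ->.
have [Nx ny px lxy _] := ed.
have rs5 k : k < 5 -> k < rs by move=> h; apply: leq_trans h (leq_addr _ _).
have M00 v : nd N W v -> m' (nm v) = m (nm v).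
  by move=> nv; rewrite -[nm v]addn0 MV // ?andbF ?addn0 //; apply: rs5.
have M01 v : nd N W v -> m' (nm v + 1) = m (nm v + 1).
  by move=> nv; rewrite MV ?andbF //; apply: rs5.
have M03 v : nd N W v -> m' (nm v + 3) = m (nm v + 3).
  by move=> nv; rewrite MV ?andbF //; apply: rs5.
have M02 v : nd N W v -> m' (nm v + 2) = if v == y then m (nm y + 2) + (size cur - size x) else m (nm v + 2).
  by move=> nv; rewrite MV ?andbT ?andbF //; apply: rs5.
have M04 v : nd N W v -> m' (nm v + 4) = if Some v == pd then fr else m (nm v + 4).
  by move=> nv; rewrite MV ?andbT ?andbF //; apply: rs5.
have M05 v c : nd N W v -> m' (nm v + 5 + code c) =
    if (v == x) && (c == nth hash y (size x)) then fr else m (nm v + 5 + code c).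
  move=> nv; rewrite -addnA MV ?code_lt // eqn_add2l (inj_eq code_inj).
  by rewrite !andbF.
have splitE := @split_edge N W x y cur hW gN ed pc lt1 lt2.
have lf := label_nth R ed.
have px' := split_prefix ed pc lt1.
split.
- by move=> w wW; rewrite nmv ?M00 ?(r_leaf R wW) //; apply: ndW.
- move=> z /orP [/eqP ->|Nz]; first by rewrite nmc.
  by rewrite nmv ?M00 ?(r_int R Nz) //; apply: ndN.
- move=> a b /splitE [[-> ->]|[-> ->]|[h nb nac nbc]].
  + rewrite nmc nmv ?M05 ?ndN // eqxx /= (nth_prefix hash pc lt1) eqxx.
    by [].
  + by rewrite nmc nmv // MC eqxx.
  have [Na nd_b _ _ _] := h.
  rewrite nmv ?M05 ?ndN // nmv // (r_child R h).
  case: andP => // -[/eqP e1 /eqP e2]; case: nb.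
  have [_ _ pab lab _] := h.
  have n1 := prefix_next hash pab lab; have n2 := prefix_next hash px lxy.
  by rewrite e2 e1 in n1; rewrite e1 in h; apply: (edge_uniq hW gN h ed n1 n2).
- move=> a c /orP [/eqP ->|Na] np.
    rewrite nmc MC; case: eqP => // e; case/negP: np; rewrite e.
    by apply: pre_prefix (prefix_next hash pc lt2) (edge_pre gN ed).
  rewrite nmv ?M05 ?ndN //; case: andP => [[/eqP e1 /eqP e2]|_]; last exact: (r_null R).
  case/negP: np; rewrite e1 e2.
  exact: pre_prefix (prefix_next hash px lxy) (edge_pre gN ed).
- move=> a b /splitE [[-> ->]|[-> ->]|[h nb nac nbc]] bW.
  + by case/negP: new; apply: ndW.
  + have [S [p [e1 e2 e3]]] := r_lleaf R ed bW.
    exists S, p; rewrite nmv // M01 // M02 // eqxx e3; split=> //.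
    by clear -lt1; lia.
  have nb' := ndW _ bW; have [S [p [e1 e2 e3]]] := r_lleaf R h bW.
  by exists S, p; rewrite nmv // M01 // M02 //; move/eqP/negbTE: nb => ->.
- move=> a b /splitE [[-> ->]|[-> ->]|[h nb nac nbc]] Nb.
  + have [S eS hS] := lf; exists S; rewrite nmc M1 M3 M2; split=> //.
      have [|l _] := hS (size cur - size x).-1; first by clear -lt1 lt2; lia.
      by move: l; clear -lt1; lia.
    rewrite addKn; have lo o : o < size cur - size x -> o < size y - size x by clear -lt2; lia.
    have sz : size (take (size cur - size x) (drop (m (nm y + 2)) S)) = size cur - size x.
      rewrite size_takel // size_drop.
      have [|l _] := hS (size cur - size x).-1; first by clear -lt1 lt2; lia.
      by move: l; clear -lt1; lia.
    apply: (@eq_from_nth _ hash); first by rewrite sz size_drop.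
    move=> i; rewrite size_drop => li; rewrite nth_drop nth_take // nth_drop.
    by rewrite (hS _ (lo _ li)).2 (nth_prefix hash pc) //; clear -li; lia.
  + have Ny : N y.
      by case/orP: Nb => // /eqP e; rewrite -e ltnn in lt2.
    have [S [e1 le e2]] := r_lint R ed Ny.
    exists S; rewrite nmv // M01 // M02 // M03 // eqxx; split=> //.
    have -> : drop (size cur) y = drop (size cur - size x) (drop (size x) y).
      by rewrite drop_drop subnK // ltnW.
    rewrite e2 subnDA [m (nm y + 2) + _]addnC -drop_drop [RHS]take_drop; congr (drop _ (take _ _)).
    have := label_size R ed Ny; clear -lt1 lt2 lxy; lia.
  have Nb' : N b by case/orP: Nb => // /eqP.
  have nb' := ndN _ Nb'; have [S [e1 le e2]] := r_lint R h Nb'.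
  exists S; rewrite nmv // M01 // M02 // M03 //; move/eqP/negbTE: nb => ->.
  by split.
- move=> c w /orP [/eqP e|Nz] ne; first by case: ne; rewrite e.
  rewrite nmv ?M04 ?ndN //; case: eqP => [e|ne2].
    by have ew := hpd c w (esym e); rewrite ew nmc /N' eqxx.
  have [Nw ->] := r_link R Nz ne2.
  by rewrite /N' Nw orbT nmv // ndN.
- move=> z; rewrite split_nd => /orP [/eqP ->|nz].
    rewrite nmc leqnn; have [p1 p2] := r_pos R ny; split=> //.
    by apply: leq_trans p2; apply: leq_trans p1 (leq_addr _ _).
  by rewrite nmv //; have [p1 p2] := r_pos R nz; split=> //; apply: leq_trans p2 (leq_addr _ _).
- move=> z z'; rewrite !split_nd => /orP [/eqP ->|nz] /orP [/eqP ->|nz'] //.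
  + by move=> _; rewrite nmc nmv //; right; case: (r_pos R nz').
  + by move=> _; rewrite nmc nmv //; left; case: (r_pos R nz).
  + by rewrite !nmv //; apply: (r_dis R).
- move=> z i; rewrite split_nd => /orP [/eqP ->|nz] li; last by rewrite nmv //; apply: (r_A R).
  by rewrite nmc; left; apply: (r_strA R).
- move=> z i; rewrite split_nd => /orP [/eqP ->|nz] li; last by rewrite nmv //; apply: (r_D R).
  by rewrite nmc; left; apply: (r_strD R).
- by move=> i li; apply: leq_trans (r_strA R li) (leq_addr _ _).
- by move=> i li; apply: leq_trans (r_strD R li) (leq_addr _ _).
Qed.

(** * Adding a leaf *)

Section EdgeLeaf.
Variables (N : pred word) (W : seq word) (w cur : word) (c : Sigma).
Hypotheses (hW : hterm hash W) (hw : exists2 w', w = rcons w' hash & hash \notin w')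
  (gN : goodN N W) (Nc : N cur) (pcw : prefix (rcons cur c) w) (npre : ~~ pre W (rcons cur c)).

Lemma leaf_hterm : hterm hash (w :: W).
Proof. by move=> v; rewrite inE => /orP [/eqP ->|/hW]. Qed.

Lemma leaf_notnd z : nd N W z -> prefix z w -> size z <= size cur.
Proof.
move=> nz pz; rewrite leqNgt; apply/negP => lt; case/negP: npre.
have zn : z != [::] by case: z lt {nz pz}.
apply: pre_prefix (nd_pre gN nz zn).
by apply: (prefix_comparable pcw pz); rewrite size_rcons.
Qed.

Lemma leaf_new : ~~ nd N W w.
Proof.
apply/negP => /leaf_notnd /(_ (prefix_refl _)) h; move: (size_pfx pcw).
by rewrite size_rcons => /leq_trans /(_ h); rewrite ltnn.
Qed.

Lemma leaf_nd z : nd N (w :: W) z = (z == w) || nd N W z.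
Proof. by rewrite /nd inE orbCA. Qed.

Lemma leaf_good : cur \notin W -> pre W cur -> goodN N (w :: W).
Proof.
move=> cW pc; split=> z.
  by rewrite (br_insert pc pcw npre cW) => /orP [/eqP ->|/gN.1].
move=> Nz; have [zW zp] := gN.2 _ Nz; split.
  rewrite inE negb_or zW andbT; apply/eqP => e; case/negP: leaf_new.
  by rewrite /nd -e Nz.
by move=> /zp h; rewrite pre_insert h orbT.
Qed.

Lemma leaf_edge1 : edge N (w :: W) cur w.
Proof.
split=> //.
- by rewrite leaf_nd eqxx.
- exact: prefix_rconsl pcw.
- by move: (size_pfx pcw); rewrite size_rcons.
move=> z; rewrite leaf_nd => /orP [/eqP -> //|nz] pz lz.
by move: (leaf_notnd nz pz); rewrite leqNgt lz.
Qed.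

Lemma leaf_edge a b : goodN N (w :: W) -> edge N (w :: W) a b ->
  (a = cur /\ b = w) \/ [/\ edge N W a b, b <> w & a <> w].
Proof.
move=> gN' h; case: (eqVneq b w) => [e|nb].
  left; split=> //; rewrite e in h.
  exact: edge_parent_uniq h leaf_edge1.
right; have [Na nb' p l bt] := h; split; try exact/eqP.
  split=> //; first by move: nb'; rewrite leaf_nd (negbTE nb).
  by move=> z nz; apply: bt; rewrite leaf_nd nz orbT.
by move=> e; case/negP: leaf_new; rewrite /nd -e Na.
Qed.

End EdgeLeaf.

Lemma rep_leaf N W nm m m' fr pd w cur c e j :
  hterm hash W -> goodN N W -> rep N W nm m fr pd -> N cur -> cur \notin W -> pre W cur ->
  prefix (rcons cur c) w -> ~~ pre W (rcons cur c) -> w = drop j B -> size cur = e - j -> j <= e ->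
  m' fr = 0 -> m' (fr + 1) = 1 -> m' (fr + 2) = e ->
  (forall v k, nd N W v -> k < rs -> m' (nm v + k) =
     if (v == cur) && (k == 5 + code c) then fr else m (nm v + k)) ->
  rep N (w :: W) (rename nm w fr) m' (fr + rs) pd.
Proof.
move=> hW gN R Nc cW pc pcw npre ew szc lje M0 M1 M2 MV.
have new := leaf_new gN pcw npre.
have gN' := leaf_good gN Nc pcw npre cW pc.
have nmv v : nd N W v -> rename nm w fr v = nm v.
  by move=> h; apply: rename_other; apply: contraNneq new => <-.
have nmw := rename_same nm w fr.
have ndN v : N v -> nd N W v by rewrite /nd => ->.
have ndW v : v \in W -> nd N W v by rewrite /nd orbC => ->.
have rs5 k : k < 5 -> k < rs by move=> h; apply: leq_trans h (leq_addr _ _).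
have M00 v k : k < 5 -> nd N W v -> m' (nm v + k) = m (nm v + k).
  by move=> k5 nv; rewrite MV ?rs5 // ltn_eqF ?andbF // (leq_trans k5) ?leq_addr.
have M000 v : nd N W v -> m' (nm v) = m (nm v).
  by move=> nv; rewrite -[nm v]addn0 M00.
have M05 v d : nd N W v -> m' (nm v + 5 + code d) =
    if (v == cur) && (d == c) then fr else m (nm v + 5 + code d).
  by move=> nv; rewrite -addnA MV ?code_lt // eqn_add2l (inj_eq code_inj).
have edgeE := @leaf_edge N W w cur c gN Nc pcw npre _ _ gN'.
split.
- move=> v; rewrite inE => /orP [/eqP ->|vW]; first by rewrite nmw.
  by rewrite nmv ?M000 ?(r_leaf R vW) //; apply: ndW.
- by move=> z Nz; rewrite nmv ?M000 ?(r_int R Nz) //; apply: ndN.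
- move=> a b /edgeE [[-> ->]|[h nb na]].
    rewrite nmw nmv ?M05 ?ndN // eqxx.
    by rewrite (nth_prefix hash pcw) ?size_rcons // nth_rcons ltnn eqxx eqxx.
  have [Na nb' pab lab _] := h.
  rewrite nmv ?M05 ?ndN // nmv // (r_child R h).
  case: andP => // -[/eqP e1 /eqP e2]; case/negP: npre; rewrite -e1 -e2.
  exact: pre_prefix (prefix_next hash pab lab) (edge_pre gN h).
- move=> a d Na; rewrite pre_insert negb_or => /andP [np1 np2].
  rewrite nmv ?M05 ?ndN //; case: andP => [[/eqP e1 /eqP e2]|_]; last exact: (r_null R).
  by move: np1; rewrite e1 e2 pcw.
- move=> a b /edgeE [[-> ->]|[h nb na]].
    move=> _; exists B, j; rewrite nmw M1 M2 szc; split=> //.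
    by clear -lje; lia.
  rewrite inE => /orP [/eqP //|bW].
  have [S [p [e1 e2 e3]]] := r_lleaf R h bW.
  by exists S, p; rewrite nmv ?M00 ?ndW.
- move=> a b /edgeE [[-> ->]|[h nb na]] Nb.
    by case/negP: new; apply: ndN.
  have [S [e1 le e2]] := r_lint R h Nb.
  by exists S; rewrite nmv ?M00 ?ndN.
- move=> d v Nv ne; have [Nw e1] := r_link R Nv ne.
  by rewrite nmv ?M00 ?ndN // nmv ?ndN.
- move=> z; rewrite leaf_nd => /orP [/eqP ->|nz].
    rewrite nmw leqnn; have [p1 p2] := r_pos R (ndN _ Nc); split=> //.
    by apply: leq_trans p2; apply: leq_trans p1 (leq_addr _ _).
  by rewrite nmv //; have [p1 p2] := r_pos R nz; split=> //; apply: leq_trans p2 (leq_addr _ _).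
- move=> z z'; rewrite !leaf_nd => /orP [/eqP ->|nz] /orP [/eqP ->|nz'] //.
  + by move=> _; rewrite nmw nmv //; right; case: (r_pos R nz').
  + by move=> _; rewrite nmw nmv //; left; case: (r_pos R nz).
  + by rewrite !nmv //; apply: (r_dis R).
- move=> z i; rewrite leaf_nd => /orP [/eqP ->|nz] li; last by rewrite nmv //; apply: (r_A R).
  by rewrite nmw; left; apply: (r_strA R).
- move=> z i; rewrite leaf_nd => /orP [/eqP ->|nz] li; last by rewrite nmv //; apply: (r_D R).
  by rewrite nmw; left; apply: (r_strD R).
- by move=> i li; apply: leq_trans (r_strA R li) (leq_addr _ _).
- by move=> i li; apply: leq_trans (r_strD R li) (leq_addr _ _).
Qed.

(** * Executing the updates of the trie *)

Lemma run_clear n f m : exists m', [/\ run (clear n) (State f m) = State f m',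
  forall k, k < n -> m' (f rZ + (5 + k)) = 0 &
  forall a, (forall k, k < n -> a <> f rZ + (5 + k)) -> m' a = m a].
Proof.
elim: n => [|n [m' [e h1 h2]]]; first by exists m.
exists (upd m' (f rZ + (5 + n)) 0); split.
- by rewrite /= run_seq e run_mw; ev.
- move=> k; rewrite ltnS leq_eqVlt updE => /orP [/eqP ->|lt]; first by rewrite eqxx.
  by case: eqP => // _; apply: h1.
move=> a ha; rewrite updE; case: eqP => [e2|_]; first by case: (ha n).
by apply: h2 => k lk; apply: ha; apply: ltnW.
Qed.

Lemma strs_keep N W nm m m' fr pd : strs m -> rep N W nm m fr pd ->
  (forall a, a < fr -> (forall v k, nd N W v -> k < rs -> a <> nm v + k) -> m' a = m a) ->
  strs m'.
Proof.
move=> [sA sD] R h; split=> i li.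
  rewrite h ?sA //; first exact: (r_strA R).
  by move=> v k nv lk e; case: (r_A R nv li); clear -e lk; lia.
rewrite h ?sD //; first exact: (r_strD R).
by move=> v k nv lk e; case: (r_D R nv li); clear -e lk; lia.
Qed.

(** At most one link is missing. Its target is the located string [cur], which is no node yet: it
    ends strictly below [x], inside an arc. *)
Definition pending N nm (pd : option word) f x cur : Prop :=
  (pd = None /\ f rPend = 0) \/
  exists b, [/\ pd = Some (b :: cur), N (b :: cur), f rPend = nm (b :: cur) & size x < size cur].

Definition split_regs := [:: rFree; rZ; rC; rC2; rPend; rStr; rBeg; rEnd].

Lemma run_split N W nm pd f m x : inv N W nm pd (State f m) -> locus N W nm f x ->
  f rE < size B ->
  let cur := sub (f rJ) (f rE) in
  let s' := run (split #|Sigma|) (State f m) in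
  pending N nm pd f x cur ->
  exists N' nm' pd', [/\ inv N' W nm' pd' s', forall z, N' z = (z == cur) || N z,
    forall v, nd N W v -> nm' v = nm v,
    (forall r, r \notin split_regs -> reg s' r = f r) /\ reg s' rZ = nm' cur
  & (pd' = None /\ reg s' rPend = 0) /\ cur = x \/
    [/\ pd' = Some cur, reg s' rPend = nm' cur & size x < size cur]].
Proof.
move=> Is lx ltB cur s' PD.
have [cs st R [hW gN] eroot] := Is; cbn [reg mem] in cs, st, R.
have [[Nx /andP [bnd bE] subx [eu edu] preW] alt] := lx.
have szc : size cur = f 9 - f 8 by apply: size_sub.
case: alt => [e|[y [ed pc lt eY yN]]].
  have ex : cur = x.
    by rewrite /cur -[RHS]subx; congr sub; clear -e bnd; lia.
  have es' : s' = State (upd f 19 (nm x)) m.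
    rewrite /s' /split run_if; ev; case: eqP => [_|[]]; last by clear -e edu bnd; lia.
    by rewrite run_asg; ev; rewrite eu.
  exists N, nm, pd; rewrite es'; split.
  - by apply: (inv_same (l := [:: 19]) isT _ Is); apply: same_upd.
  - by move=> z; case: eqP => // ->; rewrite ex Nx.
  - by [].
  - split=> [r|]; last by rewrite ex.
    rewrite /= updE; case: eqP => // ->; by rewrite !inE.
  (* Here [cur] is a node already, so no link can be pending: a pending target lies strictly below
     [x]. *)
  - left; split=> //; rewrite /= updE /=.
    by case: PD => // -[b [_ _ _]]; rewrite ex ltnn.
rewrite -szc in lt yN.
have lcy : size cur < size y.
  have [_ ny _ _ _] := ed; case/orP: ny => [/yN //|yW].
  rewrite ltnNge; apply/negP => h.
  by apply: (@sub_not_word W y (f 8) (f 9) hW yW) => //; rewrite (prefix_size_eq pc) ?prefix_refl.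
have [_ ny px lxy _] := ed.
have new := split_new ed pc lt lcy.
pose N' : pred word := fun z => (z == cur) || N z.
have ndE z : nd N' W z = (z == cur) || nd N W z by apply: split_nd.
have [S eS hS] := label_nth R ed.
set c0 := nth hash B (f 8 + size x).
set d := nth hash y (size cur).
pose fr := f rFree.
have lc0 : f 8 + size x < size B by clear -lt szc ltB; lia.
have lo : size cur - size x < size y - size x by clear -lt lcy; lia.
have [lS eqS] := hS _ lo.
have eo : f 9 - (f 8 + size x) = size cur - size x.
  by clear -lt szc; lia.
have ed' : size x + (size cur - size x) = size cur by clear -lt; lia.
have es1 : exists f', s' = run (clear #|Sigma| ;; 
     rZ <<~ #1 ;; rZ `+ #1 <<~ rStr ;; rZ `+ #2 <<~ rBeg ;; rZ `+ #3 <<~ rEnd ;;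
     rY `+ #2 <<~ rEnd ;; rU `+ #5 `+ rC <<~ rZ ;; rZ `+ #5 `+ rC2 <<~ rY ;;
     If (TEq rPend #0) Skip (rPend `+ #4 <<~ rZ) ;;
     rPend <~ rZ) (State f' m) /\ [/\ forall r, r \notin split_regs -> f' r = f r,
     [/\ f' rFree = fr + rs, f' rZ = fr, f' rC = code c0 & f' rC2 = code d],
     f' rPend = f rPend & [/\ f' rStr = m (nm y + 1), f' rBeg = m (nm y + 2)
     & f' rEnd = m (nm y + 2) + (size cur - size x)]].
  eexists; split.
    rewrite /s' /split; move: (clear #|Sigma| ;; _) => Q; rewrite run_if; ev; case: eqP => [e|_].
      by move: e; rewrite edu; clear -lt szc; lia.
    rewrite run_seq run_asg; ev; rewrite run_seq run_asg; ev.
    rewrite run_seq run_get_b //; ev; last by rewrite edu.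
    rewrite run_seq (run_get_s _ (S := S)); [ev|by []|by []|by ev; rewrite eY|by ev; rewrite eY edu eo].
    do 3 (rewrite run_seq run_asg; ev).
    rewrite eY edu eo eqS ed' -/fr -/c0 -/d.
    by [].
  split; ev=> //.
  move=> r; rewrite /split_regs !inE !negb_or => /and5P [n1 n2 n3 n4 /and4P [n5 n6 n7 n8]].
  by rewrite !updE !ifN.
have [f' [{}es1 [r1 [g1 g2 g3 g4] g5 [g6 g7 g8]]]] := es1.
have r12 : f' 12 = nm y by rewrite r1.
have r10 : f' 10 = nm x by rewrite r1.
pose nmz := rename nm cur fr.
have nmc : nmz cur = fr by apply: rename_same.
have nmv v : nd N W v -> nmz v = nm v.
  by move=> h; apply: rename_other; apply/eqP => e; case/negP: new; move: h; rewrite e.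
have nx : nd N W x by rewrite /nd Nx.
have rs5 k : k < 5 -> k < rs by move=> h; apply: leq_trans h (leq_addr _ _).
have dis v v' : nd N' W v -> nd N' W v' -> v <> v' -> nmz v + rs <= nmz v' \/ nmz v' + rs <= nmz v.
  rewrite !ndE => /orP [/eqP ->|nz] /orP [/eqP ->|nz'] //.
  - by move=> _; rewrite nmc nmv //; right; case: (r_pos R nz').
  - by move=> _; rewrite nmc nmv //; left; case: (r_pos R nz).
  - by rewrite !nmv //; apply: (r_dis R).
have H v v' k k' : nd N' W v -> nd N' W v' -> k < rs -> k' < rs ->
    (nmz v + k == nmz v' + k') = (v == v') && (k == k').
  by move=> h1 h2; apply: addr_eq; apply: dis.
have nc' : nd N' W cur by rewrite ndE eqxx.
have ny' : nd N' W y by rewrite ndE ny orbT.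
have nx' : nd N' W x by rewrite ndE nx orbT.
have [m1 [em1 z1 z2]] := run_clear #|Sigma| f' m.
have cx : (x == cur) = false by apply/eqP => e; move: lt; rewrite e ltnn.
have cy : (y == cur) = false by apply/eqP => e; move: lcy; rewrite e ltnn.
have xy : (x == y) = false by apply/eqP => e; move: lxy; rewrite e ltnn.
have : exists m', s' = State (upd f' rPend fr) m' /\ (forall a, m' a =
  let w4 := fun b => if pd is Some v then if a == nmz v + 4 then nmz cur else b else b in
  w4 (if a == nmz cur + (5 + code d) then nmz y else
   if a == nmz x + (5 + code c0) then nmz cur else
   if a == nmz y + 2 then m (nm y + 2) + (size cur - size x) else
   if a == nmz cur + 3 then m (nm y + 2) + (size cur - size x) else
   if a == nmz cur + 2 then m (nm y + 2) else
   if a == nmz cur + 1 then m (nm y + 1) else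
   if a == nmz cur + 0 then 1 else m1 a)).
  rewrite es1 run_seq em1.
  do 7 (rewrite run_seq run_mw; cbn [eval reg mem]).
  rewrite run_seq run_if; cbn [teval eval reg mem].
  rewrite g5 g2 g3 g4 g6 g7 g8 r12 r10 nmc !nmv //.
  case: PD => [[-> ->]|[b [-> Nb e15 _]]].
    rewrite eqxx run_skip run_asg; cbn [eval reg mem]; rewrite g2; eexists; split; first by [].
    by move=> a; rewrite !updE !addnA addn0.
  have nb : nd N W (b :: cur) by rewrite /nd Nb.
  rewrite e15; have [/gtn_eqF -> _] := r_pos R nb.
  rewrite run_mw run_asg; cbn [eval reg mem]; rewrite g2 g5 e15.
  eexists; split; first by [].
  by move=> a; rewrite !updE !addnA addn0 (nmv _ nb).
move=> [m' [{}es1 Mm]].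
have M v k : nd N' W v -> k < rs -> m' (nmz v + k) =
  if (Some v == pd) && (k == 4) then fr else
  if (v == cur) && (k == 5 + code d) then nm y else
  if (v == x) && (k == 5 + code c0) then fr else
  if (v == y) && (k == 2) then m (nm y + 2) + (size cur - size x) else
  if v == cur then
    if k == 3 then m (nm y + 2) + (size cur - size x) else
    if k == 2 then m (nm y + 2) else
    if k == 1 then m (nm y + 1) else
    if k == 0 then 1 else m1 (nmz v + k)
  else m1 (nmz v + k).
  move=> nv lk; rewrite Mm /= !H //; try exact: code_lt.
  case: PD => [[-> _]|[b [-> Nb _ _]]].
    by rewrite nmc (nmv _ ny) /=; case: (v == cur).
  rewrite H //; last by rewrite ndE /nd Nb orbT.
  by rewrite (inj_eq Some_inj) nmc (nmv _ ny); case: ifP => // _; case: (v == cur).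
have m1v v k : nd N W v -> k < rs -> m1 (nm v + k) = m (nm v + k).
  move=> nv lk; apply: z2 => k' lk'; rewrite g2.
  have [_ le] := r_pos R nv; clear -le lk; rewrite -/fr in le *; lia.
have Mv v k : nd N W v -> k < rs -> m' (nm v + k) =
     if (v == y) && (k == 2) then m (nm y + 2) + (size cur - size x)
     else if (v == x) && (k == 5 + code c0) then fr
     else if (Some v == pd) && (k == 4) then fr
     else m (nm v + k).
  move=> nv lk; rewrite -{1}nmv // M // ?ndE ?nv ?orbT //.
  have vc : (v == cur) = false by apply/eqP => e; case/negP: new; move: nv; rewrite e.
  rewrite vc nmv // m1v //=.
  case E1: ((Some v == pd) && (k == 4)); last by case: (v == x) / eqP => [->|]; rewrite ?xy.
  case/andP: E1 => _ /eqP ->; rewrite !andbF.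
  by rewrite ?andbF.
have ec0 : nth hash y (size x) = c0.
  rewrite (nth_prefix hash pc lt) /cur nth_sub //; clear -lt szc; lia.
have hpd b w : pd = Some (b :: w) -> w = cur.
  by case: PD => [[-> _]|[b' [-> _ _ _]]] // [_ ->].
have Mc k : k < rs -> m' (fr + k) = if k == 5 + code d then nm y else
    if k == 3 then m (nm y + 2) + (size cur - size x) else
    if k == 2 then m (nm y + 2) else
    if k == 1 then m (nm y + 1) else
    if k == 0 then 1 else m1 (fr + k).
  move=> lk; rewrite -{1}nmc M // eqxx ![_ == x]eq_sym ![_ == y]eq_sym cx cy /= nmc.
  case: PD => [[-> _]|[b [-> _ _ _]]] //.
  rewrite (inj_eq Some_inj).
  have -> // : (cur == b :: cur) = false by apply/eqP => /(congr1 size) /=; clear; lia.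
have R' : rep N' W nmz m' (fr + rs) (Some cur).
  apply: (rep_split hW gN R ed pc lt lcy hpd).
  - by have := Mc 0 (rs5 0 isT); rewrite addn0.
  - exact: (Mc 1 (rs5 1 isT)).
  - exact: (Mc 2 (rs5 2 isT)).
  - exact: (Mc 3 (rs5 3 isT)).
  - move=> c; rewrite -/fr -addnA Mc ?code_lt // eqn_add2l (inj_eq code_inj) -/d.
    case: eqP => // _; rewrite -g2 z1 //; last exact: ltn_ord.
  - by move=> v k nv lk; rewrite ec0; apply: Mv.
have st' : strs m'.
  apply: (strs_keep st R) => a la ha.
  have nz k : (a == fr + k) = false by apply/eqP; clear -la; rewrite -/fr in la; lia.
  have nn v k : nd N W v -> k < rs -> (a == nmz v + k) = false.
    by move=> nv lk; apply/eqP; rewrite nmv //; apply: ha.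
  rewrite Mm /= nmc !nz !nn ?code_lt ?rs5 //.
  have -> : m1 a = m a by apply: z2 => k lk; rewrite g2; clear -la; rewrite -/fr in la; lia.
  by case: PD => [[-> _]|[b [-> Nb _ _]]] //; rewrite nn ?rs5 // /nd Nb.
exists N', nmz, (Some cur); rewrite es1; split=> //.
- split=> //.
  + by move: cs; rewrite /consts /= !updE /= !r1.
  + by rewrite /= updE /= g1.
  + by split=> //; apply: (split_good gN ed pc lt lcy).
  + by rewrite nmv // /nd (goodN0 gN).
- split=> [r hr|]; last by rewrite /= updE /= nmc g2.
  rewrite /= updE; case: eqP => [e|_]; last exact: r1.
  by move: hr; rewrite e !inE.
by right; rewrite /= updE /= nmc.
Qed.

Lemma run_add_leaf N W nm pd f m :
  let cur := sub (f rJ) (f rE) in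
  let w := drop (f rJ) B in
  let s' := run (add_leaf #|Sigma|) (State f m) in
  inv N W nm pd (State f m) -> N cur -> pre W cur -> f rJ <= f rE -> f rE < size B ->
  ~~ pre W (rcons cur (nth hash B (f rE))) -> f rZ = nm cur ->
  exists nm', [/\ inv N (w :: W) nm' pd s', forall v, nd N W v -> nm' v = nm v
    & forall r, r \notin [:: rFree; rC] -> reg s' r = f r].
Proof.
move=> cur w s' [cs st R [hW gN] eroot] Nc pc lje ltB npre eZ; cbn [reg mem] in cs, st, R.
set c := nth hash B (f rE) in npre; pose fr := f rFree.
have szc : size cur = f 9 - f 8 by apply: size_sub; apply: ltnW.
have scur : sub (f 8) (f 9).+1 = rcons cur c by rewrite sub_rcons.
have pcw : prefix (rcons cur c) w by rewrite -scur /w -sub_full sub_prefix.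
have cW : cur \notin W by case: (gN.2 _ Nc).
have hw : exists2 w', w = rcons w' hash & hash \notin w'.
  have [B' eB nh] := hB; exists (drop (f 8) B').
    rewrite /w eB drop_rcons //; move: ltB; rewrite eB size_rcons ltnS; exact: leq_trans.
  by apply: contra nh; apply: mem_drop.
have ndc : nd N W cur by rewrite /nd Nc.
have rs5 k : k < 5 -> k < rs by move=> h; apply: leq_trans h (leq_addr _ _).
have [p1 p2] := r_pos R ndc.
have [m' [es' Mm]] : exists m', s' = State (upd (upd f 13 (code c)) rFree (fr + rs)) m' /\
   forall a, m' a = if a == fr + 2 then f 9 else if a == fr + 1 then 1 else if a == fr then 0
     else if a == nm cur + (5 + code c) then fr else m a.
  eexists; split.
    rewrite /s' /add_leaf run_seq run_get_b; [ev|by []|by []|by []].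
    do 4 (rewrite run_seq run_mw; ev).
    by rewrite run_asg eZ; ev; rewrite -/fr.
  by move=> a; rewrite !updE -addnA.
have lf a : a < fr -> [/\ (a == fr + 2) = false, (a == fr + 1) = false & (a == fr) = false].
  by move=> la; split; apply/eqP; clear -la; lia.
have nf v k : nd N W v -> k < rs -> nm v + k < fr.
  by move=> nv lk; have [_ le] := r_pos R nv; clear -le lk; rewrite -/fr in le *; lia.
exists (rename nm w fr).
have new := leaf_new gN pcw npre.
have nmv v : nd N W v -> rename nm w fr v = nm v.
  by move=> h; apply: rename_other; apply/eqP => e; case/negP: new; move: h; rewrite e.
have gN' := leaf_good gN Nc pcw npre cW pc.
have f1 : (fr + 1 == fr + 2) = false by rewrite eqn_add2l.
have f2 : (fr == fr + 2) = false /\ (fr == fr + 1) = false.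
  by split; apply/eqP; clear; lia.
rewrite es'; split=> //=; last first.
  move=> r; rewrite !inE negb_or => /andP [/negbTE n1 /negbTE n2].
  by rewrite !updE n1 n2.
split=> /=.
- exact: cs.
- apply: (strs_keep st R) => a la ha; rewrite Mm.
  have [-> -> ->] := lf _ la; case: eqP => // e; case: (ha _ _ ndc (code_lt c) e).
- rewrite updE /=; apply: (rep_leaf (cur := cur) (c := c) (e := f 9) (j := f 8) hW gN R) => //.
  + by rewrite Mm !f2.1 f2.2 eqxx.
  + by rewrite Mm f1 eqxx.
  + by rewrite Mm eqxx.
  move=> v k nv lk; rewrite Mm; have [-> -> ->] := lf _ (nf _ _ nv lk).
  rewrite (@addr_eq nm) ?code_lt //; exact: (r_dis R).
- by split=> //; apply: leaf_hterm.
- rewrite nmv // /nd (goodN0 gN) //.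
Qed.

Lemma inv_ext N N' W nm pd s : (forall z, N z = N' z) -> inv N W nm pd s -> inv N' W nm pd s.
Proof.
move=> e [cs st R [hW [g1 g2]] er].
have ndE z : nd N' W z = nd N W z by rewrite /nd e.
have edE x y : edge N' W x y -> edge N W x y.
  case=> h1 h2 h3 h4 h5; split=> //; rewrite ?e -?ndE //.
  by move=> z; rewrite -ndE; apply: h5.
split=> //; last by split=> //; split=> z; rewrite -e; [apply: g1 | apply: g2].
case: R => R1 R2 R3 R4 R5 R6 R7 R8 R9 R10 R11 R12 R13; split=> //.
- by move=> x; rewrite -e; apply: R2.
- by move=> x y /edE; apply: R3.
- by move=> x c; rewrite -e; apply: R4.
- by move=> x y /edE; apply: R5.
- by move=> x y /edE h; rewrite -e; apply: R6.
- by move=> c w; rewrite -!e; apply: R7.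
- by move=> z; rewrite ndE; apply: R8.
- by move=> z z'; rewrite !ndE; apply: R9.
- by move=> z i; rewrite ndE; apply: R10.
- by move=> z i; rewrite ndE; apply: R11.
Qed.

Lemma rep_link N W nm m fr b w : rep N W nm m fr (Some (b :: w)) -> N (b :: w) -> N w ->
  rep N W nm (upd m (nm (b :: w) + 4) (nm w)) fr None.
Proof.
case=> R1 R2 R3 R4 R5 R6 R7 R8 R9 R10 R11 R12 R13 Nbw Nw.
have nb : nd N W (b :: w) by rewrite /nd Nbw.
have ndN v : N v -> nd N W v by rewrite /nd => ->.
have ndW v : v \in W -> nd N W v by rewrite /nd orbC => ->.
have M v k : nd N W v -> k < rs -> k != 4 -> upd m (nm (b :: w) + 4) (nm w) (nm v + k) = m (nm v + k).
  move=> nv lk nk; rewrite updE (@addr_eq nm) //; last exact: R9.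
  by rewrite (negbTE nk) andbF.
have M0 v : nd N W v -> upd m (nm (b :: w) + 4) (nm w) (nm v) = m (nm v).
  by move=> nv; rewrite -[nm v]addn0 M // addn0.
have M5 v (c : Sigma) : nd N W v -> upd m (nm (b :: w) + 4) (nm w) (nm v + 5 + code c) = m (nm v + 5 + code c).
  move=> nv; rewrite -addnA M //; apply: code_lt.
split=> //.
- by move=> v vW; rewrite M0 ?R1 ?ndW.
- by move=> v Nv; rewrite M0 ?R2 ?ndN.
- by move=> x y h; have [Nx _ _ _ _] := h; rewrite M5 ?ndN ?R3.
- by move=> x c Nx h; rewrite M5 ?ndN ?R4.
- by move=> x y h yW; rewrite !M ?ndW //; apply: R5.
- by move=> x y h Ny; rewrite !M ?ndN //; apply: R6.
move=> c v Ncv _; rewrite updE (@addr_eq nm) ?andbT //; last by apply: R9; rewrite // ndN.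
case: eqP => [[_ ->]|ne] //; apply: R7 => // -[e1 e2]; case: ne; by rewrite e1 e2.
Qed.

Lemma run_fix N W nm pd f m x :
  inv N W nm pd (State f m) -> locus N W nm f x ->
  pending N nm pd f x (sub (f rJ) (f rE)) \/
    (exists b, [/\ pd = Some (b :: sub (f rJ) (f rE)), N (b :: sub (f rJ) (f rE)) &
       f rPend = nm (b :: sub (f rJ) (f rE))]) ->
  let s' := run fix_link (State f m) in
  exists pd', [/\ inv N W nm pd' s', forall r, r != rPend -> reg s' r = f r
    & pending N nm pd' (reg s') x (sub (f rJ) (f rE))].
Proof.
move=> Is lx PD s'; have [cs st R [hW gN] eroot] := Is; cbn [reg mem] in cs, st, R.
have [[Nx /andP [bnd bE] subx [eu edu] preW] alt] := lx.
set cur := sub _ _ in PD *.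
have szc : size cur = f 9 - f 8 by apply: size_sub.
case: (PD) => [[[epd e15]|[b [epd Nb e15 lt]]]|[b [epd Nb e15]]].
- exists None; rewrite /s' /fix_link run_if; ev; rewrite e15 eqxx run_skip -epd; split=> //.
  by left.
- have nb : nd N W (b :: cur) by rewrite /nd Nb.
  have [/gtn_eqF p0 _] := r_pos R nb.
  exists pd; rewrite /s' /fix_link run_if; ev; rewrite e15 p0 run_if; ev.
  case: eqP => [e|_]; first by exfalso; move: lt; rewrite szc; clear -e edu; lia.
  by rewrite run_skip; split=> //; right; exists b.
have nb : nd N W (b :: cur) by rewrite /nd Nb.
have [/gtn_eqF p0 _] := r_pos R nb.
rewrite /s' /fix_link run_if; ev; rewrite e15 p0 run_if; ev.
case: eqP => [e|ne]; last first.
  exists pd; rewrite run_skip; split=> //; right; exists b; split=> //.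
  by rewrite szc; clear -ne edu bnd; lia.
have ex : cur = x by rewrite /cur -[RHS]subx -e edu.
have Ncur : N cur by rewrite ex.
exists None; rewrite run_seq run_mw run_asg; ev; rewrite e15 eu; split; last by left.
  split=> //=; last by rewrite updE /= -ex; apply: rep_link; rewrite // -epd.
    apply: (strs_keep st R) => a la ha; rewrite updE; case: eqP => // e2.
    by case: (ha _ 4 nb _ e2); apply: leq_addr.
by move=> r /negbTE h; rewrite /= updE h.
Qed.

(** * Suffix links and insertion *)

Definition closed W : Prop := forall v, v \in W -> behead v = [::] \/ behead v \in W.
(** During insertion one nonempty tail may be missing, that of the suffix inserted last, which is
    the suffix to be inserted next. *)
Definition closed_at W (j : nat) : Prop :=
  forall v, v \in W -> [\/ behead v = drop j B, behead v = [::] | behead v \in W].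

Lemma hterm_suffix j : j < size B -> exists2 w', drop j B = rcons w' hash & hash \notin w'.
Proof.
have [B' eB nh] := hB => lt; exists (drop j B').
  by move: lt; rewrite eB size_rcons ltnS => lt; rewrite drop_rcons.
by apply: contra nh; apply: mem_drop.
Qed.

Lemma full_word W w : hterm hash W -> (exists2 w', w = rcons w' hash & hash \notin w') ->
  pre W w -> w \in W.
Proof.
move=> hW [w' ew nh] /preP [v vW pv]; have [v' ev nv] := hW _ vW.
case: (ltngtP (size w) (size v)) => [lt|lt|e].
- case/negP: nv; have : prefix w v'.
    apply: (prefix_comparable pv); first by rewrite ev prefix_rcons.
    by move: lt; rewrite ev size_rcons.
  by rewrite ew => /prefixP [t ->]; rewrite mem_cat mem_rcons inE eqxx.
- by move: (size_pfx pv); rewrite leqNgt lt.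
- by rewrite (prefix_size_eq pv) // e.
Qed.

Lemma br_nohash W z : hterm hash W -> br W z -> hash \notin z.
Proof.
move=> hW /brP [->|[c [_ [_ /preP [v vW pv] _]]]]; first by [].
have [v' ev nv] := hW _ vW; apply: contra nv => hz.
have : prefix z v'.
  apply: (prefix_comparable (prefix_rconsl pv)); first by rewrite ev prefix_rcons.
  by move: (size_pfx pv); rewrite ev !size_rcons.
by move=> /prefixP [t ->]; rewrite mem_cat hz.
Qed.

Lemma sub_next j e e' : j <= e -> e < e' -> e' <= size B ->
  prefix (rcons (sub j e) (nth hash B e)) (sub j e').
Proof.
move=> le lt le'; rewrite -sub_rcons //; first exact: sub_prefix.
exact: leq_trans le'.
Qed.

(* The link of [b :: cur] leads to a node as soon as B continues [cur] within the trie. *)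
Lemma pending_next W j e b : hterm hash W -> closed_at W j -> br W (b :: sub j e) ->
  j <= e -> e <= size B -> j < size B ->
  e < size B /\ exists2 c, c != nth hash B e & pre W (rcons (sub j e) c).
Proof.
move=> hW cl bz lje leB ltj.
have ltB : e < size B.
  rewrite ltn_neqAle leB andbT; apply/eqP => e1.
  have [w' ew _] := hterm_suffix ltj; have := br_nohash hW bz.
  by rewrite e1 sub_full ew inE mem_rcons inE eqxx orbT.
split=> //.
(* The tail of a word with this prefix is not the missing suffix, which continues with the next
   character of [B]. Of the two continuations of a branching word at least one is of this kind. *)
have key c : pre W (rcons (b :: sub j e) c) -> c != nth hash B e -> pre W (rcons (sub j e) c).
  move=> /preP [v vW pv] ne.
  have pb : prefix (rcons (sub j e) c) (behead v).
    by case: v pv {vW} => // d v /=; case: (b == d).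
  case: (cl _ vW) => [ev|ev|bW]; last by apply/preP; exists (behead v).
    case/eqP: ne; rewrite ev in pb; apply: (prefix_rcons_inj pb).
    by rewrite -sub_rcons // -sub_full sub_prefix.
  by move: (size_pfx pb); rewrite ev size_rcons.
case/brP: bz => // -[c1 [c2 [ne h1 h2]]].
case: (eqVneq c1 (nth hash B e)) => [e1|n1].
  by exists c2; [rewrite -e1 eq_sym | apply: key; rewrite // -e1 eq_sym].
by exists c1; [|apply: key].
Qed.

Definition shift_regs := [:: rU; rDU; rJ; rE].

Lemma run_shift N W nm pd f m x :
  let s' := run shift (State f m) in
  inv N W nm pd (State f m) -> N x -> Some x <> pd ->
  sub (f rJ) (f rJ + size x) = x -> f rJ + size x <= f rE <= size B -> f rJ < size B ->
  f rU = nm x -> f rDU = size x -> pre W (sub (f rJ).+1 (maxn (f rE) (f rJ).+1)) ->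
  [/\ same_but shift_regs (State f m) s', reg s' rJ = (f rJ).+1,
      reg s' rE = maxn (f rE) (f rJ).+1 & at_node N W nm (reg s') (behead x)].
Proof.
move=> s' [cs st R [hW gN] eroot] Nx xpd subx /andP [bnd bE] ltj eu edu preW.
cbn [reg mem] in *.
have [f1 [es1 [h1 h2 h3]]] : exists f1, run (If (TEq rDU #0) Skip (rU <~ !(rU `+ #4) ;; rDU <~ rDU `- #1)) (State f m) = State f1 m /\
   [/\ f1 10 = nm (behead x), f1 11 = size (behead x) & forall r, r \notin [:: 10; 11] -> f1 r = f r].
  rewrite run_if; ev; rewrite edu; case: eqP => [e|ne].
    exists f; rewrite run_skip; split=> //; rewrite eu edu.
    by have -> : x = [::] by apply: size0nil.
  exists (upd (upd f 10 (nm (behead x))) 11 (size (behead x))); split.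
    rewrite run_seq !run_asg; ev; rewrite eu edu size_behead subn1.
    case: x Nx xpd ne {subx bnd eu edu} => // c w Nx xpd _ /=.
    by rewrite (r_link R Nx _).2 // => e; case: xpd.
  split=> // r; rewrite !inE !negb_or => /andP [/negbTE n1 /negbTE n2].
  by rewrite !updE n1 n2.
have [f2 [es' [k1 k2 k3]]] : exists f2, s' = State f2 m /\
   [/\ f2 8 = (f 8).+1, f2 9 = maxn (f 9) (f 8).+1 & forall r, r \notin [:: 8; 9] -> f2 r = f1 r].
  exists (if (f 8).+1 <= f 9 then upd f1 8 (f 8).+1 else upd (upd f1 8 (f 8).+1) 9 (f 8).+1).
  split.
    rewrite /s' /shift run_seq es1 run_seq run_asg; ev; rewrite run_if; ev; rewrite !h3 // addn1.
    by case: ifP => _; rewrite ?run_skip // run_asg; ev; rewrite updE /=.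
  split; rewrite ?h3 //.
  - by case: ifP.
  - case: ifP => le; rewrite !updE /= ?h3 //; first by rewrite (maxn_idPl le).
    by rewrite (maxn_idPr _) //; clear -le; lia.
  - move=> r; rewrite !inE !negb_or => /andP [/negbTE n1 /negbTE n2].
    by case: ifP => _; rewrite !updE ?n1 ?n2.
rewrite es' /=; split=> //.
  split=> // r; rewrite !inE !negb_or /= => /and4P [n1 n2 n3 n4].
  by rewrite k3 ?h3 // !inE negb_or ?n1 ?n3.
rewrite /at_node k1 k2 !k3 // h1 h2.
have sb : size (behead x) = (size x).-1 by rewrite size_behead.
split=> //.
- case: x Nx xpd {subx bnd eu edu h1 h2 sb es1 h3} => // c w Nx xpd.
  exact: (r_link R Nx xpd).1.
- rewrite sb; apply/andP; split; last by rewrite geq_max bE ltj.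
  by clear -bnd; lia.
- rewrite sb -[in RHS]subx behead_sub.
  case: (x) => [|c w]; first by rewrite /= !addn0 sub0 /sub subnS subnn take0.
  by rewrite /= addSnnS.
Qed.

Lemma loopfree_clear n : loopfree (clear n).
Proof. by elim: n => //= n ->. Qed.

Definition grow (sz : nat) : cmd := If (TEq rE len_b) Skip (split sz ;; add_leaf sz).

Definition insert_unit := scan_unit + rescan_unit + cmax (grow #|Sigma|) + cmax shift +
  cmax fix_link + tcost (TNot (TLe rLim rJ)).

Lemma locus_max N W nm f x : goodN N W -> locus N W nm f x -> br W (sub (f rJ) (f rE)) ->
  size x = f rE - f rJ.
Proof.
move=> gN [[_ /andP [_ le] _ _ _] [//|[y [ed pc lt _ yN]]]] bc.
have sz : size (sub (f rJ) (f rE)) = f rE - f rJ by apply: size_sub.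
have [_ ny _ _ bt] := ed.
have Nc := gN.1 _ bc.
have e : sub (f rJ) (f rE) = y by apply: bt; rewrite ?sz // /nd Nc.
by move: (yN); rewrite -e sz ltnn => /(_ Nc).
Qed.

Lemma locus_full N W nm f x : locus N W nm f x -> size x = f rE - f rJ -> x = sub (f rJ) (f rE).
Proof.
move=> [[_ /andP [le _] sx _ _] _] e; rewrite -sx; congr sub.
by move: le; rewrite e; clear; lia.
Qed.

Lemma br_sub W W2 z : {subset W <= W2} -> br W z -> br W2 z.
Proof.
move=> h /brP [->|[c1 [c2 [ne /preP [v1 h1 p1] /preP [v2 h2 p2]]]]]; apply/brP; first by left.
by right; exists c1, c2; split=> //; apply/preP; [exists v1 | exists v2]; rewrite ?h.
Qed.

Lemma mulnD6l a b c d e g k : (a + b + c + d + e + g) * k = a * k + b * k + c * k + d * k + e * k + g * k.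
Proof. by rewrite !mulnDl. Qed.

(** The node [x] loses at most one character of depth along its suffix link and none while scanning
    or rescanning. Rescanning is paid for by the change in depth, offset by a constant that covers
    this loss. *)
Lemma insert_step W nm pd s x :
  inv (br W) W nm pd s -> locus (br W) W nm (reg s) x -> reg s rJ < size B ->
  pending (br W) nm pd (reg s) x (sub (reg s rJ) (reg s rE)) -> closed_at W (reg s rJ) ->
  runs (insert_body #|Sigma|) s (fun T s' => exists W' nm' pd' x' e,
    [/\ [/\ inv (br W') W' nm' pd' s', locus (br W') W' nm' (reg s') x',
        pending (br W') nm' pd' (reg s') x' (sub (reg s' rJ) (reg s' rE)) &
        closed_at W' (reg s' rJ)],
      forall v, v \in W' = (v == drop (reg s rJ) B) || (v \in W),
      [/\ reg s' rJ = (reg s rJ).+1, reg s' rLim = reg s rLim & reg s' rOld = reg s rOld],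
      [/\ pre W (sub (reg s rJ) e), reg s rE <= e <= size B, reg s' rE = maxn e (reg s rJ).+1
        & size x <= size x' + 2]
    & T + tcost (TNot (TLe rLim rJ)) <=
      insert_unit * ((reg s' rE - reg s rE) + (size x' + 2 - size x) + 1)]).
Proof.
move=> Is lx ltj PD cl; apply: runs_seq.
apply: runs_impl (run_scan Is lx) _ => T1 s1 [sb1 [x1 [lx1 le1 lee1 stop lT1]]].
have ej : reg s1 8 = reg s 8 by case: sb1 => _ ->.
set j := reg s 8 in ltj PD cl ej *.
have Is1 := inv_same (l := scan_regs) isT sb1 Is.
have [cs st R [hW gN] eroot] := Is.
have [[Nx1 /andP [bnd1 bE1] subx1 [eu1 edu1] preW1] alt1] := lx1.
have [[Nx /andP [bnd bE] subx [eu edu] preW] alt] := lx.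
set cur := sub (reg s1 8) (reg s1 9).
have ecur : cur = sub j (reg s1 9) by rewrite /cur ej.
have lej : j <= reg s1 9 by rewrite -ej; clear -bnd1; lia.
(* While a link is pending, scanning stops at once: the trie continues the located string by a
   character other than that of [B], so an advance would make the string branching, hence a node.
   The coming split therefore creates exactly the awaited target. *)
have PD1 : pending (br W) nm pd (reg s1) x1 cur /\ (reg s1 9 = size B -> pd = None).
  have e15 : reg s1 15 = reg s 15 by case: sb1 => _ ->.
  case: PD => [[epd e0]|[b [epd Nb eb lt]]]; first by split=> //; left; rewrite e15.
  have lej0 : j <= reg s 9 by clear -bnd; rewrite -/j in bnd; lia.
  have [ltB [c nc pc]] := pending_next hW cl Nb lej0 bE ltj.
  have nbr : ~~ br W (sub j (reg s 9)).
    apply/negP => bc; have := locus_max (goodN_br hW) lx bc.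
    move: lt; rewrite size_sub // => lt e; rewrite e ltnn in lt; by [].
  have ee : reg s1 9 = reg s 9.
    apply/eqP; rewrite eqn_leq lee1 andbT leqNgt; apply/negP => lt2.
    case/negP: nbr; apply/brP; right; exists c, (nth hash B (reg s 9)); split=> //.
    apply: pre_prefix preW1; rewrite ej; exact: sub_next.
  have ec2 : cur = sub j (reg s 9) by rewrite ecur ee.
  split; last by move=> e; move: ltB; rewrite -ee e ltnn.
  right; exists b; rewrite ec2 e15; split=> //.
  rewrite size_sub // ltn_neqAle; apply/andP; split; last first.
    by move: bnd1; rewrite ej ee; clear; lia.
  apply/eqP => e; case/negP: nbr; rewrite -ec2.
  by rewrite /cur -(locus_full lx1) // ej ee.
have {PD1} [PD1 pdB] := PD1.
set w := drop j B.
have hw : exists2 w', w = rcons w' hash & hash \notin w' by apply: hterm_suffix.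
have ltBj : j < size B by [].
apply: runs_seq; apply: runs_run; first by rewrite /= loopfree_clear.
move=> T2 lT2; set s2 := run _ s1.
have [W2 [nm2 [pd2 [Is2 W2E r2 eu2 PD2]]]] : exists W2 nm2 pd2,
  [/\ inv (br W2) W2 nm2 pd2 s2, forall v, v \in W2 = (v == w) || (v \in W),
    forall r, r \notin rFree :: split_regs -> reg s2 r = reg s1 r,
    nm x1 = nm2 x1 &
    (pd2 = None /\ reg s2 rPend = 0) \/
    [/\ pd2 = Some cur, reg s2 rPend = nm2 cur, br W2 cur & size x1 < size cur]].
  have es1 : s1 = State (reg s1) (mem s1) by case: (s1).
  have eB : eval s1 len_b = size B.
    by case: Is1 => -[_ h1 h2 h3 h4] _ _ _ _; rewrite /len_b /= h1 h3 h4 !size_cat addnA.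
  rewrite /s2 run_if; cbn [teval]; rewrite eB; cbn [eval]; case: eqP => [e|ne].
    have epd := pdB e; exists W, nm, pd; rewrite run_skip; split=> //.
    - have wW : w \in W.
        by apply: full_word => //; rewrite /w -sub_full -e -ej.
      by move=> v; case: eqP => // ->.
    - left; split=> //; case: PD1 => [[] //|[b [epd2]]]; by rewrite epd2 in epd.
  have ltB : reg s1 9 < size B by clear -bE1 ne; lia.
  case: stop => [//|npre]; rewrite run_seq es1.
  have Is1' : inv (br W) W nm pd (State (reg s1) (mem s1)) by rewrite -es1.
  have [N' [nm' [pd' [Is' N'E nm'E [r' eZ'] PD']]]] := run_split Is1' lx1 ltB PD1.
  set sm := run _ _ in Is' r' eZ' PD' *.
  have esm : sm = State (reg sm) (mem sm) by case: (sm).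
  have rm8 : reg sm 8 = reg s1 8 by apply: r'.
  have rm9 : reg sm 9 = reg s1 9 by apply: r'.
  rewrite esm in Is' *.
  have := run_add_leaf Is'; rewrite rm8 rm9 -/cur N'E eqxx.
  have lej1 : reg s1 8 <= reg s1 9 by rewrite ej.
  move=> /(_ isT preW1 lej1 ltB npre eZ') [nm'' [Is'' nm''E r'']].
  have ew : drop (reg s1 8) B = w by rewrite ej.
  rewrite ew in Is''.
  set s3 := run _ _ in Is'' r'' *.
  have pcw : prefix (rcons cur (nth hash B (reg s1 9))) w.
    by rewrite /cur -sub_rcons // -ew -sub_full sub_prefix.
  have cW : cur \notin W.
    by apply/negP => h; apply: (sub_not_word hW h (prefix_refl _) ltB).
  have brE z : N' z = br (w :: W) z by rewrite N'E (br_insert preW1 pcw npre cW).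
  have ndx : nd (br W) W x1 by rewrite /nd Nx1.
  exists (w :: W), nm'', pd'; split=> //.
  - exact: inv_ext brE Is''.
  - move=> r; rewrite inE negb_or => /andP [n1 n2].
    rewrite r''; first exact: r'.
    rewrite !inE negb_or n1 /=; apply: contra n2 => /eqP ->; by rewrite !inE.
  - by rewrite nm''E ?nm'E // /nd N'E Nx1 orbT.
  have e15 : reg s3 15 = reg sm 15 by apply: r''.
  case: PD' => [[[epd e0] _]|[epd e0 lt]]; [left|right]; rewrite e15 e0; split=> //.
    by rewrite nm''E // /nd N'E eqxx.
  by rewrite -brE N'E eqxx.
have [cs2 st2 R2 [hW2 gN2] eroot2] := Is2.
have r28 : reg s2 8 = j by rewrite r2.
have r29 : reg s2 9 = reg s1 9 by rewrite r2.
have Nx2 : br W2 x1 by apply: br_sub Nx1 => v vW; rewrite W2E vW orbT.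
have npd : Some x1 <> pd2.
  by case: PD2 => [[-> _] //|[-> _ _ lt]] [e]; move: lt; rewrite e ltnn.
have subE : sub j.+1 (maxn (reg s1 9) j.+1) = behead cur.
  rewrite ecur behead_sub; case: (leqP j.+1 (reg s1 9)) => le; first by [].
  have -> : reg s1 9 = j by clear -lej le; lia.
  by rewrite sub0 /sub subnS subnn take0.
have wW2 : w \in W2 by rewrite W2E eqxx.
(* The matched part without its first character begins the tail of some word. This tail is empty, an
   old word, or the suffix present since this very step. *)
have pre2 : pre W2 (behead cur).
  have /preP [v vW pv] := preW1.
  have pb : prefix (behead cur) (behead v).
    move: pv; rewrite -/cur; case: (cur) => [|b c]; first by move=> _; exact: prefix0s.
    by case: (v) => // d v' /=; case: (b == d).
  case: (cl _ vW) => [ev|ev|bW]; apply/preP.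
  - by exists w; rewrite // /w -ev.
  - by exists w => //; move: pb; rewrite ev; case: (behead cur) => // _; apply: prefix0s.
  - by exists (behead v); rewrite // W2E bW orbT.
apply: runs_seq; apply: runs_run => // T3 lT3; set s3 := run shift s2.
have es2 : s2 = State (reg s2) (mem s2) by case: (s2).
have Is2' : inv (br W2) W2 nm2 pd2 (State (reg s2) (mem s2)) by rewrite -es2.
have sub1 : sub (reg s2 8) (reg s2 8 + size x1) = x1 by rewrite r28 -ej.
have bn2 : reg s2 8 + size x1 <= reg s2 9 <= size B by rewrite r28 r29 -ej bnd1.
have lt2 : reg s2 8 < size B by rewrite r28.
have u2 : reg s2 10 = nm2 x1 by rewrite r2 // eu1.
have du2 : reg s2 11 = size x1 by rewrite r2.
have pr2 : pre W2 (sub (reg s2 8).+1 (maxn (reg s2 9) (reg s2 8).+1)) by rewrite r28 r29 subE.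
have [] := run_shift Is2' Nx2 npd sub1 bn2 lt2 u2 du2 pr2.
rewrite -es2 -/s3 r28 r29 => sb3 r38 r39 at3.
have Is3 := inv_same (l := shift_regs) isT sb3 Is2.
apply: runs_seq; apply: runs_impl (run_rescan Is3 at3) _ => T4 s4 [sb4 [x4 [lx4 le4 lT4]]].
have Is4 := inv_same (l := rescan_regs) isT sb4 Is3.
have r48 : reg s4 8 = j.+1 by case: sb4 => _ ->.
have r49 : reg s4 9 = maxn (reg s1 9) j.+1 by case: sb4 => _ ->.
apply: runs_run => // T5 lT5; set s5 := run fix_link s4.
have es4 : s4 = State (reg s4) (mem s4) by case: (s4).
have Is4' : inv (br W2) W2 nm2 pd2 (State (reg s4) (mem s4)) by rewrite -es4.
have e415 : reg s4 15 = reg s2 15 by case: sb4 => _ -> //; case: sb3 => _ ->.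
have PD4 : pending (br W2) nm2 pd2 (reg s4) x4 (sub (reg s4 8) (reg s4 9)) \/
    (exists b, [/\ pd2 = Some (b :: sub (reg s4 8) (reg s4 9)), br W2 (b :: sub (reg s4 8) (reg s4 9)) &
       reg s4 15 = nm2 (b :: sub (reg s4 8) (reg s4 9))]).
  rewrite r48 r49 subE e415; case: PD2 => [[epd e0]|[epd e0 bc lt]]; first by left; left; rewrite e415.
  right; case: (cur) epd e0 bc lt => // b c epd e0 bc _.
  by exists b.
have [pd5 [Is5 r5 PD5]] := run_fix Is4' lx4 PD4.
rewrite -es4 -/s5 in Is5 r5 PD5.
have r58 : reg s5 8 = j.+1 by rewrite r5.
have r59 : reg s5 9 = maxn (reg s1 9) j.+1 by rewrite r5.
exists W2, nm2, pd5, x4, (reg s1 9); split.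
- split=> //.
  + move: lx4; rewrite /locus /at_node /mid_edge r58 r59 r48 r49.
    by rewrite !r5.
  + by rewrite (r5 8) // (r5 9).
  + rewrite r58 => v; rewrite W2E => /orP [/eqP ->|vW].
      by constructor 1; rewrite /w -drop1 drop_drop add1n.
    case: (cl _ vW) => [->|->|h]; [constructor 3|constructor 2|constructor 3] => //.
    by rewrite W2E h orbT.
- exact: W2E.
- split=> //; rewrite r5 //; case: sb4 => _ -> //; case: sb3 => _ -> //; rewrite r2 //;
    by case: sb1 => _ ->.
- split=> //; first by rewrite -ecur.
    by rewrite lee1.
  by rewrite size_behead in le4; clear -le1 le4; lia.
rewrite r59.
have sb1' : size (behead x1) = (size x1).-1 by rewrite size_behead.
move: lT1 lT2 lT3 lT4 lT5; rewrite -/(grow #|Sigma|) sb1'.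
set c2 := cmax (grow _); set c3 := cmax shift; set c5 := cmax fix_link; set c6 := tcost _.
rewrite /insert_unit -/c2 -/c3 -/c5 -/c6.
have m1 := leq_maxl (reg s1 9) j.+1.
set e5 := maxn _ _ in m1 *.
move=> lT1 lT2 lT3 lT4 lT5.
set Z := (e5 - reg s 9 + (size x4 + 2 - size x) + 1).
have b1 : reg s1 9 - reg s 9 + 1 <= Z by rewrite /Z; clear -m1; lia.
have b2 : size x4 - (size x1).-1 + 1 <= Z by rewrite /Z; clear -le1 le4 sb1'; rewrite sb1' in le4; lia.
have b3 : 0 < Z by rewrite /Z addn1.
have h1 := leq_trans lT1 (leq_mul (leqnn scan_unit) b1).
have h2 := leq_trans lT4 (leq_mul (leqnn rescan_unit) b2).
have k2 := leq_pmulr c2 b3; have k3 := leq_pmulr c3 b3.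
have k5 := leq_pmulr c5 b3; have k6 := leq_pmulr c6 b3.
rewrite mulnD6l; clear -h1 h2 k2 k3 k5 k6 lT2 lT3 lT5; lia.
Qed.

Definition insert_cost := insert_unit + (cmax (rE <~ rJ) + cmax (rU <~ rRoot) + cmax (rDU <~ #0) +
  cmax (rPend <~ #0) + tcost (TNot (TLe rLim rJ))).

(** [E] bounds how far the right end of the matched part may come. As [drop lim B] is a word from
    the start, the chain of tails closes up at the end and no suffix link is left missing. *)
Lemma run_insert W0 nm s n lim E :
  inv (br W0) W0 nm None s -> closed W0 -> pre W0 [::] -> drop lim B \in W0 ->
  reg s rJ = n -> reg s rLim = lim -> n <= lim -> lim < size B -> lim <= E ->
  (forall j e v, n <= j < lim -> j <= e <= size B ->
     v \in W0 \/ (exists2 i, n <= i < j & v = drop i B) -> prefix (sub j e) v -> e <= E) ->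
  runs (insert #|Sigma|) s (fun T s' => exists W nm',
    [/\ inv (br W) W nm' None s', closed W,
        forall v, v \in W <-> v \in W0 \/ exists2 i, n <= i < lim & v = drop i B,
        reg s' rOld = reg s rOld
      & T <= insert_cost * ((E - n) + (E - n) + 4 * (lim - n) + 1)]).
Proof.
move=> Is cl pn limW en elim le_n ltl leE Hb.
have es : s = State (reg s) (mem s) by case: (s).
have [cs st R [hW gN] eroot] := Is.
apply: runs_seq; apply: runs_run => // T1 lT1; apply: runs_seq; apply: runs_run => // T2 lT2.
apply: runs_seq; apply: runs_run => // T3 lT3; apply: runs_seq; apply: runs_run => // T4 lT4.
set s1 := run (rPend <~ #0) _.
pose f1 := upd (upd (upd (upd (reg s) 9 n) 10 root) 11 0) 15 0.
have es1 : s1 = State f1 (mem s).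
  rewrite /s1 es !run_asg; ev; rewrite en.
  by case: cs => -[_ _ ->].
have sb1 : same_but [:: 9; 10; 11; 15] s s1.
  by rewrite es1 /f1; do 4!apply: same_upd => //; rewrite {2}es.
pose st' (W : seq word) j := forall v, v \in W <-> v \in W0 \/ exists2 i, n <= i < j & v = drop i B.
pose I s' := (exists W nm' pd x, [/\ inv (br W) W nm' pd s', locus (br W) W nm' (reg s') x,
   pending (br W) nm' pd (reg s') x (sub (reg s' rJ) (reg s' rE)) & closed_at W (reg s' rJ) /\ st' W (reg s' rJ)])
  /\ [/\ n <= reg s' rJ <= lim, reg s' rE <= E, reg s' rLim = lim & reg s' rOld = reg s rOld].
(* The summands pay for the advance of the matched end, for the depth gained by rescanning, and for
   each suffix together with the depth lost along its suffix link. *)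
pose Phi s' := insert_unit * ((E - reg s' rE) + ((E - n) - reg s' rDU) + 4 * (lim - reg s' rJ)).
have I1 : I s1.
  have j1 : reg s1 8 = n by rewrite es1.
  have e1 : reg s1 9 = n by rewrite es1.
  split; last first.
    rewrite j1 e1 leqnn le_n; split=> //.
    exact: leq_trans leE.
  exists W0, nm, None, [::]; rewrite j1 e1; split.
  - exact: (inv_same (l := [:: 9; 10; 11; 15]) isT sb1 Is).
  - rewrite /locus /at_node j1 e1 es1 subnn sub0; split; last by left.
    rewrite addn0 sub0 leqnn (ltnW (leq_ltn_trans le_n ltl)); split=> //.
  - by left; rewrite es1.
  split=> v; first by case/cl => h; [constructor 2 | constructor 3].
  split=> [|[//|[i h]]]; first by left.
  by move: h; case: leqP => // h /=; rewrite ltnNge h.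
apply: runs_impl (runs_while (I := I) (Phi := Phi) _ I1) _.
  move=> s2 [[W [nm2 [pd [x [Is2 lx2 PD2 [cl2 stW]]]]]] [/andP [nj jl] eE el eo]].
  cbn [teval eval]; rewrite el -ltnNge => ltj.
  have ltjB : reg s2 8 < size B := ltn_trans ltj ltl.
  apply: runs_impl (insert_step Is2 lx2 ltjB PD2 cl2) _ => T s3.
  move=> [W' [nm' [pd' [x' [e [[Is3 lx3 PD3 cl3] W'E [r1 r2 r3] [p1 /andP [p2 p3] p4 p5] lT]]]]]].
  have eE' : e <= E.
    case: (leqP (reg s2 8) e) => [lje|]; last by move=> h; apply: ltnW (leq_trans (ltn_trans h ltj) leE).
    have /preP [v vW pv] := p1; apply: (Hb (reg s2 8) e v _ _ _ pv).
    - by rewrite nj.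
    - by rewrite lje.
    - exact/stW.
  have eE3 : reg s3 9 <= E.
    by rewrite p4 geq_max eE'; apply: leq_trans leE.
  have [[_ /andP [b1 _] _ [_ b2] _] _] := lx2.
  have [[_ /andP [b3 _] _ [_ b4] _] _] := lx3.
  have e23 : reg s2 9 <= reg s3 9 by rewrite p4; apply: leq_trans p2 (leq_maxl _ _).
  split; last first.
    apply: leq_trans (leq_add lT (leqnn _)) _; rewrite /Phi -mulnDr leq_mul2l; apply/orP; right.
    rewrite r1 b2 b4; rewrite r1 in b3.
    by clear -b1 b3 eE eE3 e23 nj ltj p5; lia.
  split; last first.
    rewrite r1 r2 r3; split=> //; apply/andP; split=> //; exact: leqW.
  exists W', nm', pd', x'; split=> //; split=> // v; rewrite W'E r1.
  split=> [/orP [/eqP ->|/stW [h|[i /andP [h1 h2] ->]]]|[h|[i /andP [h1 h2] ->]]].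
  - by right; exists (reg s2 8); rewrite ?nj ?leqnn.
  - by left.
  - by right; exists i => //; rewrite h1 ltnS ltnW.
  - by apply/orP; right; apply/stW; left.
  move: h2; rewrite ltnS leq_eqVlt => /orP [/eqP ->|h2]; first by rewrite eqxx.
  by apply/orP; right; apply/stW; right; exists i; rewrite ?h1.
move=> T s2 [[[W [nm2 [pd [x [Is2 lx2 PD2 [cl2 stW]]]]]] [/andP [nj jl] eE el eo]]].
cbn [teval eval]; rewrite el negbK => lj lT.
have ej : reg s2 8 = lim by apply/eqP; rewrite eqn_leq jl lj.
have [cs2 st2 R2 [hW2 gN2] eroot2] := Is2.
have limW2 : drop lim B \in W by apply/stW; left.
have clW : closed W.
  by move=> v vW; case: (cl2 _ vW) => [->|->|h]; [rewrite ej; right|left|right].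
(* The located string now begins the word [drop lim B]; with the other continuation guaranteed by
   [pending_next] it is branching, so it is a node and cannot be a pending target. *)
have epd : pd = None.
  case: PD2 => [[] //|[b [epd bb eb lt]]].
  have [[_ /andP [b1 b2] _ _ _] _] := lx2.
  have lje : reg s2 8 <= reg s2 9 by clear -b1; lia.
  have ltjB : reg s2 8 < size B by rewrite ej.
  have [ltB [c nc pc]] := pending_next hW2 cl2 bb lje b2 ltjB.
  have bc : br W (sub (reg s2 8) (reg s2 9)).
    apply/brP; right; exists c, (nth hash B (reg s2 9)); split=> //.
    apply: (pre_prefix (v := drop lim B)); last exact: word_pre.
    by rewrite -ej -sub_full sub_next.
  have := locus_max gN2 lx2 bc; move: lt; rewrite size_sub // => lt e.
  by rewrite e ltnn in lt.
rewrite epd in Is2; exists W, nm2; split=> //; first by rewrite -ej.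
move: lT; rewrite /Phi /insert_cost.
have -> : reg s1 9 = n by rewrite es1.
have -> : reg s1 11 = 0 by rewrite es1.
have -> : reg s1 8 = n by rewrite es1.
rewrite subn0; set Z := E - n + (E - n) + 4 * (lim - n) => lT.
have k1 : insert_unit * Z <= insert_unit * (Z + 1) by rewrite leq_mul2l leq_addr orbT.
have {}lT := leq_trans (leq_addr _ _) lT; set t := tcost _ in lT *.
have k2 := leq_pmulr (cmax (9 <~ 8) + cmax (10 <~ rRoot) + cmax (11 <~ #0) + cmax (15 <~ #0) + t) (ltn_addl Z (ltn0Sn 0)).
rewrite (mulnDl insert_unit); clear -lT k1 k2 lT1 lT2 lT3 lT4.
lia.
Qed.

(** * Finding repeated suffixes *)

Lemma sub_alpha j : sub j (size alpha) = drop j alpha.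
Proof.
rewrite /sub; case: (leqP j (size alpha)) => le.
  rewrite drop_cat; case: ltnP => lt; first by rewrite takel_cat ?size_drop // -size_drop take_size.
  have -> : j = size alpha by apply/eqP; rewrite eqn_leq le lt.
  by rewrite subnn drop0 take0 drop_size.
have /eqP -> : size alpha - j == 0 by rewrite subn_eq0 ltnW.
by rewrite take0 drop_oversize // ltnW.
Qed.

(** If no nonempty suffix qualifies, [find] returns [size alpha], which stands for the empty
    suffix. *)
Definition first_two W := find (fun i => two W (drop i alpha)) (iota 0 (size alpha)).

Lemma first_two_le W : first_two W <= size alpha.
Proof. by have := find_size (fun i => two W (drop i alpha)) (iota 0 (size alpha)); rewrite size_iota. Qed.

(** Distinct words with the same first character have distinct tails, and closure makes these tails
    words, as they are nonempty. *)
Lemma two_behead W v : closed W -> two W v -> 1 < size v -> two W (behead v).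
Proof.
move=> cl /twoP [v1 [v2 [h1 h2 ne p1 p2]]]; case: v p1 p2 => // c [//|d v] p1 p2 _.
case: v1 h1 ne p1 => // c1 v1 h1 ne /= /andP [/eqP e1 p1].
case: v2 h2 ne p2 => // c2 v2 h2 ne /= /andP [/eqP e2 p2].
apply/twoP; exists v1, v2; split=> //.
- by case: (cl _ h1) => //= e; rewrite e in p1.
- by case: (cl _ h2) => //= e; rewrite e in p2.
by move: ne; rewrite -e1 -e2; apply: contra => /eqP ->.
Qed.

Lemma two_alpha W i : closed W -> i < size alpha -> two W (drop i alpha) = (first_two W <= i).
Proof.
move=> cl lt; case: leqP => le; last first.
  apply/negbTE/negP => h; have := before_find 0 le.
  by rewrite nth_iota // h.
have := le; rewrite -[X in _ <= X]/(0 + i) => _.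
have lt0 : first_two W < size alpha by apply: leq_ltn_trans le lt.
have base : two W (drop (first_two W) alpha).
  have : has (fun i => two W (drop i alpha)) (iota 0 (size alpha)).
    by rewrite has_find size_iota.
  by move/(nth_find 0); rewrite -/(first_two W) nth_iota.
rewrite -(subnKC le) in lt *; elim: (i - first_two W) lt => [|k IH] lt; first by rewrite addn0.
have lt' : first_two W + k < size alpha by apply: leq_trans lt; rewrite addnS.
rewrite addnS -addn1 addnC -drop_drop drop1; apply: two_behead => //.
  exact: IH.
by rewrite size_drop ltn_subRL addn1 -addnS.
Qed.

(** Every word through a point inside the arc to [y] passes through [y]: that is one word if [y] is
    a leaf, and at least two if [y] branches. A nonempty string located at a node is itself
    branching. *)
Lemma leaf_arc_two W nm f m x : hterm hash W -> rep (br W) W nm m (f rFree) None ->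
  locus (br W) W nm f x -> sub (f rJ) (f rE) <> [::] ->
  exists f', [/\ run leaf_arc (State f m) = State f' m, f' rC2 = ~~ two W (sub (f rJ) (f rE)) &
    forall r, r != rC2 -> f' r = f r].
Proof.
move=> hW R lx; have gN := goodN_br hW.
have [[Nx /andP [bnd bE] subx [eu edu] preW] alt] := lx.
set cur := sub _ _ => ne.
have szc : size cur = f 9 - f 8 by apply: size_sub.
have up (k : nat) : forall r, r != rC2 -> upd f rC2 k r = f r by move=> r /negbTE n; rewrite updE n.
rewrite /leaf_arc run_if; ev; rewrite edu.
case: eqP => [e|n1].
  exists (upd f 20 0); rewrite run_asg; split=> //; last exact: up.
  rewrite br_two //; last exact/eqP.
  have := locus_full lx; rewrite -/cur => <- //; clear -e; lia.
case: alt => [e|[y [ed pc lt ey yN]]]; first by case: n1; rewrite e; clear -bnd; lia.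
have [_ ny _ lxy _] := ed.
rewrite run_if; ev; rewrite ey (node_leaf R gN ny).
have pry := edge_pre gN ed.
case: (boolP (y \in W)) => yW.
  exists (upd f 20 1); rewrite run_asg; split=> //; last exact: up.
  rewrite updE /=.
  suff -> : two W cur = false by [].
  apply/negbTE/negP => /twoP [v1 [v2 [h1 h2 nv p1 p2]]].
  have key v : v \in W -> prefix cur v -> v = y.
    move=> vW pv; have pxc : prefix x cur by rewrite -subx sub_prefix.
    have pxn : prefix (rcons x (nth hash cur (size x))) cur by apply: prefix_next => //; rewrite szc.
    have := edge_cmp hW gN ed (word_pre vW) (prefix_trans pxc pv).
    case; first by exists (nth hash cur (size x)); apply: prefix_trans pxn _.
      by move=> p; apply: (word_max hW yW (word_pre vW) p).
    by move=> p; symmetry; apply: (word_max hW vW pry p).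
  by case/eqP: nv; rewrite (key _ h1 p1) (key _ h2 p2).
exists (upd f 20 0); rewrite run_asg; split=> //; last exact: up.
  rewrite updE /=.
have by' : br W y by move: ny; rewrite /nd (negbTE yW) orbF.
rewrite (two_prefix pc) //; apply: br_two => //.
by case: (y) lxy.
Qed.

Definition locate : cmd := While (TEq rC2 #1) (shift ;; rescan ;; leaf_arc).
Definition locate_regs := [:: rJ; rE; rU; rDU; rY; rC; rGo; rC2].
Definition locate_unit := cmax shift + rescan_unit + cmax leaf_arc + tcost (TEq rC2 #1).

Lemma run_leaf_arc0 f m : f rJ + f rDU = f rE -> run leaf_arc (State f m) = State (upd f rC2 0) m.
Proof. by move=> e; rewrite /leaf_arc run_if; ev; rewrite e eqxx. Qed.

Definition flagged W nm (f : nat -> nat) x : Prop :=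
  [/\ locus (br W) W nm f x, f rE = size alpha, f rJ <= size alpha & f rC2 = (f rJ < first_two W)].

Lemma run_leaf_arc W nm s x : inv (br W) W nm None s -> closed W ->
  locus (br W) W nm (reg s) x -> reg s rE = size alpha -> reg s rJ <= size alpha ->
  same_but [:: rC2] s (run leaf_arc s) /\ flagged W nm (reg (run leaf_arc s)) x.
Proof.
move=> Is cl lx eE lej; have [cs st R [hW gN] eroot] := Is.
have es : s = State (reg s) (mem s) by case: (s).
have [[Nx /andP [bnd bE] subx [eu edu] preW] alt] := lx.
suff [f' [e1 e2 e3]] : exists f', [/\ run leaf_arc s = State f' (mem s),
    f' rC2 = (reg s rJ < first_two W) & forall r, r != rC2 -> f' r = reg s r].
  rewrite e1; split; first by split=> // r; rewrite inE; apply: e3.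
  rewrite /flagged /= e2 !e3 // eE; split=> //.
  by move: lx; rewrite /locus /at_node /mid_edge !e3.
rewrite es; case: (ltnP (reg s rJ) (size alpha)) => lt.
  have [|f' [e1 e2 e3]] := leaf_arc_two hW R lx.
    by rewrite eE sub_alpha => /(congr1 size); rewrite size_drop /=; clear -lt; lia.
  exists f'; split=> //; rewrite e2 eE sub_alpha two_alpha //.
  by rewrite -ltnNge.
exists (upd (reg s) rC2 0); rewrite run_leaf_arc0; last first.
  by rewrite edu; clear -eE lej lt bnd; lia.
split=> //; first by rewrite updE /= ltnNge (leq_trans (first_two_le W) lt).
by move=> r /negbTE n; rewrite updE n.
Qed.

(** The right end stays at the end of [alpha], so depths never exceed the length of the trial. In
    the factor 5 this depth counts once and each step along a suffix link four times. *)
Lemma run_locate W nm s x : inv (br W) W nm None s -> closed W -> (forall j, pre W (drop j alpha)) ->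
  flagged W nm (reg s) x ->
  runs locate s (fun T s' => [/\ same_but locate_regs s s',
    reg s' rJ = maxn (reg s rJ) (first_two W) &
    T <= locate_unit * (5 * (size alpha - reg s rJ) + 1)]).
Proof.
move=> Is cl prea fl.
set D := size alpha - reg s rJ.
pose I s' := same_but locate_regs s s' /\ exists x', flagged W nm (reg s') x' /\
  reg s rJ <= reg s' rJ <= maxn (reg s rJ) (first_two W).
pose Phi s' := locate_unit * ((D - reg s' rDU) + 4 * (size alpha - reg s' rJ)).
have I1 : I s.
  by split=> //; exists x; split=> //; rewrite leqnn leq_maxl.
apply: runs_impl (runs_while (I := I) (Phi := Phi) _ I1) _.
  move=> s1 [sb1 [x1 [[lx1 eE1 lej1 fl1] /andP [j0 j1]]]]; cbn [teval eval].
  rewrite fl1 eqb1 => ltF.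
  have Is1 := inv_same (l := locate_regs) isT sb1 Is.
  have [cs st R [hW gN] eroot] := Is1.
  have [[Nx1 /andP [bnd bE] subx [eu edu] preW] alt] := lx1.
  have lta : reg s1 8 < size alpha := leq_trans ltF (first_two_le W).
  have es1 : s1 = State (reg s1) (mem s1) by case: (s1).
  have ltB : reg s1 8 < size B by apply: leq_trans lta _; rewrite size_cat leq_addr.
  apply: runs_seq; apply: runs_run => // T2 lT2; set s2 := run shift s1.
  have Is1' : inv (br W) W nm None (State (reg s1) (mem s1)) by rewrite -es1.
  have em : maxn (reg s1 9) (reg s1 8).+1 = size alpha by rewrite eE1; apply/maxn_idPl.
  have pr : pre W (sub (reg s1 8).+1 (maxn (reg s1 9) (reg s1 8).+1)).
    by rewrite em sub_alpha.
  have bb : reg s1 8 + size x1 <= reg s1 9 <= size B by rewrite bnd.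
  have npd : Some x1 <> None by [].
  have [] := run_shift Is1' Nx1 npd subx bb ltB eu edu pr.
  rewrite -es1 -/s2 em => sb2 r28 r29 at2.
  have Is2 := inv_same (l := shift_regs) isT sb2 Is1.
  apply: runs_seq; apply: runs_impl (run_rescan Is2 at2) _ => T3 s3 [sb3 [x3 [lx3 le3 lT3]]].
  have Is3 := inv_same (l := rescan_regs) isT sb3 Is2.
  have r38 : reg s3 8 = (reg s1 8).+1 by case: sb3 => _ ->.
  have r39 : reg s3 9 = size alpha by case: sb3 => _ ->.
  apply: runs_run => // T4 lT4.
  have lej3 : reg s3 8 <= size alpha by rewrite r38.
  have [sb4 fl4] := run_leaf_arc Is3 cl lx3 r39 lej3.
  set s4 := run leaf_arc s3 in sb4 fl4 *.
  have r48 : reg s4 8 = (reg s1 8).+1 by case: sb4 => _ ->.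
  have [[[_ /andP [b4 _] _ [_ e4] _] _] eE4 _ _] := fl4.
  split; last first.
    rewrite /Phi; apply: (@leq_trans (locate_unit * ((size x3 + 2 - size x1) + 1) +
      locate_unit * (D - reg s4 11 + 4 * (size alpha - reg s4 8)))).
      rewrite leq_add2r /locate_unit; set c1 := cmax shift; set c2 := cmax leaf_arc; set c3 := tcost _.
      set Z := _ + 2 - _ + 1.
      have sbx : size (behead x1) = (size x1).-1 by rewrite size_behead.
      rewrite sbx in lT3 le3.
      have bz : size x3 - (size x1).-1 + 1 <= Z by rewrite /Z; clear -le3; lia.
      have h3 := leq_trans lT3 (leq_mul (leqnn rescan_unit) bz).
      have b3 : 0 < Z by rewrite /Z addn1.
      have k1 := leq_pmulr c1 b3; have k2 := leq_pmulr c2 b3; have k3 := leq_pmulr c3 b3.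
      rewrite (mulnDl (_ + _ + _)) (mulnDl (_ + _)) (mulnDl c1).
      by clear -h3 k1 k2 k3 lT2 lT4; lia.
    rewrite -mulnDr leq_mul2l; apply/orP; right.
    rewrite r48 e4 edu; rewrite r48 eE4 in b4; rewrite size_behead in le3.
    by rewrite eE1 in bnd; rewrite /D; clear -b4 bnd lta j0 le3; lia.
  split.
    have s12 : same_but locate_regs s s2 by apply: (same_trans sb1 sb2); apply/allP.
    have s13 : same_but locate_regs s s3 by apply: (same_trans s12 sb3); apply/allP.
    by apply: (same_trans s13 sb4); apply/allP.
  exists x3; split=> //; rewrite r48; apply/andP; split; first exact: leqW.
  by rewrite leq_max ltF orbT.
move=> T s' [[sb' [x' [[lx' eE' lej' fl'] /andP [j0 j1]]]]].
cbn [teval eval]; rewrite fl' eqb1 -leqNgt => le lT; split=> //.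
  by apply/eqP; rewrite eqn_leq j1 geq_max j0.
apply: leq_trans (leq_trans (leq_addr _ _) lT) _.
rewrite mulnDr muln1; apply: leq_add; last exact: leq_addl.
by rewrite /Phi -/D leq_mul2l; apply/orP; right; clear; lia.
Qed.

Definition find_regs := [:: rK; rEll; rJ; rE; rU; rDU; rY; rC; rGo; rC2].
Definition find_init := cmax (rK <~ rK `+ rK `+ #1) + cmax (rJ <~ rAlphaLen `- rK) +
  cmax (rE <~ rAlphaLen) + cmax (rU <~ rRoot) + cmax (rDU <~ #0) + cmax leaf_arc +
  cmax (rEll <~ rAlphaLen `- rJ).
Definition find_unit := find_init + rescan_unit + 5 * locate_unit + tcost (TEq rEll rK).

Lemma run_find_body W nm s : inv (br W) W nm None s -> closed W ->
  (forall j, pre W (drop j alpha)) ->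
  runs find_body s (fun T s' => [/\ same_but find_regs s s', reg s' rK = (reg s rK).*2.+1,
    reg s' rEll = minn (reg s rK).*2.+1 (size alpha - first_two W) &
    T + tcost (TEq rEll rK) <= find_unit * ((reg s rK).*2.+1 + 1)]).
Proof.
move=> Is cl prea; have [cs st R [hW gN] eroot] := Is.
have es : s = State (reg s) (mem s) by case: (s).
set K := (reg s rK).*2.+1; set F := first_two W.
have leF : F <= size alpha := first_two_le W.
apply: runs_seq; apply: runs_run => // T1 lT1; apply: runs_seq; apply: runs_run => // T2 lT2.
apply: runs_seq; apply: runs_run => // T3 lT3; apply: runs_seq; apply: runs_run => // T4 lT4.
apply: runs_seq; apply: runs_run => // T5 lT5; set s5 := run (rDU <~ #0) _.
pose f5 := upd (upd (upd (upd (upd (reg s) 17 K) 8 (size alpha - K)) 9 (size alpha)) 10 root) 11 0.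
have es5 : s5 = State f5 (mem s).
  rewrite /s5 es !run_asg; ev.
  by case: cs => -[_ _ ->] -> _ _ _; rewrite /K /f5 !addn1 !addnn.
have sb5 : same_but find_regs s s5.
  by rewrite es5 /f5; do 5!apply: same_upd => //; rewrite {2}es.
have Is5 := inv_same (l := find_regs) isT sb5 Is.
have r5 : reg s5 8 = size alpha - K /\ reg s5 9 = size alpha by rewrite es5.
have lB : size alpha <= size B by rewrite size_cat leq_addr.
have at5 : at_node (br W) W nm (reg s5) [::].
  rewrite /at_node r5.1 r5.2 es5 addn0 sub0 sub_alpha; split=> //.
  by rewrite leq_subr.
apply: runs_seq; apply: runs_impl (run_rescan Is5 at5) _ => T6 s6 [sb6 [x6 [lx6 _ lT6]]].
have Is6 := inv_same (l := rescan_regs) isT sb6 Is5.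
have r68 : reg s6 8 = size alpha - K by case: sb6 => _ ->; rewrite ?r5.1.
have r69 : reg s6 9 = size alpha by case: sb6 => _ ->; rewrite ?r5.2.
apply: runs_seq; apply: runs_run => // T7 lT7.
have le6 : reg s6 8 <= size alpha by rewrite r68 leq_subr.
have [sb7 fl7] := run_leaf_arc Is6 cl lx6 r69 le6.
set s7 := run leaf_arc s6 in sb7 fl7 *.
have Is7 := inv_same (l := [:: rC2]) isT sb7 Is6.
have r78 : reg s7 8 = size alpha - K by case: sb7 => _ ->.
apply: runs_seq; apply: runs_impl (run_locate Is7 cl prea fl7) _ => T8 s8 [sb8 r88 lT8].
apply: runs_run => // T9 lT9.
have s56 : same_but find_regs s s6 by apply: (same_trans sb5 sb6); apply/allP.
have s57 : same_but find_regs s s7 by apply: (same_trans s56 sb7); apply/allP.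
have s58 : same_but find_regs s s8 by apply: (same_trans s57 sb8); apply/allP.
have Is8 := inv_same (l := find_regs) isT s58 Is.
have es8 : s8 = State (reg s8) (mem s8) by case: (s8).
have r817 : reg s8 17 = K.
  case: sb8 => _ -> //; case: sb7 => _ -> //; case: sb6 => _ -> //; by rewrite es5.
have al : reg s8 rAlphaLen = size alpha by case: Is8 => -[_ ->].
split.
- by rewrite es8 run_asg; apply: same_upd => //; rewrite -es8.
- by rewrite es8 run_asg /= updE.
- rewrite es8 run_asg; ev; rewrite al r88 r78 -/F.
  by clear -leF; lia.
have b1 : size x6 <= K.
  have [[_ /andP [b _] _ _ _] _] := lx6; rewrite r68 r69 in b; clear -b; lia.
have b2 : size alpha - reg s7 8 <= K by rewrite r78; clear; lia.
have k1 : T6 <= rescan_unit * (K + 1).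
  by apply: leq_trans lT6 _; rewrite leq_mul2l; apply/orP; right; rewrite subn0 leq_add2r.
have k2 : T8 <= 5 * locate_unit * (K + 1).
  apply: leq_trans lT8 _; rewrite mulnAC mulnC leq_mul2r; apply/orP; right.
  by clear -b2; lia.
have Kp : 0 < K + 1 by rewrite addn1.
have k3 := leq_pmulr find_init Kp; have k4 := leq_pmulr (tcost (TEq rEll rK)) Kp.
rewrite /find_unit (mulnDl (_ + _ + _)) (mulnDl (_ + _)) (mulnDl find_init).
move: k3; rewrite {1}/find_init; clear -k1 k2 k4 lT1 lT2 lT3 lT4 lT5 lT7 lT9; lia.
Qed.

Definition find_cost := find_unit * 8 + (cmax (rK <~ #0) + cmax (rEll <~ #0) + tcost (TEq rEll rK)).

Lemma run_find W nm s : inv (br W) W nm None s -> closed W ->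
  (forall j, pre W (drop j alpha)) ->
  runs find_rep s (fun T s' => [/\ same_but find_regs s s',
    reg s' rEll = size alpha - first_two W &
    T <= find_cost * (size alpha - first_two W + 1)]).
Proof.
move=> Is cl prea; have es : s = State (reg s) (mem s) by case: (s).
set M := size alpha - first_two W.
apply: runs_seq; apply: runs_run => // T1 lT1; apply: runs_seq; apply: runs_run => // T2 lT2.
set s1 := run (rEll <~ #0) _.
have es1 : s1 = State (upd (upd (reg s) 17 0) 18 0) (mem s) by rewrite /s1 es !run_asg.
have sb1 : same_but find_regs s s1.
  by rewrite es1; do 2!apply: same_upd => //; rewrite {2}es.
pose I s' := [/\ same_but find_regs s s', reg s' rEll = minn (reg s' rK) M & reg s' rK <= M.*2.+1].
(* With [K] the value of [rK], the next trial has length 2K+1 and costs 2K+2 units, twice the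
   increase of [rK]. A trial is made only if [K] is at most [M], so lengths stay below 2M+2. *)
pose Phi s' := find_unit * (2 * (M.*2.+2 - reg s' rK)).
have I1 : I s1 by split; rewrite // es1 /= min0n.
apply: runs_impl (runs_while (I := I) (Phi := Phi) _ I1) _.
  move=> s2 [sb2 e2 l2]; cbn [teval eval]; rewrite e2 => /eqP eK.
  have leK : reg s2 17 <= M by rewrite -eK geq_minr.
  have Is2 := inv_same (l := find_regs) isT sb2 Is.
  apply: runs_impl (run_find_body Is2 cl prea) _ => T s3 [sb3 r3 e3 lT].
  split; first split.
  - by apply: (same_trans sb2 sb3); apply/allP.
  - by rewrite e3 r3.
  - by rewrite r3 ltnS leq_double.
  rewrite /Phi r3; apply: leq_trans (leq_add lT (leqnn _)) _.
  rewrite -mulnDr leq_mul2l; apply/orP; right; clear -leK; lia.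
move=> T s2 [[sb2 e2 l2]]; cbn [teval eval]; rewrite e2 => nK lT; split=> //.
  by apply/minn_idPr; move/eqP: nK; clear; lia.
have lT' := leq_trans (leq_addr _ _) lT.
rewrite /Phi es1 /= in lT'.
have b : 0 < M + 1 by rewrite addn1.
have k := leq_pmulr (cmax (rK <~ #0) + cmax (rEll <~ #0) + tcost (TEq rEll rK)) b.
rewrite /find_cost mulnDl -mulnA.
have h : find_unit * (2 * (M.*2.+2 - 0)) <= find_unit * (8 * (M + 1)).
  by rewrite leq_mul2l; apply/orP; right; clear; lia.
rewrite !updE /= in lT'; clear -lT' k h lT1 lT2; lia.
Qed.

(** * The common suffix of alpha beta and alpha delta *)

Notation X := (alpha ++ beta).
Notation Y := (alpha ++ delta).

Definition tail_eq t : Prop :=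
  [/\ t <= size X, t <= size Y & drop (size X - t) X = drop (size Y - t) Y].

Lemma tail_eqS t : tail_eq t -> t < size X -> t < size Y ->
  nth hash X (size X - t.+1) = nth hash Y (size Y - t.+1) -> tail_eq t.+1.
Proof.
case=> _ _ e lX lY en; split=> //.
rewrite (drop_nth hash); last by clear -lX; lia.
rewrite [RHS](drop_nth hash); last by clear -lY; lia.
by rewrite en -!subSn //= !subSS e.
Qed.

Lemma tail_eq_nth t t' : tail_eq t' -> t < t' ->
  nth hash X (size X - t.+1) = nth hash Y (size Y - t.+1).
Proof.
case=> lX lY e lt; have := congr1 (fun w => nth hash w (t' - t.+1)) e.
by rewrite /= !nth_drop !addnBA // !subnK.
Qed.

Lemma nth_A_X i : i < size X -> nth hash A i = nth hash X i.
Proof. by move=> lt; rewrite catA nth_cat lt. Qed.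

Lemma nth_B_Y i : i < size Y -> nth hash B i = nth hash Y i.
Proof. by move=> lt; rewrite catA nth_cat lt. Qed.

Definition common_regs := [:: rT; rGo; rC; rC2].
Definition common_unit := (cmax common_body + tcost (TEq rGo #1)).*2 + cmax (rT <~ #0) + cmax (rGo <~ #1).

Lemma run_common N W nm pd s : inv N W nm pd s ->
  runs common s (fun T s' => same_but common_regs s s' /\ exists t,
    [/\ reg s' rT = t, tail_eq t, forall t', tail_eq t' -> t' <= t &
        T <= common_unit * (t + 1)]).
Proof.
move=> Is; apply: runs_seq; apply: runs_run => // T1 lT1.
apply: runs_seq; apply: runs_run => // T2 lT2.
have es : s = State (reg s) (mem s) by case: (s).
set s1 := run (rGo <~ #1) _.
have es1 : s1 = State (upd (upd (reg s) 25 0) 14 1) (mem s) by rewrite /s1 es !run_asg.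
pose k := cmax common_body + tcost (TEq rGo #1).
pose I s' := [/\ same_but common_regs s s', tail_eq (reg s' rT) &
   reg s' rGo <> 1 -> forall t', tail_eq t' -> t' <= reg s' rT].
pose Phi s' := k * ((size X - reg s' rT) + (reg s' rGo == 1)).
have I1 : I s1.
  split; first by rewrite es1; do 2!apply: same_upd => //; rewrite {2}es.
    by rewrite es1; split=> //=; rewrite !subn0 !drop_size.
  by rewrite es1.
have [|T [s' [ex [[sb te mx] ng lT]]]] := runs_while (I := I) (Phi := Phi) (p := common_body) (b := TEq rGo #1) _ I1.
  move=> [f m] [sb te _] /= /eqP go; apply: runs_run => // T lT.
  pose G s2 := I s2 /\ T + tcost (TEq rGo #1) + Phi s2 <= Phi (State f m).
  rewrite -/(G (run common_body (State f m))).
  have lT' : T + tcost (TEq rGo #1) <= k by rewrite leq_add2r.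
  have [cs st _ _ _] := inv_same (s := s) (l := common_regs) isT sb Is.
  cbn [reg mem] in *.
  have hPhi f' : (size X - f' 25) + (f' 14 == 1) < (size X - f 25) + (f 14 == 1) ->
      T + tcost (TEq rGo #1) + Phi (State f' m) <= Phi (State f m).
    by move=> h; rewrite /Phi /=; apply: pay.
  have [[fA _ _] fa fb fd _] := cs.
  have sX : f rAlphaLen + f rBetaLen = size X by rewrite fa fb size_cat.
  have sY : f rAlphaLen + f rDeltaLen = size Y by rewrite fa fd size_cat.
  have stop f2 : same_but common_regs s (State f2 m) -> f2 25 = f 25 ->
      (forall t', tail_eq t' -> t' <= f 25) -> G (State (upd f2 14 0) m).
    move=> sb2 e2 mx; split; last by apply: hPhi; ev; rewrite e2 go; clear; lia.
    split; first exact: same_upd.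
      by rewrite /= updE /= e2.
    by move=> _; rewrite /= updE /= e2.
  rewrite /common_body run_if; ev; rewrite sX addn1.
  case: ltnP => ltX; last first.
    rewrite run_asg; apply: stop => // t' [h _ _]; exact: leq_trans ltX.
  rewrite run_if; ev; rewrite sY addn1.
  case: ltnP => ltY; last first.
    rewrite run_asg; apply: stop => // t' [_ h _]; exact: leq_trans ltY.
  rewrite run_seq run_asg; ev; rewrite sX fA addn1.
  have lA : size X - (f 25).+1 < size A.
    by rewrite catA [size (X ++ _)]size_cat; clear -ltX; lia.
  have lB : size Y - (f 25).+1 < size B.
    by rewrite catA [size (Y ++ _)]size_cat; clear -ltY; lia.
  rewrite st.1 // nth_A_X; last by clear -ltX; lia.
  rewrite run_seq run_get_b; [ev|by []|by []|by ev; rewrite sY addn1].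
  rewrite sY addn1 nth_B_Y; last by clear -ltY; lia.
  rewrite run_if; ev.
  set cX := nth hash X _; set cY := nth hash Y _.
  have sb2 : same_but common_regs s (State (upd (upd f 13 (code cX)) 20 (code cY)) m).
    by do 2!apply: same_upd => //.
  case: eqP => [ec|nec].
    rewrite run_asg; ev; split; last by apply: hPhi; ev; rewrite addn1; clear -ltX; lia.
    split; first exact: same_upd.
      by rewrite /= updE /= addn1; apply: tail_eqS => //; apply: code_inj.
    by rewrite /= !updE /=.
  rewrite run_asg; apply: stop => // t' h; rewrite leqNgt; apply/negP => lt.
  by case: nec; rewrite /cX /cY (tail_eq_nth h lt).
exists T, s'; split=> //; split=> //; exists (reg s' 25); split=> //.
  by apply: mx => h; move/eqP: ng; rewrite /= h.
have [tX _ _] := te.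
have {}lT : T <= k * (reg s' 25 + 1) + tcost (TEq 14 #1).
  move: lT; rewrite /Phi es1 /= !updE /= -[_ == 1]/(teval s' (TEq 14 #1)) (negbTE ng).
  have -> : size X - 0 + (1 == 1) = (reg s' 25 + 1) + (size X - reg s' 25 + 0).
    by clear -tX; lia.
  by rewrite [k * (_ + 1 + _)]mulnDr; clear; lia.
have Kp : 0 < reg s' 25 + 1 by rewrite addn1.
have h : tcost (TEq 14 #1) <= k by rewrite leq_addl.
have k1 := leq_pmulr k Kp; have k2 := leq_pmulr (cmax (25 <~ #0)) Kp.
have k3 := leq_pmulr (cmax (14 <~ #1)) Kp.
rewrite /common_unit -/k -addnn (mulnDl (_ + _ + _)) (mulnDl (_ + _)) (mulnDl k).
by clear -lT h k1 k2 k3 lT1 lT2; lia.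
Qed.

(** * Occurrences in A and B versus words of the trie *)

Implicit Type S : word.

Hypothesis hfirst : ohead (beta ++ gamma) != ohead (delta ++ gamma).

Lemma find_mono (p : pred nat) n i : (forall j, p j -> j.+1 < n -> p j.+1) -> i < n ->
  (find p (iota 0 n) <= i) = p i.
Proof.
move=> mono lt; case: leqP => le; last first.
  by have := before_find 0 le; rewrite nth_iota.
have ltF : find p (iota 0 n) < n by apply: leq_ltn_trans lt.
have base : p (find p (iota 0 n)).
  have : has p (iota 0 n) by rewrite has_find size_iota.
  by move/(nth_find 0); rewrite nth_iota.
symmetry; move: base lt; rewrite -(subnKC le); elim: (i - _) => [|k IH] base lt.
  by rewrite addn0.
by rewrite addnS; apply: mono; [apply: IH => //; apply: leq_trans lt; rewrite addnS | rewrite -addnS].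
Qed.

Lemma count2P (p : pred nat) n :
  1 < count p (iota 0 n) <-> exists i j, [/\ i < j, j < n, p i & p j].
Proof.
rewrite -size_filter; split=> [|[i [j [lt ltn pi pj]]]].
  have := filter_uniq p (iota_uniq 0 n); have mf i : i \in filter p (iota 0 n) -> p i /\ i < n.
    by rewrite mem_filter mem_iota add0n => /andP [].
  case: filter mf => [|i [|j s]] mf //= /andP [nij _] _.
  have [pi li] := mf i (mem_head _ _).
  have [pj lj] : p j /\ j < n by apply: mf; rewrite !inE eqxx orbT.
  case: (ltngtP i j) => [lt|lt|e]; [exists i, j|exists j, i|] => //.
  by rewrite e inE eqxx in nij.
have hi : i \in filter p (iota 0 n) by rewrite mem_filter pi mem_iota /=; apply: ltn_trans ltn.
have hj : j \in filter p (iota 0 n) by rewrite mem_filter pj mem_iota.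
case: filter hi hj => [|a [|b s]] //; rewrite !inE => /eqP ei /eqP ej.
by rewrite ei ej ltnn in lt.
Qed.

Lemma prefix_drop_size u S i : u != [::] -> prefix u (drop i S) -> i < size S.
Proof.
case: u => // a u _ /size_pfx; rewrite size_drop ltnNge => le; apply/negP => h.
by rewrite (eqP (h : size S - i == 0)) in le.
Qed.

Lemma occ2P u S : u != [::] ->
  2 <= occ u S <-> exists i j, [/\ i < j, prefix u (drop i S) & prefix u (drop j S)].
Proof.
move=> un; rewrite /occ; split=> [/count2P [i [j [lt _ pi pj]]]|[i [j [lt pi pj]]]].
  by exists i, j.
by apply/count2P; exists i, j; split=> //; apply: ltnW; apply: prefix_drop_size pj.
Qed.

Lemma occ2I u S i j : u != [::] -> i != j -> prefix u (drop i S) -> prefix u (drop j S) -> 2 <= occ u S.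
Proof.
move=> un ne pi pj; apply/occ2P => //.
by case: (ltngtP i j) ne => // lt _; [exists i, j | exists j, i].
Qed.

Lemma prefix_drop u v r : prefix u v -> prefix (drop r u) (drop r v).
Proof.
move=> /prefixP [t ->]; case: (leqP r (size u)) => le.
  by rewrite drop_cat; case: ltnP => h; rewrite ?prefix_prefix // (eqP (_ : r == size u)) ?drop_size ?prefix0s // eqn_leq le.
by rewrite drop_oversize ?prefix0s // ltnW.
Qed.

Lemma drop_alpha_neq0 i : i < size alpha -> drop i alpha != [::].
Proof. by move=> lt; rewrite -size_eq0 size_drop subn_eq0 -ltnNge. Qed.

Lemma prefix_alpha i S : prefix (drop i alpha) (drop i (alpha ++ S)).
Proof.
by apply: prefix_drop; apply: prefix_prefix.
Qed.

(** The position where [alpha_rep alpha S] starts within [alpha]. *)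
Definition first_occ S := find (fun i => 2 <= occ (drop i alpha) S) (iota 0 (size alpha)).

Lemma first_occP S i : i < size alpha -> (first_occ S <= i) = (2 <= occ (drop i alpha) S).
Proof.
move=> lt; apply: (find_mono (p := fun i => 2 <= occ (drop i alpha) S)) => // j h ltj.
have /(occ2P _ (drop_alpha_neq0 (ltnW ltj))) [k [l [ltkl pk pl]]] := h.
apply: (@occ2I _ _ k.+1 l.+1); first exact: drop_alpha_neq0.
- by rewrite eqSS ltn_eqF.
- by rewrite -add1n -drop_drop -[k.+1]add1n -drop_drop prefix_drop.
- by rewrite -add1n -drop_drop -[l.+1]add1n -drop_drop prefix_drop.
Qed.

Lemma first_occ_le S : first_occ S <= size alpha.
Proof. by have := find_size (fun i => 2 <= occ (drop i alpha) S) (iota 0 (size alpha)); rewrite size_iota. Qed.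

Lemma size_alpha_rep S : size (alpha_rep alpha S) = size alpha - first_occ S.
Proof.
rewrite /alpha_rep /longest_suffix find_map.
(* The last candidate is the empty suffix, which is also the default of [nth]; so only nonempty
   suffixes need a search. *)
rewrite -[(size alpha).+1]addn1 iotaD find_cat /= add0n size_iota.
set q := preim _ _.
have -> : find q (iota 0 (size alpha)) = first_occ S by [].
case: ifP => h.
  have lt : first_occ S < size alpha.
    by move: h; rewrite has_find size_iota.
  by rewrite (nth_map 0) ?size_cat ?size_iota ?nth_cat ?size_iota ?lt ?nth_iota ?size_drop // ltn_addr.
have -> : first_occ S = size alpha.
  by rewrite /first_occ hasNfind ?size_iota //; apply: negbT.
rewrite subnn; case: ifP => _.
  rewrite addn0 (nth_map 0) ?size_cat ?size_iota ?addn1 // nth_cat size_iota ltnn subnn /=.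
  by rewrite drop_size.
by rewrite nth_default // size_map size_cat size_iota.
Qed.

Lemma size_alpha_star : size (alpha_star alpha beta delta gamma) =
  size alpha - minn (first_occ A) (first_occ B).
Proof.
rewrite /alpha_star; case: ifP; rewrite !size_alpha_rep => h.
- by have := first_occ_le A; have := first_occ_le B; clear -h; lia.
- by have := first_occ_le A; have := first_occ_le B; clear -h; lia.
Qed.

Definition WA : seq word := [seq drop i A | i <- iota 0 (size A)].

Lemma mem_WA v : v \in WA <-> exists2 i, i < size A & v = drop i A.
Proof.
split=> [/mapP [i]|[i lt ->]]; first by rewrite mem_iota => /andP [_ lt] ->; exists i.
by apply/mapP; exists i; rewrite // mem_iota.
Qed.

Lemma two_WA u : u != [::] -> two WA u = (2 <= occ u A).
Proof.
move=> un; apply/idP/idP => [/twoP [v1 [v2 [/mem_WA [i li ->] /mem_WA [j lj ->] ne pi pj]]]|].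
  by apply: (occ2I un _ pi pj); apply: contra ne => /eqP ->.
move=> /(occ2P _ un) [i [j [lt pi pj]]]; apply/twoP; exists (drop i A), (drop j A).
have lj := prefix_drop_size un pj; have li := ltn_trans lt lj.
split=> //; try by apply/mem_WA; [exists i | exists j].
- by apply/mem_WA; exists i.
- by apply/mem_WA; exists j.
by apply/eqP => /(congr1 (@size Sigma)); rewrite !size_drop; clear -lt lj; lia.
Qed.

Lemma WA_hterm : hterm hash WA.
Proof.
move=> v /mem_WA [j lt ->]; have [A' eA nh] := hA; exists (drop j A').
  by move: lt; rewrite eA size_rcons ltnS => lt; rewrite drop_rcons.
by apply: contra nh; apply: mem_drop.
Qed.

Lemma WA_closed : closed WA.
Proof.
move=> v /mem_WA [j lt ->]; rewrite -drop1 drop_drop add1n.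
case: (ltnP j.+1 (size A)) => h; last by left; apply: drop_oversize.
by right; apply/mem_WA; exists j.+1.
Qed.

Lemma beta_neq_delta : beta <> delta.
Proof. by move=> e; move: hfirst; rewrite e eqxx. Qed.

Lemma drop_XY i : i <= size alpha -> drop i X <> drop i Y.
Proof.
move=> le; rewrite !drop_cat; case: ltnP => lt.
  by move/(congr1 (drop (size (drop i alpha)))); rewrite !drop_size_cat //; apply: beta_neq_delta.
have -> : i - size alpha = 0 by clear -le lt; lia.
by rewrite !drop0; apply: beta_neq_delta.
Qed.

Lemma tail_eq_le t t' : t' <= t -> tail_eq t -> tail_eq t'.
Proof.
move=> le [lX lY e]; split; try exact: leq_trans le _.
have -> : size X - t' = (t - t') + (size X - t) by clear -le lX; lia.
have -> : size Y - t' = (t - t') + (size Y - t) by clear -le lY; lia.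
by rewrite -!drop_drop e.
Qed.

(** A common suffix longer than [delta] begins with a suffix of [alpha], which then occurs in [A]
    both at its own place and at the start of the common suffix of [alpha ++ beta]. This keeps the
    cost of [common] within the bound. *)
Lemma tail_alpha t : tail_eq t -> t <= size delta + (size alpha - first_occ A).
Proof.
move=> [lX lY e]; case: (leqP t (size delta)) => le; first exact: leq_trans le (leq_addr _ _).
set i := size Y - t; rewrite size_cat in lY.
have li : i < size alpha by rewrite /i size_cat; clear -le lY; lia.
rewrite -leq_subLR; suff : first_occ A <= i.
  by rewrite /i size_cat; clear -lY le; lia.
rewrite first_occP //; apply: (@occ2I _ _ i (size X - t)).
- exact: drop_alpha_neq0.
- by apply/eqP => e2; rewrite -e2 in e; apply: (drop_XY (ltnW li) e).
- exact: prefix_alpha.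
rewrite catA drop_cat ltn_neqAle leq_subr andbT; case: eqP => [e2|_] /=.
  by exfalso; clear -e2 lX le; lia.
rewrite e -/i; apply: prefix_trans (prefix_prefix _ _); exact: prefix_alpha.
Qed.

(** The common suffix begins with [drop i alpha], and in [alpha ++ delta] it cannot start at [i],
    since [beta] and [delta] differ. This makes the answer of [common] sound. *)
Lemma alpha_pos i t : i < size alpha -> tail_eq t -> t = size alpha - i + size beta ->
  2 <= occ (drop i alpha) B.
Proof.
move=> li [lX lY e] et; have eX : size X - t = i by rewrite size_cat; clear -li et; lia.
rewrite eX in e; apply: (@occ2I _ _ i (size Y - t)).
- exact: drop_alpha_neq0.
- by apply/eqP => e2; rewrite -e2 in e; apply: (drop_XY (ltnW li) e).
- exact: prefix_alpha.
have -> : drop (size Y - t) B = drop (size Y - t) Y ++ gamma.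
  rewrite catA drop_cat; case: ltnP => // h; exfalso; clear -et li h lY; lia.
by rewrite -e; apply: prefix_trans (prefix_prefix _ _); apply: prefix_alpha.
Qed.

Definition added W n1 := forall v, v \in W <-> v \in WA \/ exists2 i, n1 <= i < size Y & v = drop i B.

(** An occurrence starting at or before [i] fits inside [alpha], hence it is also one in [A]. One
    starting later overlaps the end of [alpha], and then [drop k alpha] begins [drop i alpha], so
    that it occurs in [A] at both places. *)
Lemma alpha_in_B k i : i < size alpha -> prefix (drop i alpha) (drop k B) -> k != i -> k < size alpha ->
  2 <= occ (drop i alpha) A \/ (i < k) && (first_occ A <= k).
Proof.
move=> li pk ne lk; case: (leqP k i) => lki.
  left; apply: (@occ2I _ _ i k).
  - exact: drop_alpha_neq0.
  - by rewrite eq_sym.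
  - exact: prefix_alpha.
  have -> : drop k A = drop k alpha ++ (beta ++ gamma).
    by rewrite drop_cat lk.
  have p2 : prefix (drop k alpha) (drop k B) by apply: prefix_alpha.
  apply: prefix_trans (prefix_prefix _ _).
  by apply: (prefix_comparable pk p2); rewrite !size_drop leq_sub2l.
right; rewrite first_occP //; apply: (@occ2I _ _ i k).
- exact: drop_alpha_neq0.
- by rewrite eq_sym.
- have p2 : prefix (drop k alpha) (drop k B) by apply: prefix_alpha.
  apply: prefix_trans (prefix_alpha i _).
  by apply: (prefix_comparable p2 pk); rewrite !size_drop leq_sub2l // ltnW.
exact: prefix_alpha.
Qed.

Lemma drop_gamma k : size Y <= k -> drop k B = drop (size X + (k - size Y)) A.
Proof.
move=> le; rewrite !catA [drop k _]drop_cat ltnNge le /= drop_cat ltnNge leq_addr /=.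
by rewrite addKn.
Qed.

(** For [i] before [n1], an added suffix of [B] beginning with [drop i alpha] gives a second
    occurrence in [B], beside the one at [i]; two words of [WA] give two occurrences in [A]. *)
Lemma two_added_occ W n1 i : added W n1 -> minn (first_occ A) (first_occ B) <= n1 -> i < size alpha ->
  two W (drop i alpha) -> 2 <= occ (drop i alpha) A \/ 2 <= occ (drop i alpha) B.
Proof.
move=> aW le li tw; have un := drop_alpha_neq0 li.
case: (leqP n1 i) => lni.
  have : minn (first_occ A) (first_occ B) <= i := leq_trans le lni.
  by rewrite geq_min !first_occP // => /orP.
have key k : n1 <= k -> prefix (drop i alpha) (drop k B) -> 2 <= occ (drop i alpha) B.
  move=> lk pk; apply: (occ2I un (_ : i != k) (prefix_alpha _ _) pk).
  by rewrite ltn_eqF // (leq_trans lni).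
move/twoP: tw => [v1 [v2 [/aW [h1|[k /andP [k1 k2] ->]] /aW [h2|[k' /andP [k3 k4] e2]] ne p1 p2]]].
- by left; rewrite -two_WA //; apply/twoP; exists v1, v2.
- by right; rewrite e2 in p2; apply: key p2.
- by right; apply: key p1.
- by right; apply: key p1.
Qed.

Lemma occ_two_added W t i : added W (first_occ A) -> tail_eq t -> (forall t', tail_eq t' -> t' <= t) ->
  i < size alpha ->
  two W (drop i alpha) || (size alpha - i + size beta <= t) =
  (2 <= occ (drop i alpha) A) || (2 <= occ (drop i alpha) B).
Proof.
move=> aW te mx li; have un := drop_alpha_neq0 li; apply/idP/idP.
  case/orP=> [tw|le].
    apply/orP; apply: two_added_occ tw => //; exact: geq_minl.
  by apply/orP; right; apply: alpha_pos (tail_eq_le le te) _.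
rewrite -two_WA //; case tA: (two WA _) => /=.
  move=> _; move/twoP: tA => [v1 [v2 [h1 h2 ne p1 p2]]]; apply/orP; left; apply/twoP.
  by exists v1, v2; split=> //; apply/aW; left.
move=> /(occ2P _ un) [k1 [k2 [ltk pk1 pk2]]].
have [k [nk pk]] : exists k, k != i /\ prefix (drop i alpha) (drop k B).
  by case: (eqVneq k1 i) => [e|ne]; [exists k2; split=> //; rewrite -e gtn_eqF | exists k1].
have {}tA : ~ 2 <= occ (drop i alpha) A by rewrite -two_WA // tA.
have ltk' := prefix_drop_size un pk.
(* An occurrence starting within [gamma] is also an occurrence in [A], beside the one at [i]. *)
case: (ltnP k (size Y)) => [lkY|leY]; last first.
  case: tA; rewrite drop_gamma // in pk.
  apply: (occ2I un (_ : i != _) (prefix_alpha _ _) pk).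
  by rewrite ltn_eqF // ltn_addr // size_cat ltn_addr.
have iW : drop i A \in W by apply/aW; left; apply/mem_WA; exists i; rewrite // size_cat ltn_addr.
case: (leqP (first_occ A) k) => lk.
  have kW : drop k B \in W by apply/aW; right; exists k; rewrite ?lk.
  (* Distinct suffixes are two words below [drop i alpha]. If they coincide, cancelling [gamma]
     shows that [drop i X] is a suffix of [Y], so [t] is large enough. *)
  case: (eqVneq (drop i A) (drop k B)) => [e|ne]; apply/orP; [right|left]; last first.
    by apply/twoP; exists (drop i A), (drop k B); split=> //; apply: prefix_alpha.
  apply: mx; have lX : i <= size X by rewrite size_cat ltnW // ltn_addr.
  have eX : drop i A = drop i X ++ gamma.
    by rewrite catA drop_cat size_cat ltn_addr.
  have eY : drop k B = drop k Y ++ gamma by rewrite catA drop_cat lkY.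
  have e2 : drop i X = drop k Y.
    have := congr1 (fun s : word => take (size s - size gamma) s) e.
    by rewrite eX eY !size_cat !addnK !take_size_cat.
  have sz : size X - i = size Y - k by rewrite -!size_drop e2.
  have -> : size alpha - i + size beta = size X - i by rewrite size_cat; clear -li; lia.
  split; rewrite ?leq_subr // ?sz ?leq_subr //.
  by rewrite -{1}sz subKn // subKn // ltnW.
(* The suffix starting at [k] was not inserted; but such an early occurrence lies within reach of
   [alpha_in_B], which yields a repetition in [A]. *)
have lka : k < size alpha := leq_trans lk (first_occ_le A).
case: (alpha_in_B li pk nk lka) => [//|/andP [_ h]].
by rewrite leqNgt lk in h.
Qed.

Lemma alpha_star_added W t : added W (first_occ A) -> closed W -> tail_eq t -> (forall t', tail_eq t' -> t' <= t) ->
  size (alpha_star alpha beta delta gamma) = maxn (size alpha - first_two W) (t - size beta).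
Proof.
move=> aW cl te mx; rewrite size_alpha_star.
have key i : i < size alpha -> (minn (first_occ A) (first_occ B) <= i) =
   (first_two W <= i) || (size alpha - i + size beta <= t).
  by move=> li; rewrite geq_min !first_occP // -(occ_two_added aW te mx li) two_alpha.
have lt : t <= size alpha + size beta by case: te; rewrite size_cat.
have lA := first_occ_le A; have lF := first_two_le W.
set m := minn _ _ in key *; have lm : m <= size alpha by rewrite geq_min lA.
apply/eqP; rewrite eqn_leq; apply/andP; split.
  case: (ltnP m (size alpha)) => h; last by clear -h; lia.
  by have := key _ h; rewrite leqnn => /esym /orP [] h2; clear -h2 lt; lia.
rewrite geq_max; apply/andP; split.
  case: (ltnP (first_two W) (size alpha)) => h; last by clear -h; lia.
  have := key _ h; rewrite leqnn /= => h2; clear -h2 lF; lia.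
case: (leqP t (size beta)) => h; first by clear -h; lia.
have hi : size alpha - (t - size beta) < size alpha by clear -h lt; lia.
have := key _ hi.
have -> : size alpha - (size alpha - (t - size beta)) + size beta <= t by clear -h lt; lia.
by rewrite orbT => h2; clear -h2 h lt lm; lia.
Qed.

Lemma longest_prefix_max (P : pred word) S n : n <= size S -> P (take n S) -> n <= size (longest_prefix P S).
Proof.
move=> le p; rewrite /longest_prefix; set c := map _ _.
have nc i : i <= size S -> nth [::] c i = take (size S - i) S.
  by move=> h; rewrite (nth_map 0) ?size_iota // nth_iota.
have h : find P c <= size S - n.
  rewrite leqNgt; apply/negP => lt; have := before_find [::] lt.
  by rewrite nc ?leq_subr // subKn // p.
by rewrite nc ?(leq_trans h) ?leq_subr // size_takel ?leq_subr //; clear -h le; lia.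
Qed.

Lemma occ_pos u S i : u != [::] -> prefix u (drop i S) -> 0 < occ u S.
Proof.
move=> un p; rewrite /occ -has_count; apply/hasP; exists i => //.
by rewrite mem_iota add0n ltnS /= ltnW //; apply: prefix_drop_size p.
Qed.

(** A matched part reaching beyond [alpha ++ delta] contains [d] followed by a prefix of [gamma].
    The word [v] that it matches supplies another occurrence, in [A] or at a different position of
    [B], so this prefix is no longer than [gamma_hat]. *)
Lemma gamma_hat_bound j e v : j < size Y -> j <= e -> e <= size B ->
  v \in WA \/ (exists2 i, i != j & v = drop i B) -> prefix (sub j e) v ->
  e <= size Y + size (gamma_hat alpha beta delta gamma).
Proof.
move=> lj lje leB hv pv; case: (leqP e (size Y)) => leY; first exact: leq_trans leY (leq_addr _ _).
rewrite -leq_subLR; have [d [Y' eY]] : exists d Y', Y = rcons Y' d.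
  by case/lastP: (alpha ++ delta) lj => // Y' d _; exists d, Y'.
set r := (size Y).-1 - j.
have er : j + r = (size Y).-1 by rewrite /r; clear -lj; lia.
have eu : sub (size Y).-1 e = d :: take (e - size Y) gamma.
  have sY : size Y = (size Y').+1 by rewrite eY size_rcons.
  have -> : (size Y).-1 = size Y' by rewrite sY.
  rewrite /sub; have -> : B = Y' ++ d :: gamma by rewrite catA eY cat_rcons.
  rewrite drop_size_cat //; have -> // : e - size Y' = (e - size Y).+1.
  by clear -leY sY; lia.
have pr : prefix (d :: take (e - size Y) gamma) (drop r v).
  rewrite -eu -er; have := prefix_drop r pv.
  have -> // : drop r (sub j e) = sub (j + r) e.
  rewrite /sub addnC -drop_drop [RHS]take_drop; congr (drop r (take _ _)).
  by clear -er leY lj; lia.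
rewrite /gamma_hat eY rev_rcons /=; apply: longest_prefix_max.
  by rewrite -eY; move: leB; rewrite catA [size (Y ++ _)]size_cat; clear -leY; lia.
rewrite -eY; have pB : prefix (d :: take (e - size Y) gamma) (drop (size Y).-1 B).
  by rewrite -eu -sub_full sub_prefix.
have un : d :: take (e - size Y) gamma != [::] by [].
case: hv => [/mem_WA [p _ ev]|[p np ev]]; rewrite ev drop_drop in pr.
  (* One occurrence in each string is enough, because [gamma_hat] counts both strings together. *)
  have h1 := occ_pos un pr; have h2 := occ_pos un pB.
  by clear -h1 h2; lia.
apply: leq_trans (leq_addl _ _); apply: (occ2I un _ pr pB).
by rewrite -er addnC eqn_add2r.
Qed.

(** * From the stored tree to the invariant and back *)

Lemma suffixE w S : (w != [::]) && suffix w S <-> exists2 i, i < size S & w = drop i S.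
Proof.
split=> [/andP [nw /suffixP [v ->]]|[i lt ->]].
  exists (size v); last by rewrite drop_size_cat.
  by rewrite size_cat -[X in X < _]addn0 ltn_add2l lt0n size_eq0.
by rewrite -size_eq0 size_drop subn_eq0 -ltnNge lt; apply: suffix_drop.
Qed.

Lemma all_cells_pos vs fr : all (fun x : nat => 0 < x < fr) (cells_of rs vs) ->
  forall n, n \in vs -> 0 < n /\ n + rs <= fr.
Proof.
move=> /allP h n hv; have r0 : 0 < rs by [].
have := h _ (mem_cells hv r0); rewrite addn0 => /andP [-> _]; split=> //.
have l : rs.-1 < rs by [].
by have /andP [_] := h _ (mem_cells hv l); rewrite -[rs]prednK // addnS.
Qed.

Lemma string_at_nth m p w : string_at m p w -> forall i, i < size w -> m (p + i) = code (nth hash w i).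
Proof.
move=> h i lt; have := congr1 (fun l : seq nat => nth 0 l i) h.
by rewrite (nth_map 0) ?size_iota // (nth_map hash) // nth_iota.
Qed.

Lemma inv_of_stored t s : stored_string_tree alpha beta delta gamma t s ->
  reg s rA = a0 -> reg s rD = d0 -> reg s rRoot = root -> exists nm, inv (br WA) WA nm None s.
Proof.
case=> -[ht hN hW] [[e2 e3 e4 e5] [sA sD] [uc ac] er [hl hn hs]] ea ed ero.
have arcs_ok : forall w (v : nat) arcs, node_at t (Plain w) (Node v arcs) ->
     [/\ w != [::] -> 2 <= size arcs, uniq [seq first a.1 | a <- arcs] &
         forall l (s : tree Sigma), List.In (l, s) arcs -> exists2 w', l = Plain w' & w' != [::]].
  move=> w v arcs h; have [h1 h2 h3 h4] := hN _ _ _ h; split=> // l [v'|v' arcs'] hin.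
    by have := h4 _ _ hin; case: (l) => // w' /andP [nw _]; exists w'.
  by have [w' -> /andP [nw _]] := h3 _ _ _ hin; exists w'.
have words w : w \in WA <-> exists v : nat, node_at t (Plain w) (Leaf Sigma v).
  split=> [/mem_WA /suffixE h|h]; first exact: (proj1 (hW (Plain w)) h).
  by apply/mem_WA/suffixE; exact: (proj2 (hW (Plain w)) h).
have WA0 : WA != [::].
  by rewrite /WA; have [A' -> _] := hA; rewrite size_rcons.
have uN := cells_uniq (isT : 0 < rs).
have [u1 u2 [u3 [u4 [u5 u6]]]] : [/\ uniq (cells_of rs (names t)),
   all (fun x : nat => 0 < x < reg s rFree) (cells_of rs (names t)) &
   (forall i, i < size A -> a0 + i < reg s rFree) /\
   (forall i, i < size delta -> d0 + i < reg s rFree) /\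
   (forall i, i < size A -> a0 + i \notin cells_of rs (names t)) /\
   (forall i, i < size delta -> d0 + i \notin cells_of rs (names t))].
  rewrite ea ed in uc ac; move: uc ac; rewrite !cat_uniq !all_cat => /and3P [v1 v2 /and3P [v3 v4 v5]].
  move=> /and3P [w1 w2 w3]; split=> //; split; last split; last split.
  - by move=> i li; have := allP w1 (a0 + i); rewrite mem_iota leq_addr ltn_add2l li => /(_ isT) /andP [].
  - by move=> i li; have := allP w2 (d0 + i); rewrite mem_iota leq_addr ltn_add2l li => /(_ isT) /andP [].
  - move=> i li; apply/negP => h; have /hasPn v2' := v2.
    have : a0 + i \in iota a0 (size A) by rewrite mem_iota leq_addr ltn_add2l.
    by apply/negP; apply: v2'; rewrite mem_cat h orbT.
  move=> i li; apply/negP => h; have /hasPn v4' := v4.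
  have : d0 + i \in iota d0 (size delta) by rewrite mem_iota leq_addr ltn_add2l.
  by apply/negP; apply: v4'.
(* Addresses are given only through the relation [node_at], so they are chosen; uniqueness of the
   node at a word makes the choice independent of the witness. *)
pose nm w := ClassicalEpsilon.epsilon (inhabits 0) (fun v : nat => exists2 u : tree Sigma, node_at t (Plain w) u & v = name u).
have nmE w (u : tree Sigma) : node_at t (Plain w) u -> nm w = name u.
  move=> h; rewrite /nm; have [|u' h' ->] := ClassicalEpsilon.epsilon_spec (inhabits 0) (fun v : nat => exists2 u : tree Sigma, node_at t (Plain w) u & v = name u).
    by exists (name u), u.
  by rewrite (node_at_uniq arcs_ok h h').
have nmN z : nd (br WA) WA z -> nm z \in names t.
  move=> /(nd_node_at ht arcs_ok words) [u h]; rewrite (nmE _ _ h).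
  exact: (node_at_names h (names_head u)).
have childE x (v : nat) arcs w (u : tree Sigma) c w' : node_at t (Plain x) (Node v arcs) -> List.In (Plain w, u) arcs ->
   w = c :: w' -> child arcs c = name u.
  by move=> h hin ew; have [_ uf _] := arcs_ok _ _ _ h; apply: (child_in uf hin); rewrite ew.
have apos := all_cells_pos u2.
have off z i : nd (br WA) WA z -> i \notin cells_of rs (names t) -> i < nm z \/ nm z + rs <= i.
  move=> nz ni; case: (ltnP i (nm z)) => l1; [by left|right]; rewrite leqNgt; apply/negP => l2.
  case/negP: ni; rewrite -(subnKC l1); apply: mem_cells; first exact: nmN.
  by clear -l1 l2; lia.
exists nm; split.
- by split.
- by split; move=> i li; [rewrite -ea; apply: (string_at_nth sA) | rewrite -ed; apply: (string_at_nth sD)].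
- split.
  + by move=> w /words [v h]; rewrite (nmE _ _ h); apply: hl h.
  + move=> x /(br_node_at ht arcs_ok words) [v [arcs h]]; rewrite (nmE _ _ h).
    by case: (hn _ _ _ h).
  + move=> x y /(edge_arc ht arcs_ok words WA0) [v [arcs [w [u [h1 h2 h3 h4 h5]]]]].
    rewrite (nmE _ _ h1) (nmE _ _ h5) /=; have [_ -> _] := hn _ _ _ h1.
    case: w h2 h3 h4 => // c w h2 h3 _; apply: (childE _ _ _ _ _ _ w h1 h2).
    by rewrite h3 nth_cat ltnn subnn.
  + move=> x c /(br_node_at ht arcs_ok words) [v [arcs h]] np; rewrite (nmE _ _ h) /=.
    have [_ -> _] := hn _ _ _ h; apply: child_null => l u hin el.
    have [_ _ /(_ _ _ hin) [w ew nw]] := arcs_ok _ _ _ h.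
    rewrite ew in hin el; case: w nw hin el {ew} => // d w _ hin [ed'].
    have [z zW pz] := leaf_below arcs_ok words WA0 (AtChild h hin).
    case/negP: np; apply/preP; exists z => //; apply: prefix_trans pz.
    by rewrite -ed' -cat_rcons prefix_prefix.
  + move=> x y /(edge_arc ht arcs_ok words WA0) [v [arcs [w [u [h1 h2 h3 h4 h5]]]]] yW.
    have /words [v' hy] := yW; have eu := node_at_uniq arcs_ok h5 hy.
    have [_ _ /(_ _ _ h2)] := hn _ _ _ h1; rewrite /label_at eu => -[S eS [ew]].
    have := eS; rewrite (nmE _ _ h5) eu /=; case: (mem s (v' + 1)) => [|[|n]] // [eSA].
    have /mem_WA [p lp ey] := yW.
    exists A, p; split=> //.
    have lx : size x < size y by rewrite h3 size_cat -[X in X < _]addn0 ltn_add2l lt0n size_eq0.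
    have : drop (size x) y = w by rewrite h3 drop_size_cat.
    rewrite ew -eSA ey drop_drop => /(congr1 (@size Sigma)); rewrite !size_drop.
    move: lx; rewrite ey size_drop; clear; lia.
  + move=> x y /(edge_arc ht arcs_ok words WA0) [v [arcs [w [u [h1 h2 h3 h4 h5]]]]] /(br_node_at ht arcs_ok words).
    move=> [v' [arcs' hy]]; have eu := node_at_uniq arcs_ok h5 hy.
    have [_ _ /(_ _ _ h2)] := hn _ _ _ h1; rewrite /label_at eu => -[S eS [lj [ew]]].
    rewrite (nmE _ _ h5) eu /=; exists S; split=> //.
      by move: eS; case: (mem s _) => [|[]].
    by rewrite h3 drop_size_cat.
  + move=> c w /(br_node_at ht arcs_ok words) [v [arcs h]] _.
    have [v' [arcs' [h' e]]] := hs _ _ _ _ h; rewrite (nmE _ _ h) (nmE _ _ h') /=; split=> //.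
    exact: (node_at_br arcs_ok words WA0 h').
  + by move=> z nz; apply: apos; apply: nmN.
  + move=> z z' nz nz' ne; apply: (cells_dis (isT : 0 < rs) u1 (nmN _ nz) (nmN _ nz')).
    move=> e; have [u h] := nd_node_at ht arcs_ok words nz.
    have [u' h'] := nd_node_at ht arcs_ok words nz'.
    rewrite (nmE _ _ h) (nmE _ _ h') in e.
    by have [[ez] _] := node_at_inj (uN _ u1) h h' e.
  + by move=> z i nz li; apply: off => //; apply: u5.
  + by move=> z i nz li; apply: off => //; apply: u6.
  + exact: u3.
  + exact: u4.
- by split; [apply: WA_hterm | apply: goodN_br; apply: WA_hterm].
by rewrite (nmE _ _ (AtRoot t)) -er.
Qed.

Hypothesis hgamma : gamma != [::].

(** * The alignment tree read off the final memory *)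

Section Build.
Variables (W : seq word) (nm : word -> nat) (s : state) (k : nat).
Notation m := (mem s).
Notation N := (br W).
Hypotheses (Is : inv (br W) W nm None s) (aW : added W k)
  (ek : k = minn (first_occ A) (first_occ B)).

Lemma build_hterm : hterm hash W. Proof. by case: Is => _ _ _ []. Qed.
Lemma build_good : goodN N W. Proof. by case: Is => _ _ _ []. Qed.
Lemma build_rep : rep N W nm m (reg s rFree) None. Proof. by case: Is. Qed.

Lemma k_le : k <= size alpha.
Proof. by rewrite ek geq_min first_occ_le. Qed.

(** Two words sharing [drop p alpha] would mean a repetition in [A] or in [B], against the choice of
    [k]. Hence the leaf of such a suffix hangs from a node within [alpha]. *)
Lemma single p u : p < k -> prefix (drop p alpha) u -> two W u -> False.
Proof.
move=> lp pu /(two_prefix pu) tw; have lpa := leq_trans lp k_le.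
have := two_added_occ aW _ lpa tw; rewrite ek leqnn => /(_ isT) h.
have : k <= p by rewrite ek geq_min !first_occP //; apply/orP.
by rewrite leqNgt lp.
Qed.

(** Equality at the same position would identify [beta] with [delta]; at different positions it
    would repeat [drop p alpha] in [B]. *)
Lemma suffixes_neq p q : p < k -> drop p A <> drop q B.
Proof.
move=> lp e; have lpa := leq_trans lp k_le; case: (eqVneq q p) => [eq|ne].
  have : drop p X = drop p Y.
    have := congr1 (fun v : word => take (size v - size gamma) v) e.
    rewrite eq !catA ![drop p (_ ++ gamma)]drop_cat !size_cat !ltn_addr // !size_cat !addnK !take_size_cat //.
  exact: drop_XY (ltnW lpa).
have : k <= p.
  rewrite ek geq_min !first_occP // orbC; apply/orP; left.
  apply: (occ2I (drop_alpha_neq0 lpa) ne _ (prefix_alpha _ _)).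
  by rewrite -e prefix_alpha.
by rewrite leqNgt lp.
Qed.

Lemma suffixes_neq' p q : p < k -> drop p B <> drop q A.
Proof.
move=> lp e; have lpa := leq_trans lp k_le; case: (eqVneq q p) => [eq|ne].
  by apply: (@suffixes_neq p p lp); rewrite e eq.
have : k <= p.
  rewrite ek geq_min !first_occP //; apply/orP; left.
  apply: (occ2I (drop_alpha_neq0 lpa) ne _ (prefix_alpha _ _)).
  by rewrite -e prefix_alpha.
by rewrite leqNgt lp.
Qed.

(** From [k] on, the suffixes of both strings are words, and they fork right after [alpha] by the
    condition on first characters. So no arc to such a leaf starts within the [alpha] part, and
    [dec_alignment] reads its label as a plain string. *)
Lemma br_alpha p : k <= p -> p < size alpha -> br W (drop p alpha).
Proof.
move=> lp lpa; apply/brP; right.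
have [c1 [u1 e1]] : exists c1 u1, beta ++ gamma = c1 :: u1.
  by case: (beta) => [|c u]; [case: (gamma) hgamma => // c u _; exists c, u | exists c, (u ++ gamma)].
have [c2 [u2 e2]] : exists c2 u2, delta ++ gamma = c2 :: u2.
  by case: (delta) => [|c u]; [case: (gamma) hgamma => // c u _; exists c, u | exists c, (u ++ gamma)].
have ne : c1 != c2 by move: hfirst; rewrite e1 e2 /=; apply: contra => /eqP ->.
exists c1, c2; split=> //; apply/preP.
  exists (drop p A); last by rewrite drop_cat lpa e1 -cat_rcons prefix_prefix.
  by apply/aW; left; apply/mem_WA; exists p; rewrite // size_cat ltn_addr.
exists (drop p B); last by rewrite drop_cat lpa e2 -cat_rcons prefix_prefix.
by apply/aW; right; exists p; rewrite // lp size_cat ltn_addr.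
Qed.

Definition label x y : asuffix Sigma :=
  if y \in W then dec_alignment alpha (nth A [:: A; B] (m (nm y + 1))) (m (nm y + 2))
  else Plain (drop (size x) y).

(** The words whose leaves stand for plain a-suffixes; the other words are the suffixes of [A]
    starting before [k]. *)
Definition late y := (exists2 q, k <= q & y = drop q A) \/ (exists2 q, k <= q < size Y & y = drop q B).

Lemma late_neq p y : p < k -> y = drop p A -> late y -> False.
Proof.
move=> lp -> [[q lq e]|[q _ e]]; last exact: (@suffixes_neq p q lp e).
have := congr1 (@size Sigma) e; rewrite !size_drop; have := k_le.
have : size alpha < size A.
  by rewrite !size_cat; case: (gamma) hgamma => //= ? ? _; clear; lia.
by clear -lp lq; lia.
Qed.

Lemma edge_deep x y p : edge N W x y -> k <= p -> p < size alpha -> prefix (drop p alpha) y ->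
  size alpha - p < size y -> size alpha - p <= size x.
Proof.
move=> [_ ny px lt bt] lp lpa pa ly; rewrite leqNgt; apply/negP => lx.
have e := bt (drop p alpha); rewrite /nd br_alpha // size_drop in e.
by move: ly; rewrite -(e isT pa lx) size_drop ltnn.
Qed.

Variant label_spec x y : Prop :=
| LabelPlain of label x y = Plain (drop (size x) y) & late y
   & suffix (drop (size x) y) (beta ++ gamma) || suffix (drop (size x) y) (delta ++ gamma)
| LabelAligned p of p < k & p + size x < size alpha & y = drop p A
   & x = take (size x) (drop p alpha) & label x y = Aligned (drop (p + size x) alpha).

Lemma labelP x y : edge N W x y -> y \in W -> label_spec x y.
Proof.
move=> ed yW; have R := build_rep; have [_ ny px lxy bt] := ed.
have [S [p [eS ey ei]]] := r_lleaf R ed yW.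
have eS' : nth A [:: A; B] (m (nm y + 1)) = S by move: eS; case: (m _) => [|[|[]]] //= [].
have lp : p < size S by move: lxy; rewrite ey size_drop; clear; lia.
have plain : size alpha <= p + size x -> label x y = Plain (drop (size x) y).
  by move=> le; rewrite /label yW eS' ei /dec_alignment ltnNge le /= ey drop_drop addnC.
have dy : drop (size x) y = drop (p + size x) S by rewrite ey drop_drop addnC.
have sA : S = A \/ S = B by move: eS; case: (m _) => [|[|[]]] //= [->]; [left|right].
(* From [k] on the end of [alpha] is a node, so the terminal arc starts there or later. *)
have deep : k <= p -> size alpha <= p + size x.
  move=> kp; case: (leqP (size alpha) p) => [h|lpa]; first exact: leq_trans h (leq_addr _ _).
  rewrite -leq_subLR; apply: (edge_deep ed kp lpa).
    by rewrite ey; case: sA => ->; apply: prefix_alpha.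
  rewrite ey size_drop; case: sA => ->; rewrite size_cat;
    have : 0 < size gamma by [rewrite lt0n size_eq0].
  - by rewrite size_cat; clear -lpa; lia.
  - by rewrite size_cat; clear -lpa; lia.
case: sA => eS2.
  case: (leqP k p) => kp.
    have le := deep kp; apply: LabelPlain; first exact: plain.
      by left; exists p; rewrite // ey eS2.
    rewrite dy eS2 drop_cat ltnNge le /=; apply/orP; left; exact: suffix_drop.
  have lpa := leq_trans kp k_le.
  (* A parent reaching the end of [alpha] would be branching, hence shared by two words, which
     [single] excludes. *)
  have lt : p + size x < size alpha.
    rewrite ltnNge; apply/negP => le.
    have nx : x != [::] by rewrite -size_eq0; apply/eqP => e; move: le lpa; rewrite e; clear; lia.
    have [Nx _ _ _ _] := ed; apply: (single kp) (br_two Nx nx).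
    apply: (prefix_comparable _ px); first by rewrite ey eS2 prefix_alpha.
    by rewrite size_drop leq_subLR.
  apply: (LabelAligned kp lt); first by rewrite ey eS2.
    have pa : prefix (drop p alpha) y by rewrite ey eS2 prefix_alpha.
    have : prefix x (drop p alpha) by apply: (prefix_comparable px pa); rewrite size_drop; clear -lt; lia.
    by rewrite prefixE => /eqP.
  by rewrite /label yW ei /dec_alignment lt.
(* A leaf labelled through [B] cannot start before [k]: such a suffix of [B] is no suffix of [A],
   and it is longer than all the inserted ones. *)
have kp : k <= p.
  rewrite leqNgt; apply/negP => kp; rewrite eS2 in ey lp.
  have /aW [/mem_WA [q _ e]|[q /andP [q1 q2] e]] := yW.
    by apply: (@suffixes_neq' p q kp); rewrite -ey.
  have lq : q < size B by rewrite catA size_cat ltn_addr.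
  have := congr1 (@size Sigma) e; rewrite ey !size_drop; clear -kp q1 lp lq; lia.
have le := deep kp; apply: LabelPlain; first exact: plain.
  rewrite eS2 in ey; case: (ltnP p (size Y)) => h.
    by right; exists p; rewrite ?kp.
  left; exists (size X + (p - size Y)); last by rewrite -drop_gamma.
  by apply: leq_trans k_le _; rewrite size_cat -addnA leq_addr.
by rewrite dy eS2 [drop _ B]drop_cat ltnNge le /= suffix_drop orbT.
Qed.

Definition down x c : word := ClassicalEpsilon.epsilon (inhabits [::])
  (fun y => edge N W x y /\ prefix (rcons x c) y).

Lemma downP x c : N x -> pre W (rcons x c) -> edge N W x (down x c) /\ prefix (rcons x c) (down x c).
Proof.
move=> Nx p; apply: (ClassicalEpsilon.epsilon_spec (inhabits [::]) (fun y => edge N W x y /\ prefix (rcons x c) y)).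
by have [y h1 h2] := edge_ex Nx p; exists y.
Qed.

Definition children x := [seq down x c | c <- enum [pred c | pre W (rcons x c)]].

Lemma mem_children x y : N x -> y \in children x <-> edge N W x y.
Proof.
move=> Nx; split=> [/mapP [c]|ed]; first by rewrite mem_enum inE => p ->; have [] := downP Nx p.
have [_ ny px lxy _] := ed; have pc := prefix_next hash px lxy.
have pr := pre_prefix pc (edge_pre build_good ed).
apply/mapP; exists (nth hash y (size x)); first by rewrite mem_enum inE.
have [ed' pc'] := downP Nx pr.
exact: (edge_uniq build_hterm build_good ed ed' pc pc').
Qed.

Lemma children_uniq x : N x -> uniq (children x).
Proof.
move=> Nx; rewrite map_inj_in_uniq ?enum_uniq // => c d; rewrite !mem_enum !inE => pc pd e.
have [_ h1] := downP Nx pc; have [_ h2] := downP Nx pd; rewrite -e in h2.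
exact: prefix_rcons_inj h1 h2.
Qed.

Definition height : nat := foldr maxn 0 (map size W).

Lemma height_word v : v \in W -> size v <= height.
Proof.
rewrite /height; elim: (W) => //= w V IH; rewrite inE => /orP [/eqP ->|/IH h].
  exact: leq_maxl.
exact: leq_trans h (leq_maxr _ _).
Qed.

Lemma height_pre v : pre W v -> size v <= height.
Proof. by move=> /preP [w wW /size_pfx h]; apply: leq_trans h (height_word wW). Qed.

(** The children are obtained by choice, so the recursion is on a bound for the remaining depth.
    With the initial value taken in [build] it does not run out at a node. *)
Fixpoint build_rec n x : tree Sigma :=
  if x \in W then Leaf Sigma (nm x) else
  if n is n'.+1 then Node (nm x) [seq (label x y, build_rec n' y) | y <- children x]
  else Leaf Sigma (nm x).

Definition build x := build_rec (height - size x).+1 x.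

Lemma build_rec_eq n x : nd N W x -> height - size x < n -> build_rec n x = build x.
Proof.
rewrite /build; have [h] := ubnP (height - size x); elim: h n x => // h IH n x lh nx.
case: n => // n ln /=; case: ifP => xW //.
have Nx : N x by move: nx; rewrite /nd xW orbF.
congr (Node _ _); apply/eq_in_map => y /(mem_children _ Nx) ed; congr pair.
have ny : nd N W y by case: ed.
have ly : size y <= height by apply/height_pre/(edge_pre build_good ed).
have lxy : size x < size y by case: ed.
have l3 : height - size y < height - size x by exact: ltn_sub2l (leq_trans lxy ly) lxy.
have l1 := leq_trans l3 lh; have l2 := leq_trans l3 ln.
by rewrite (IH n) ?(IH (height - size x)).
Qed.

Lemma build_leaf y : y \in W -> build y = Leaf Sigma (nm y).
Proof. by move=> yW; rewrite /build /= yW. Qed.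

Lemma build_node x : N x -> build x = Node (nm x) [seq (label x y, build y) | y <- children x].
Proof.
move=> Nx; have xW : x \in W = false by apply/negbTE/(br_notin build_hterm Nx).
rewrite {1}/build /= xW; congr (Node _ _); apply/eq_in_map => y /(mem_children _ Nx) ed; congr pair.
have ny : nd N W y by case: ed.
have ly : size y <= height by apply/height_pre/(edge_pre build_good ed).
have lxy : size x < size y by case: ed.
by apply: build_rec_eq => //; exact: ltn_sub2l (leq_trans lxy ly) lxy.
Qed.

Lemma name_build x : name (build x) = nm x.
Proof. by rewrite /build /=; case: ifP. Qed.

Lemma in_map_children x l (u : tree Sigma) : List.In (l, u) [seq (label x y, build y) | y <- children x] <->
  exists y, [/\ y \in children x, l = label x y & u = build y].
Proof.
elim: (children x) => /= [|z zs IH]; first by split=> // [[y []]].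
split=> [[[<- <-]|/IH [y [h1 h2 h3]]]|[y []]].
- by exists z; rewrite inE eqxx.
- by exists y; rewrite inE h1 orbT.
rewrite inE => /orP [/eqP ->|h] el eu; first by left; rewrite el eu.
by right; apply/IH; exists y.
Qed.

Let t := build [::].

Lemma root_N : N [::]. Proof. exact: goodN0 build_good. Qed.

Lemma extend_label x y : edge N W x y -> N y -> extend x (label x y) = Plain y.
Proof.
move=> [_ _ px _ _] Ny; rewrite /label (negbTE (br_notin build_hterm Ny)) /=; congr Plain.
by case/prefixP: px => v ->; rewrite drop_size_cat.
Qed.

Lemma build_node_at l (u : tree Sigma) : node_at t l u ->
  (exists x, [/\ N x, l = Plain x & u = build x]) \/
  exists x y, [/\ edge N W x y, y \in W, l = extend x (label x y) & u = Leaf Sigma (nm y)].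
Proof.
elim=> [|w v arcs l0 u0 _ IH hin]; first by left; exists [::]; split=> //; exact: root_N.
case: IH => [[x [Nx [ew] eu]]|[x [y [_ _ _ eu]]]] //.
move: eu; rewrite build_node // => -[_ ea]; rewrite ea in hin.
have /in_map_children [y [/(mem_children _ Nx) ed -> ->]] := hin; rewrite ew.
have [_ /orP [Ny|yW] _ _ _] := ed; [left|right].
  by exists y; rewrite extend_label.
by exists x, y; rewrite build_leaf.
Qed.

Lemma node_at_build x : N x -> node_at t (Plain x) (build x).
Proof.
have [n] := ubnP (size x); elim: n x => // n IH x lt Nx; case: (eqVneq x [::]) => [->|nx].
  exact: AtRoot.
have ndx : nd N W x by rewrite /nd Nx.
have [p ed] := parent_ex build_hterm build_good ndx nx; have [Np _ _ lp _] := ed.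
have h := IH p (leq_trans lp lt) Np; rewrite build_node // in h.
rewrite -(extend_label ed Nx); apply: (AtChild h).
by apply/in_map_children; exists x; split=> //; apply/(mem_children _ Np).
Qed.

Lemma node_at_leaf x y : edge N W x y -> y \in W -> node_at t (extend x (label x y)) (Leaf Sigma (nm y)).
Proof.
move=> ed yW; have [Nx _ _ _ _] := ed; have h := node_at_build Nx; rewrite build_node // in h.
apply: (AtChild h); apply/in_map_children; exists y; split; rewrite ?build_leaf //.
exact/(mem_children _ Nx).
Qed.

Lemma onthS (n : nat) (S : word) : onth [:: A; B] n = Some S -> S = A \/ S = B.
Proof. by case: n => [|[|[|n]]] //= [->]; [left|right]. Qed.

Lemma ohead_drop n (v : word) : n < size v -> ohead (drop n v) = Some (nth hash v n).
Proof. by move=> lt; rewrite (drop_nth hash lt). Qed.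

Lemma first_label x y : edge N W x y -> first (label x y) = Some (nth hash y (size x)).
Proof.
move=> ed; have [_ _ _ lxy _] := ed; case yW: (y \in W); last first.
  by rewrite /label yW /= ohead_drop.
case: (labelP ed yW) => [-> _ _|p lp lt ey _ ->] /=; rewrite ohead_drop //.
by rewrite ey nth_drop nth_cat lt.
Qed.

Notation arcs_of x := [seq (label x y, build y) | y <- children x].

Lemma arcs_first x : N x -> uniq [seq first (a : asuffix Sigma * tree Sigma).1 | a <- arcs_of x].
Proof.
move=> Nx; rewrite -map_comp map_inj_in_uniq ?children_uniq // => y z.
move=> /(mem_children _ Nx) ey /(mem_children _ Nx) ez /=; rewrite !first_label // => -[e].
have [_ _ py ly _] := ey; have [_ _ pz lz _] := ez.
apply: (edge_uniq build_hterm build_good ey ez (prefix_next hash py ly)).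
by rewrite e; apply: prefix_next.
Qed.

Lemma size_arcs x : N x -> x != [::] -> 2 <= size (arcs_of x).
Proof. by rewrite !size_map -cardE /br => /orP [->|]. Qed.

(** One arc begins with [hash], another with the first character of [A], unless [A] is [hash] alone.
    In that case [alpha] and [beta] are empty, and the first character of the nonempty [delta]
    differs from [hash]. *)
Lemma root_arcs : 2 <= size (arcs_of [::]).
Proof.
rewrite !size_map -cardE; apply/card_gt1P; have [A' eA nA] := hA.
have inW i : i < size A -> drop i A \in W by move=> lt; apply/aW; left; apply/mem_WA; exists i.
have hashW : pre W [:: hash].
  apply/preP; exists (drop (size A') A); first by apply: inW; rewrite eA size_rcons.
  by rewrite eA -cats1 drop_size_cat ?prefix_refl.
suff [c nc pc] : exists2 c, c != hash & pre W [:: c] by exists c, hash.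
case: A' eA nA => [|c A'] eA nA.
  have ea : alpha = [::] by case: (alpha) eA => // c [|? ?] //; case: (beta) => //; case: (gamma) hgamma.
  have eb : beta = [::] by move: eA; rewrite ea; case: (beta) => // c [|? ?] //; case: (gamma) hgamma.
  have [d [v ed]] : exists d v, delta = d :: v.
    by case: (delta) beta_neq_delta; rewrite eb // => d v _; exists d, v.
  have [B' eB nB] := hB; exists d.
    apply: contra nB => /eqP dh; move: eB; rewrite ea ed dh /=.
    case: B' => [|b B'] /= [] => [|-> _]; last by rewrite inE eqxx.
    by case: (v) => //; case: (gamma) hgamma.
  apply/preP; exists B; last by rewrite ea ed /= eqxx prefix0s.
  have k0 : k = 0 by move: k_le; rewrite ea; case: (k).
  by apply/aW; right; exists 0; rewrite ?drop0 // k0 ed size_cat addnS.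
exists c; first by apply: contra nA => /eqP ->; rewrite inE eqxx.
apply/preP; exists A; last by rewrite eA /= eqxx prefix0s.
by rewrite -[X in X \in _]drop0; apply: inW; rewrite eA.
Qed.

Lemma inner_label x y : edge N W x y -> N y ->
  exists2 w, label x y = Plain w & (w != [::]) && (infix w A || infix w B).
Proof.
move=> ed Ny; have [_ _ _ lxy _] := ed; exists (drop (size x) y).
  by rewrite /label (negbTE (br_notin build_hterm Ny)).
rewrite -size_eq0 size_drop subn_eq0 -ltnNge lxy /=.
have [S [/onthS eS _ ->]] := r_lint build_rep ed Ny.
have h : infix (take (m (nm y + 3) - m (nm y + 2)) (drop (m (nm y + 2)) S)) S.
  apply/infixP; exists (take (m (nm y + 2)) S), (drop (m (nm y + 3) - m (nm y + 2)) (drop (m (nm y + 2)) S)).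
  by rewrite cat_take_drop cat_take_drop.
by case: eS h => -> ->; rewrite ?orbT.
Qed.

Lemma node_at_inner w (v : nat) arcs : node_at t (Plain w) (Node v arcs) ->
  [/\ N w, v = nm w & arcs = arcs_of w].
Proof.
by move/build_node_at => [[x [Nx [->] e]]|[x [y [_ _ _ //]]]]; move: e; rewrite build_node // => -[-> ->].
Qed.

Lemma in_arcs x l (u : tree Sigma) : N x -> List.In (l, u) (arcs_of x) ->
  exists y, [/\ edge N W x y, l = label x y, u = build y &
    (N y /\ u = Node (nm y) (arcs_of y)) \/ (y \in W /\ u = Leaf Sigma (nm y))].
Proof.
move=> Nx /in_map_children [y [/(mem_children _ Nx) ed -> ->]]; exists y; split=> //.
have [_ /orP [Ny|yW] _ _ _] := ed; [left|right]; split=> //; [exact: build_node|exact: build_leaf].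
Qed.

Lemma late_in v : late v -> v != [::] -> v \in W.
Proof.
case=> [[q _ ->] nv|[q lq ->] _]; apply/aW; [left; apply/mem_WA|right]; exists q => //.
by move: nv; rewrite -size_eq0 size_drop subn_eq0 -ltnNge.
Qed.

Lemma leaf_words l : (exists v : nat, node_at t l (Leaf Sigma v)) <->
  (exists2 y, (y != [::]) && (y \in W) & late y /\ l = Plain y) \/ (exists2 p, p < k & l = Aligned (drop p alpha)).
Proof.
have at_leaf y : y \in W -> y != [::] -> exists x, edge N W x y /\ node_at t (extend x (label x y)) (Leaf Sigma (nm y)).
  move=> yW ny; have [|x ed] := @parent_ex _ hash N W build_hterm build_good y _ ny; first by rewrite /nd yW orbT.
  by exists x; split=> //; apply: node_at_leaf.
split=> [[v /build_node_at [[x [Nx _]]|[x [y [ed yW el _]]]]]|[[y /andP [ny yW] [ly ->]]|[p lp ->]]].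
- by rewrite build_node.
- have [_ _ /prefixP [z ez] lxy _] := ed; have := labelP ed yW.
  case=> [e ly _|p lp lt ey ex e]; [left|right].
    exists y; first by rewrite yW andbT; case: (y) lxy.
    by rewrite el e /= {2 3}ez drop_size_cat // -ez.
  exists p => //; rewrite el e /= {1}ex addnC -drop_drop; congr Aligned; exact: cat_take_drop.
- have [x [ed h]] := at_leaf y yW ny; exists (nm y); move: h.
  have [_ _ /prefixP [z ez] _ _] := ed; case: (labelP ed yW) => [-> _ _|p lp _ ey _ _].
    by rewrite /= {1}ez drop_size_cat // -ez.
  by case: (late_neq lp ey ly).
have lpA : p < size A by rewrite size_cat ltn_addr // (leq_trans lp k_le).
have yW : drop p A \in W by apply/aW; left; apply/mem_WA; exists p.
have ny : drop p A != [::] by rewrite -size_eq0 size_drop subn_eq0 -ltnNge.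
have [x [ed h]] := at_leaf _ yW ny; exists (nm (drop p A)); move: h.
case: (labelP ed yW) => [_ ly _|q lq _ ey ex ->]; first by case: (late_neq lp erefl ly).
suff -> : p = q by rewrite /= {1}ex addnC -drop_drop cat_take_drop.
have := congr1 (@size Sigma) ey; rewrite !size_drop; have := k_le.
have : size alpha <= size A by rewrite size_cat leq_addr.
clear -lpA lq; lia.
Qed.

Lemma suffix_dropE (v S : word) : suffix v S -> v = drop (size S - size v) S.
Proof. by case/suffixP => z ->; rewrite size_cat addnK drop_size_cat. Qed.

Lemma alpha_rep_suffix S : suffix (alpha_rep alpha S) alpha.
Proof.
rewrite /alpha_rep /longest_suffix; set c := map _ _; set j := find _ _.
case: (ltnP j (size c)) => h; last by rewrite nth_default ?suffix0s.
by have /mapP [i _ ->] := mem_nth [::] h; apply: suffix_drop.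
Qed.

Lemma alpha_starE : alpha_star alpha beta delta gamma = drop k alpha.
Proof.
have h : suffix (alpha_star alpha beta delta gamma) alpha.
  by rewrite /alpha_star; case: ifP => _; apply: alpha_rep_suffix.
rewrite (suffix_dropE h) size_alpha_star -ek subKn //; exact: k_le.
Qed.

Lemma is_asuffix_plain w : is_asuffix alpha beta delta gamma (Plain w) <->
  (w != [::]) && (w \in W) /\ late w.
Proof.
rewrite /is_asuffix alpha_starE.
have dA : drop k alpha ++ beta ++ gamma = drop k A.
  by rewrite drop_cat; case: ltnP => // le; rewrite (eqP (_ : k == size alpha)) ?eqn_leq ?k_le // drop_size subnn drop0.
have dB : drop k alpha ++ delta ++ gamma = drop k B.
  by rewrite drop_cat; case: ltnP => // le; rewrite (eqP (_ : k == size alpha)) ?eqn_leq ?k_le // drop_size subnn drop0.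
rewrite dA dB; split.
  move=> /andP [nw h]; have lw : late w; last by rewrite nw (late_in lw nw).
  case/or3P: h => [h|/andP [h _]|/andP [h lt]].
  - left; exists (size X + (size gamma - size w)); first by rewrite size_cat -addnA (leq_trans k_le) ?leq_addr.
    by rewrite catA drop_cat ltnNge leq_addr addKn /=; apply: suffix_dropE.
  - left; exists (k + (size (drop k A) - size w)); first exact: leq_addr.
    by rewrite addnC -drop_drop; apply: suffix_dropE.
  have [q lq e] : exists2 q, k <= q & w = drop q B.
    exists (k + (size (drop k B) - size w)); first exact: leq_addr.
    by rewrite addnC -drop_drop; apply: suffix_dropE.
  right; exists q => //; rewrite lq /= ltnNge; apply/negP => le.
  by move: lt; rewrite e size_drop catA size_cat; clear -le; lia.
case=> /andP [nw _] lw; rewrite nw /=.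
have gs : forall q S, w = drop q (S ++ gamma) -> size S <= q -> suffix w gamma.
  by move=> q S -> le; rewrite drop_cat ltnNge le; apply: suffix_drop.
have gt : forall q (S : word), w = drop q (S ++ gamma) -> q < size S -> size gamma < size w.
  by move=> q S -> lt; rewrite size_drop size_cat; clear -lt; lia.
have sf : forall q S, k <= q -> w = drop q S -> suffix w (drop k S).
  by move=> q S lq ->; rewrite -{1}(subnK lq) -drop_drop suffix_drop.
case: lw => [[q lq e]|[q /andP [lq lt] e]].
  case: (ltnP q (size X)) => h; last by rewrite (@gs q X) // e catA.
  rewrite (@gt q X) //; last by rewrite e catA.
  by rewrite (sf _ _ lq e) orbT.
rewrite (@gt q Y) //; last by rewrite e catA.
by rewrite (sf _ _ lq e) !orbT.
Qed.

Lemma is_asuffix_aligned w : is_asuffix alpha beta delta gamma (Aligned w) <->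
  exists2 p, p < k & w = drop p alpha.
Proof.
have lk := k_le; rewrite /is_asuffix alpha_starE size_drop; split=> [/andP [h lt]|[p lp ->]].
  exists (size alpha - size w); last exact: suffix_dropE.
  by rewrite ltn_subCl // size_suffix.
by rewrite suffix_drop size_drop; apply: ltn_sub2l => //; apply: leq_trans lk.
Qed.

Lemma asuffix_words l : is_asuffix alpha beta delta gamma l <-> exists v : nat, node_at t l (Leaf Sigma v).
Proof.
rewrite leaf_words; case: l => w; rewrite ?is_asuffix_plain ?is_asuffix_aligned.
  split=> [[h lw]|[[y h [ly [->]]]|[]//]]; [left; by exists w | by []].
by split=> [[p lp ->]|[[y _ [_ //]]|[p lp [->]]]]; [right|]; exists p.
Qed.

Lemma build_trie : alignment_suffix_tree alpha beta delta gamma t.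
Proof.
split; last first.
  by move=> v arcs; rewrite /t (build_node root_N) => -[_ <-]; apply: root_arcs.
split; last exact: asuffix_words.
  by exists (nm [::]), (arcs_of [::]); apply: build_node root_N.
move=> w v arcs /node_at_inner [Nw _ ->]; split.
- exact: size_arcs.
- exact: arcs_first.
- move=> l v' arcs' /(in_arcs Nw) [y [ed -> _ [[Ny _]|[_ //]]]]; exact: inner_label.
move=> l v' /(in_arcs Nw) [y [ed -> _ [[_ //]|[yW _]]]].
have [_ _ _ lxy _] := ed; case: (labelP ed yW) => [-> _ h|p lp lt ey ex ->] /=.
  by rewrite h andbT -size_eq0 size_drop subn_eq0 -ltnNge.
by rewrite suffix_drop andbT -size_eq0 size_drop subn_eq0 -ltnNge.
Qed.

Lemma build_tree_at : tree_at [:: A; B] (dec_alignment alpha) m t.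
Proof.
have R := build_rep; split.
- move=> x v /build_node_at [[y [Ny _]]|[y [z [_ zW _ [->]]]]]; first by rewrite build_node.
  exact: (r_leaf R).
- move=> l v arcs /build_node_at [[x [Nx _]]|[y [z [_ _ _ //]]]].
  rewrite build_node // => -[-> ->]; split; first exact: (r_int R).
    move=> c; case pc: (pre W (rcons x c)).
      have [ed pd] := downP Nx pc; have [_ _ _ lt _] := ed.
      have e : nth hash (down x c) (size x) = c.
        by rewrite (nth_prefix hash pd) ?size_rcons // nth_rcons ltnn eqxx.
      have hin : List.In (label x (down x c), build (down x c)) (arcs_of x).
        by apply/in_map_children; exists (down x c); split=> //; apply/mem_children.
      rewrite (child_in (arcs_first Nx) hin) ?first_label ?e // name_build.
      by rewrite -(r_child R ed) e.
    rewrite (r_null R Nx) ?pc // child_null // => l' u /(in_arcs Nx) [y [ed -> _ _]].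
    rewrite first_label // => -[e]; have [_ _ px lt _] := ed.
    by rewrite -e (pre_prefix (prefix_next hash px lt) (edge_pre build_good ed)) in pc.
  move=> l' u /(in_arcs Nx) [y [ed -> _ [[Ny ->]|[yW ->]]]].
    have [S [eS le eq]] := r_lint R ed Ny; exists S => //=; split=> //.
    by rewrite -eq /label (negbTE (br_notin build_hterm Ny)).
  have [S [p [eS _ _]]] := r_lleaf R ed yW; exists S => //=.
  by rewrite /label yW; congr dec_alignment; move: eS; case: (m _) => [|[|[]]] //= [].
move=> c w v arcs /node_at_inner [Nw -> _]; have [|Nw' e] := r_link R Nw; first by [].
by exists (nm w), (arcs_of w); rewrite -build_node //; split=> //; apply: node_at_build.
Qed.

Lemma nm_inj z z' : nd N W z -> nd N W z' -> nm z = nm z' -> z = z'.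
Proof.
move=> nz nz' e; apply/eqP; apply/negPn/negP => /eqP ne.
by case: (r_dis build_rep nz nz' ne); rewrite e -[X in _ <= X]addn0 leq_add2l.
Qed.

Lemma uniq_flatten (T T' : eqType) (f : T -> seq T') (l : seq T) : uniq l ->
  (forall y : T, y \in l -> uniq (f y)) ->
  (forall (y z : T) a, y \in l -> z \in l -> a \in f y -> a \in f z -> y = z) -> uniq (flatten (map f l)).
Proof.
elim: l => //= y l IH /andP [ny ul] uf dis; rewrite cat_uniq uf ?inE ?eqxx //=.
rewrite IH ?andbT //; last first.
- by move=> a b c ha hb; apply: dis; rewrite inE ?ha ?hb orbT.
- by move=> a ha; apply: uf; rewrite inE ha orbT.
apply/hasPn => a /flattenP [b /mapP [z hz ->]] ha; apply/negP => hy.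
by move: ny; rewrite (dis y z a) ?inE ?eqxx ?hz ?orbT.
Qed.

(** Names below [x] are addresses of words extending [x]. Words below different children differ in
    the character after [x], and distinct nodes have distinct addresses. *)
Lemma names_build x : nd N W x -> uniq (names (build x)) /\
  forall n : nat, n \in names (build x) -> exists z, [/\ nd N W z, prefix x z & n = nm z].
Proof.
have [h] := ubnP (height - size x); elim: h x => // h IH x lh nx.
case/orP: (nx) => [Nx|xW]; last first.
  by rewrite build_leaf //=; split=> // n; rewrite inE => /eqP ->; exists x; rewrite prefix_refl.
have sub y : y \in children x -> edge N W x y /\ (uniq (names (build y)) /\
  forall n : nat, n \in names (build y) -> exists z, [/\ nd N W z, prefix y z & n = nm z]).
  move=> /(mem_children _ Nx) ed; split=> //; have [_ ny _ lxy _] := ed.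
  have ly : size y <= height by apply/height_pre/(edge_pre build_good ed).
  by apply: IH => //; apply: leq_trans (ltn_sub2l (leq_trans lxy ly) lxy) lh.
rewrite build_node //=; have -> : [seq names (a : asuffix Sigma * tree Sigma).2 | a <- arcs_of x] = [seq names (build y) | y <- children x].
  by rewrite -map_comp.
have mem (n : nat) : n \in flatten [seq names (build y) | y <- children x] ->
    exists y z, [/\ edge N W x y, nd N W z, prefix y z & n = nm z].
  case/flattenP => b /mapP [y hy ->] hn; have [ed [_ /(_ _ hn) [z [nz pz ->]]]] := sub y hy.
  by exists y, z.
split; last first.
  move=> n; rewrite inE => /orP [/eqP ->|/mem [y [z [ed nz pz ->]]]].
    by exists x; rewrite prefix_refl.
  by exists z; split=> //; have [_ _ px _ _] := ed; apply: prefix_trans px pz.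
apply/andP; split.
  apply/negP => /mem [y [z [ed nz pz e]]]; have [_ _ px lxy _] := ed.
  by move: (size_pfx pz); rewrite -(nm_inj nx nz e) leqNgt lxy.
apply: uniq_flatten; first exact: children_uniq.
  by move=> y /sub [_ []].
move=> y y' n /sub [ed [_ g]] /sub [ed' [_ g']] /g [z [nz pz ->]] /g' [z' [nz' pz' e]].
rewrite -(nm_inj nz nz' e) in pz'; have [_ _ px lx _] := ed; have [_ _ px' lx' _] := ed'.
have q := prefix_next hash px lx; have q' := prefix_next hash px' lx'.
apply: (edge_uniq build_hterm build_good ed ed' q).
by rewrite (prefix_rcons_inj (prefix_trans q pz) (prefix_trans q' pz')).
Qed.

Lemma string_at_of p (w : word) : (forall i, i < size w -> m (p + i) = code (nth hash w i)) -> string_at m p w.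
Proof.
move=> h; apply: (@eq_from_nth _ 0); rewrite !size_map size_iota // => i li.
by rewrite (nth_map 0) ?size_iota // (nth_map hash) // nth_iota // h.
Qed.

Lemma build_stored : uniq (iota a0 (size A) ++ iota d0 (size delta)) ->
  all (leq 1) (iota a0 (size A) ++ iota d0 (size delta)) ->
  stored_alignment_tree alpha beta delta gamma t s.
Proof.
move=> us /allP ps; split; first exact: build_trie.
have [[[fA fD fR] f2 f3 f4 f5] [sA sD] R _ er] := Is.
have nd0 : nd N W [::] by rewrite /nd root_N.
have [un mn] := names_build nd0.
split.
- by split.
- by rewrite fA fD; split; apply: string_at_of.
- rewrite fA fD; split.
    rewrite catA cat_uniq us andTb; apply/andP; split.
      apply/hasPn => c /flattenP [b /mapP [n /mn [z [nz _ ->]] ->]].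
      rewrite mem_iota => /andP [l1 l2]; apply/negP; rewrite mem_cat !mem_iota => /orP [] /andP [l3 l4].
        have := @r_A _ _ _ _ _ _ R z (c - a0) nz; rewrite -(ltn_add2l a0) subnKC // l4 => /(_ isT).
        by move: l1 l2; clear; lia.
      have := @r_D _ _ _ _ _ _ R z (c - d0) nz; rewrite -(ltn_add2l d0) subnKC // l4 => /(_ isT).
      by move: l1 l2; clear; lia.
    apply: uniq_cells => // n n' /mn [z [nz _ ->]] /mn [z' [nz' _ ->]] ne.
    by apply: (r_dis R nz nz') => e; rewrite e in ne.
  apply/allP => c; rewrite catA mem_cat => /orP [hc|].
    rewrite (ps c hc) andTb; move: hc; rewrite mem_cat !mem_iota => /orP [] /andP [l3 l4].
      by rewrite -(subnKC l3); apply: (r_strA R); rewrite -(ltn_add2l a0) subnKC.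
    by rewrite -(subnKC l3); apply: (r_strD R); rewrite -(ltn_add2l d0) subnKC.
  case/flattenP => b /mapP [n /mn [z [nz _ ->]] ->]; rewrite mem_iota => /andP [l1 l2].
  by have [p0 p1] := r_pos R nz; move: l1 l2 p0 p1; clear; lia.
- by rewrite fR name_build er.
exact: build_tree_at.
Qed.

End Build.

(** * Correctness and cost of the whole program *)

Lemma first_two_WA : first_two WA = first_occ A.
Proof.
apply: eq_in_find => i; rewrite mem_iota add0n => /andP [_ lt] /=.
exact: two_WA (drop_alpha_neq0 lt).
Qed.

Lemma pre_alpha W : {subset WA <= W} -> forall j, pre W (drop j alpha).
Proof.
move=> sW j; have gp : 0 < size gamma by rewrite lt0n size_eq0.
case: (ltnP j (size alpha)) => le.
  apply/preP; exists (drop j A); last exact: prefix_alpha.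
  by apply/sW/mem_WA; exists j; rewrite // size_cat ltn_addr.
rewrite drop_oversize //; apply/preP; exists (drop 0 A); last exact: prefix0s.
by apply/sW/mem_WA; exists 0; rewrite // !size_cat !addn_gt0 gp !orbT.
Qed.

Lemma gamma_WA : drop (size Y) B \in WA.
Proof.
have gp : 0 < size gamma by rewrite lt0n size_eq0.
apply/mem_WA; exists (size X); first by rewrite catA [size (_ ++ gamma)]size_cat -[X in X < _]addn0 ltn_add2l.
by rewrite !catA !drop_size_cat.
Qed.

Definition setup_cost := cmax (rJ <~ rAlphaLen `- rEll) + cmax (rOld <~ rJ) +
  cmax (rLim <~ rAlphaLen `+ rDeltaLen) +
  cmax (If (TLe (rEll `+ rBetaLen) rT) (rEll <~ rT `- rBetaLen) Skip) +
  cmax (rJ <~ rAlphaLen `- rEll) + cmax (rLim <~ rOld).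
(** Each of the two rounds of insertion accounts for 7: twice the range of the matched end, four
    times the number of suffixes, and one. *)
Definition main_cost := 2 * find_cost + 14 * insert_cost + common_unit + setup_cost.

Lemma run_main nm s : inv (br WA) WA nm None s ->
  uniq (iota a0 (size A) ++ iota d0 (size delta)) ->
  all (leq 1) (iota a0 (size A) ++ iota d0 (size delta)) ->
  runs (main #|Sigma|) s (fun T s' =>
    T <= main_cost * (size (alpha_star alpha beta delta gamma) + size delta
                      + size (gamma_hat alpha beta delta gamma) + 1) /\
    exists t', stored_alignment_tree alpha beta delta gamma t' s').
Proof.
move=> Is us ps; set n1 := first_occ A; set k := minn n1 (first_occ B).
set g := size (gamma_hat _ _ _ _); set st := size (alpha_star _ _ _ _).
have l1 : n1 <= size alpha := first_occ_le A.
have est : st = size alpha - k by exact: size_alpha_star.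
have lk : k <= n1 by exact: geq_minl.
have gp : 0 < size gamma by rewrite lt0n size_eq0.
have eY : size Y = size alpha + size delta by rewrite size_cat.
have ltB : size Y < size B by rewrite catA [size (_ ++ gamma)]size_cat -[X in X < _]addn0 ltn_add2l.
apply: runs_seq; apply: runs_impl (run_find Is WA_closed (pre_alpha (fun _ h => h))) _ => T1 s1 [sb1 e1 lT1].
rewrite first_two_WA -/n1 in e1 lT1.
have Is1 := inv_same (l := find_regs) isT sb1 Is.
apply: runs_seq; apply: runs_run => // T2 lT2; apply: runs_seq; apply: runs_run => // T3 lT3.
apply: runs_seq; apply: runs_run => // T4 lT4; set s2 := run (rLim <~ _) _.
have es2 : s2 = State (upd (upd (upd (reg s1) 8 n1) 21 n1) 16 (size Y)) (mem s1).
  have [[_ c2 _ c4 _] _ _ _ _] := Is1.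
  have es : s1 = State (reg s1) (mem s1) by case: (s1).
  by rewrite /s2 es !run_asg; ev; rewrite c2 c4 e1 eY subKn.
have sb2 : same_but [:: 8; 21; 16] s1 s2.
  rewrite es2; do 3!apply: same_upd => //; split=> //.
have Is2 := inv_same (l := [:: 8; 21; 16]) isT sb2 Is1.
have preW0 : pre WA [::] by have := pre_alpha (fun _ h => h) (size alpha); rewrite drop_size.
apply: runs_seq; apply: runs_impl (run_insert (n := n1) (lim := size Y) (E := size Y + g) Is2 WA_closed preW0 gamma_WA _ _ _ ltB _ _) _.
- by rewrite es2.
- by rewrite es2.
- by rewrite eY; apply: leq_trans l1 (leq_addr _ _).
- exact: leq_addr.
- move=> j e v /andP [_ lj] /andP [lje leB] hv pv; apply: (gamma_hat_bound lj lje leB _ pv).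
  case: hv => [|[i /andP [_ li] ->]]; [by left|right]; exists i => //.
  by rewrite ltn_eqF.
move=> T5 s3 [W [nm3 [Is3 cl3 aW eo3 lT5]]].
have sW : {subset WA <= W} by move=> v h; apply/aW; left.
apply: runs_seq; apply: runs_impl (run_find Is3 cl3 (pre_alpha sW)) _ => T6 s4 [sb4 e4 lT6].
have Is4 := inv_same (l := find_regs) isT sb4 Is3.
apply: runs_seq; apply: runs_impl (run_common Is4) _ => T7 s5 [sb5 [t [e5 te mx lT7]]].
have Is5 := inv_same (l := common_regs) isT sb5 Is4.
have lt := tail_alpha te.
have emax : st = maxn (size alpha - first_two W) (t - size beta) by exact: alpha_star_added.
apply: runs_seq; apply: runs_run => // T8 lT8; apply: runs_seq; apply: runs_run => // T9 lT9.
apply: runs_seq; apply: runs_run => // T10 lT10; set s6 := run (rLim <~ _) _.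
have e21 : reg s5 21 = n1.
  by case: sb5 => _ ->; case: sb4 => // _ ->; rewrite // eo3 es2.
have e18 : reg s5 18 = size alpha - first_two W by case: sb5 => _ ->.
have [sb6 e68 e616] : [/\ same_but [:: 18; 8; 16] s5 s6, reg s6 8 = k & reg s6 16 = n1].
  have es : s5 = State (reg s5) (mem s5) by case: (s5).
  have [[_ c2 c3 _ _] _ _ _ _] := Is5.
  have ek : size alpha - st = k by rewrite est subKn // (leq_trans lk).
  (* The conditional takes the larger of the two candidates, which is the maximum of
     [alpha_star_added]. *)
  rewrite /s6 es run_if; ev; rewrite c3 e18 e5; case: ifP => h; rewrite !run_asg ?run_skip; ev.
    rewrite e5 c3 (_ : t - size beta = st); last first.
      by rewrite emax; apply/esym/maxn_idPr; move: h; clear; lia.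
    rewrite c2 ek e21; split=> //; do 3!apply: same_upd => //; by split.
  have ea : size alpha - first_two W = st.
    by rewrite emax; apply/esym/maxn_idPl; move/negbT: h; clear; lia.
  rewrite c2 e18 ea ek e21; split=> //; do 2!apply: same_upd => //; by split.
have Is6 := inv_same (l := [:: 18; 8; 16]) isT sb6 Is5.
have lY1 : n1 <= size Y by rewrite eY; apply: leq_trans l1 (leq_addr _ _).
(* The second round stops at the suffix with which the first one began, or at [gamma] if the first
   one inserted nothing. *)
have limW : drop n1 B \in W.
  apply/aW; move: lY1; rewrite leq_eqVlt => /orP [/eqP ->|h]; first by left; exact: gamma_WA.
  by right; exists n1; rewrite // leqnn.
have preW : pre W [::] by have := pre_alpha sW (size alpha); rewrite drop_size.
apply: runs_impl (run_insert (n := k) (lim := n1) (E := size Y + g) Is6 cl3 preW limW _ _ lk _ _ _) _.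
- exact: e68.
- exact: e616.
- exact: leq_ltn_trans ltB.
- exact: leq_trans (leq_addr _ _).
- move=> j e v /andP [_ lj] /andP [lje leB] hv pv.
  apply: (gamma_hat_bound (leq_trans lj lY1) lje leB _ pv).
  case: hv => [/aW [h|[i /andP [li _] ->]]|[i /andP [_ li] ->]]; [by left|right|right]; exists i => //.
    by rewrite gtn_eqF // (leq_trans lj).
  by rewrite ltn_eqF.
move=> T11 s7 [W' [nm7 [Is7 _ aW' _ lT11]]]; split; last first.
  exists (build W' nm7 s7 [::]); apply: (build_stored (k := k) Is7) => // v; rewrite aW' aW.
  split=> [[[h|[i /andP [li li'] ->]]|[i /andP [li li'] ->]]|[h|[i /andP [li li'] ->]]].
  - by left.
  - by right; exists i; rewrite // li' (leq_trans lk).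
  - by right; exists i; rewrite // li (leq_trans li').
  - by left; left.
  by case: (ltnP i n1) => h; [right|left; right]; exists i; rewrite // ?li ?h.
set M := st + size delta + g + 1.
have M0 : 0 < M by rewrite /M addn1.
have b1 : T1 <= find_cost * M.
  by apply: leq_trans lT1 _; rewrite leq_mul2l; apply/orP; right; rewrite /M est; clear -lk l1; lia.
have b5 : T5 <= insert_cost * (7 * M).
  by apply: leq_trans lT5 _; rewrite leq_mul2l; apply/orP; right; rewrite /M est eY; clear -lk l1; lia.
have b6 : T6 <= find_cost * M.
  apply: leq_trans lT6 _; rewrite leq_mul2l; apply/orP; right.
  by have := leq_maxl (size alpha - first_two W) (t - size beta); rewrite -emax /M; clear; lia.
have b7 : T7 <= common_unit * M.
  apply: leq_trans lT7 _; rewrite leq_mul2l; apply/orP; right.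
  by move: lt; rewrite -/n1 /M est; clear -lk l1; lia.
have b11 : T11 <= insert_cost * (7 * M).
  by apply: leq_trans lT11 _; rewrite leq_mul2l; apply/orP; right; rewrite /M est eY; clear -lk l1; lia.
have b0 : T2 + (T3 + T4) + (T8 + (T9 + T10)) <= setup_cost * M.
  apply: leq_trans (leq_pmulr _ M0); rewrite /setup_cost; clear -lT2 lT3 lT4 lT8 lT9 lT10; lia.
rewrite /main_cost; clear -b0 b1 b5 b6 b7 b11; nia.
Qed.

End Algo.

Theorem theorem1 (Sigma : finType) (hash : Sigma) :
  exists (p : cmd) (C : nat),
  forall (alpha beta delta gamma : seq Sigma) (t : tree Sigma) (s : state),
    alignment hash alpha beta delta gamma ->
    stored_string_tree alpha beta delta gamma t s ->
    exists (T : nat) (t' : tree Sigma) (s' : state),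
      [/\ exec p s T s',
          T <= C * (size (alpha_star alpha beta delta gamma) + size delta
                    + size (gamma_hat alpha beta delta gamma) + 1)
        & stored_alignment_tree alpha beta delta gamma t' s'].
Proof.
exists (main #|Sigma|), (main_cost Sigma) => alpha beta delta gamma t s al st.
have [_ hg _ hA hB _ hf] := al; have [_ [_ _ [uc ac] _ _]] := st.
have [nm Is] := inv_of_stored hA st erefl erefl erefl.
rewrite catA cat_uniq in uc; have /andP [us _] := uc.
have ps : all (leq 1) (iota (reg s rA) (size (alpha ++ beta ++ gamma)) ++ iota (reg s rD) (size delta)).
  apply/allP => c hc; have /allP /(_ c) := ac.
  by rewrite catA mem_cat hc => /(_ isT) /andP [].
have [T [s' [ex [lT [t' ht]]]]] := run_main hA hB hf hg Is us ps.
by exists T, t', s'.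
Qed.
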